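(* There is an algorithm that, given stopwatch automata $\mathbb{A},\mathbb{A}'$ (over the same alphabet) with bounds $B_\mathbb{A},B_{\mathbb{A}'}$, decides whether $L(\mathbb{A})\cap L(\mathbb{A}')\neq\emptyset$ in time $O\big((\|\mathbb{A}\|\cdot\|\mathbb{A}'\|\cdot B_\mathbb{A}\cdot B_{\mathbb{A}'})^3\big)$.
   Context: A (specific) stopwatch automaton is a tuple $\mathbb{A}=(Q,\Sigma,X,\lambda,\beta,\zeta,\Delta)$ where $Q$ is a finite set of states containing two distinguished states $\mathit{start}$ and $\mathit{accept}$; $\Sigma$ is a finite nonempty alphabet; $X$ is a finite set of stopwatches; $\lambda:Q\to\Sigma$; $\beta:X\to\mathbb{N}$ assigns each stopwatch its bound; $\zeta\subseteq X\times Q$ ($x$ is active in $q$ iff $(x,q)\in\zeta$); $\Delta$ is a finite set of transitions $(q,g,\alpha,q')$ with $g$ a guard and $\alpha$ an action. An assignment is $\xi:X\to\mathbb{N}$ with $\xi(x)\le\beta(x)$. Guards are Boolean circuits taking the binary encoding of an assignment (a block of $\lceil\log(\beta(x)+1)\rceil$ bits per stopwatch) and outputting one bit; actions are Boolean circuits mapping such encodings to encodings of numbers $v_x$, the resulting assignment being $x\mapsto\min\{v_x,\beta(x)\}$. Edges $(q,\xi)\stackrel{t}{\to}(q',\xi')$ between nodes (state, assignment): either $t=0$ and some $(q,g,\alpha,q')\in\Delta$ has $\xi$ satisfying $g$ and $\alpha(\xi)=\xi'$; or $t>0$, $q=q'$, and $\xi'(x)=\min\{\xi(x)+t,\beta(x)\}$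 for $x$ active in $q$, $\xi'(x)=\xi(x)$ otherwise. A computation is a sequence $(q_0,\xi_0)\stackrel{t_0}{\to}\cdots\stackrel{t_{\ell-1}}{\to}(q_\ell,\xi_\ell)$ with $q_i\ne\mathit{accept}$ for $i<\ell$; it is initial if $q_0=\mathit{start}$ and $\xi_0\equiv0$, accepting if $q_\ell=\mathit{accept}$, and reads $\lambda(q_0)^{t_0}\cdots\lambda(q_{\ell-1})^{t_{\ell-1}}$. $L(\mathbb{A})$ is the set of words read by initial accepting computations. The bound of $\mathbb{A}$ is $B_\mathbb{A}=\prod_{x\in X}(\beta(x)+1)$, and $\|\mathbb{A}\|$ is the length of a reasonable binary encoding of $\mathbb{A}$. *)

(* Defs.v *)
From Stdlib Require List.
From mathcomp Require Import all_boot.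

Set Implicit Arguments.
Unset Strict Implicit.
Unset Printing Implicit Defensive.

(** * Binary numbers *)

(* ceil(log2 (n + 1)): the number of bits needed to write 0, ..., n. *)
Definition bitlen (n : nat) : nat := up_log 2 n.+1.

(* Least significant bit first. *)
Definition bits (w n : nat) : seq bool :=
  [seq odd (n %/ 2 ^ i) | i <- iota 0 w].

Fixpoint bits_val (s : seq bool) : nat :=
  if s is b :: s' then b + 2 * bits_val s' else 0.

(** * Boolean circuits *)

(* The wires of a circuit with n inputs are numbered 0, ..., n-1 for the inputs
   and n, n+1, ... for the gates; a gate only refers to smaller wires. *)
Inductive gate : Type :=
  | GConst of bool
  | GNot of nat
  | GAnd of nat & nat
  | GOr of nat & nat.

Definition gate_wf (n : nat) (g : gate) : bool :=
  match g with
  | GConst _ => true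
  | GNot i => i < n
  | GAnd i j | GOr i j => (i < n) && (j < n)
  end.

Fixpoint gates_wf (n : nat) (gs : seq gate) : bool :=
  if gs is g :: gs' then gate_wf n g && gates_wf n.+1 gs' else true.

Record circuit (n k : nat) : Type := Circuit {
  gates : seq gate;
  outputs : k.-tuple nat;
  _ : gates_wf n gates;
  _ : all (fun i => i < n + size gates) outputs
}.

Definition gate_val (ws : seq bool) (g : gate) : bool :=
  match g with
  | GConst b => b
  | GNot i => ~~ nth false ws i
  | GAnd i j => nth false ws i && nth false ws j
  | GOr i j => nth false ws i || nth false ws j
  end.

Definition wires (v : seq bool) (gs : seq gate) : seq bool :=
  foldl (fun ws g => rcons ws (gate_val ws g)) v gs.

Definition circuit_eval n k (C : circuit n k) (v : seq bool) : seq bool :=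
  [seq nth false (wires v (gates C)) i | i <- outputs C].

(** * Stopwatch automata *)

Definition blocks nX (beta : {ffun 'I_nX -> nat}) : seq nat :=
  [seq bitlen (beta x) | x <- enum 'I_nX].

Definition nbits nX (beta : {ffun 'I_nX -> nat}) : nat := sumn (blocks beta).

Record transition (nQ w : nat) : Type := Transition {
  source : 'I_nQ;
  guard : circuit w 1;
  action : circuit w w;
  target : 'I_nQ
}.

(* Stopwatch automata over the (nonempty) alphabet {0, ..., m}, with states
   {0, ..., nQ - 1} and stopwatches {0, ..., nX - 1}. *)
Record stopwatch_automaton (m : nat) : Type := StopwatchAutomaton {
  nQ : nat;
  start : 'I_nQ;
  accept : 'I_nQ;
  nX : nat;
  lambda : {ffun 'I_nQ -> 'I_m.+1};
  beta : {ffun 'I_nX -> nat};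
  zeta : {set 'I_nX * 'I_nQ};
  Delta : seq (transition nQ (nbits beta))
}.

Section Semantics.
Variables (m : nat) (A : stopwatch_automaton m).

Definition assignment : Type := {dffun forall x : 'I_(nX A), 'I_(beta A x).+1}.

Definition node : Type := ('I_(nQ A) * assignment)%type.

Definition clip (b v : nat) : 'I_b.+1 := Ordinal (geq_minr v b : minn v b < b.+1).

Definition assignment_bits (xi : assignment) : seq bool :=
  flatten [seq bits (bitlen (beta A x)) (xi x) | x <- enum 'I_(nX A)].

Definition satisfies (xi : assignment)
    (g : circuit (nbits (beta A)) 1) : Prop :=
  circuit_eval g (assignment_bits xi) = [:: true].

Definition act (a : circuit (nbits (beta A)) (nbits (beta A)))
    (xi : assignment) : assignment :=
  let out := reshape (blocks (beta A)) (circuit_eval a (assignment_bits xi)) in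
  finfun (fun x : 'I_(nX A) => clip (beta A x) (bits_val (nth [::] out x))).

Definition elapse (q : 'I_(nQ A)) (t : nat) (xi : assignment) : assignment :=
  finfun (fun x : 'I_(nX A) =>
    if (x, q) \in zeta A then clip (beta A x) (xi x + t) else xi x).

Inductive edge : nat -> node -> node -> Prop :=
  | edge_transition (d : transition (nQ A) (nbits (beta A))) (xi : assignment) :
      List.In d (Delta A) -> satisfies xi (guard d) ->
      edge 0 (source d, xi) (target d, act (action d) xi)
  | edge_elapse (t : nat) (q : 'I_(nQ A)) (xi : assignment) :
      0 < t -> edge t (q, xi) (q, elapse q t xi).

(* computation n w n': some computation from n to n' reads w. *)
Inductive computation : node -> seq 'I_m.+1 -> node -> Prop :=
  | computation_nil (n : node) : computation n [::] n
  | computation_step (n n' n'' : node) (t : nat) (w : seq 'I_m.+1) :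
      n.1 != accept A -> edge t n n' -> computation n' w n'' ->
      computation n (nseq t (lambda A n.1) ++ w) n''.

Definition zero_assignment : assignment :=
  finfun (fun x : 'I_(nX A) => ord0 : 'I_(beta A x).+1).

Definition language (w : seq 'I_m.+1) : Prop :=
  exists2 n : node, computation (start A, zero_assignment) w n & n.1 = accept A.

Definition bound : nat := \prod_(x < nX A) (beta A x).+1.

End Semantics.

(** * Binary encoding of automata *)

(* Self-delimiting: each bit is preceded by true, and false ends the number. *)
Definition nat_code (n : nat) : seq bool :=
  flatten [seq [:: true; b] | b <- bits (bitlen n) n] ++ [:: false].

Definition gate_code (g : gate) : seq nat :=
  match g with
  | GConst b => [:: 0; nat_of_bool b; 0]
  | GNot i => [:: 1; i; 0]
  | GAnd i j => [:: 2; i; j]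
  | GOr i j => [:: 3; i; j]
  end.

Definition circuit_code n k (C : circuit n k) : seq nat :=
  size (gates C) :: flatten (map gate_code (gates C)) ++ k :: outputs C.

Definition transition_code nQ w (d : transition nQ w) : seq nat :=
  [:: val (source d), val (target d) &
     circuit_code (guard d) ++ circuit_code (action d)].

Definition automaton_code m (A : stopwatch_automaton m) : seq nat :=
  [:: m.+1; nQ A; val (start A); val (accept A); nX A]
  ++ [seq val (lambda A q) | q <- enum 'I_(nQ A)]
  ++ [seq beta A x | x <- enum 'I_(nX A)]
  ++ #|zeta A| :: flatten [seq [:: val p.1; val p.2] | p <- enum (zeta A)]
  ++ size (Delta A) :: flatten (map (@transition_code _ _) (Delta A)).

Definition encode m (A : stopwatch_automaton m) : seq bool :=
  flatten (map nat_code (automaton_code A)).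

Definition encoding_length m (A : stopwatch_automaton m) : nat :=
  size (encode A).

(** * Random access machines *)

(* The RAM of Cook and Reckhow with logarithmic cost, over natural numbers.
   There are infinitely many registers, initially 0, and a read-only one-way
   input tape of bits.  Since every instruction costs at least 1, the number of
   executed instructions is at most the logarithmic cost. *)
Inductive instruction : Type :=
  | IConst of nat & nat        (* r_i := c *)
  | IAdd of nat & nat & nat    (* r_i := r_j + r_k *)
  | ISub of nat & nat & nat    (* r_i := r_j - r_k, truncated at 0 *)
  | ILoad of nat & nat         (* r_i := r_(r_j) *)
  | IStore of nat & nat        (* r_(r_i) := r_j *)
  | IRead of nat               (* r_i := next input bit, 2 at the end of input *)
  | IJumpPos of nat & nat      (* go to instruction l if r_i > 0 *)
  | IHalt of bool.             (* stop with the given answer *)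

Definition program : Type := seq instruction.

Record config : Type := Config {
  pc : nat;
  regs : nat -> nat;
  input : seq bool
}.

Definition update (r : nat -> nat) (i v : nat) : nat -> nat :=
  fun j => if j == i then v else r j.

(* The number of binary digits of n, with one digit for 0. *)
Definition loglen (n : nat) : nat := (trunc_log 2 n).+1.

(* The logarithmic cost of an instruction and the configuration it leads to. *)
Definition exec (I : instruction) (s : config) : option (nat * config) :=
  let r := regs s in
  let goon c r' := Some (c, Config (pc s).+1 r' (input s)) in
  match I with
  | IConst i c => goon (loglen c) (update r i c)
  | IAdd i j k => goon (loglen (r j) + loglen (r k)) (update r i (r j + r k))
  | ISub i j k => goon (loglen (r j) + loglen (r k)) (update r i (r j - r k))
  | ILoad i j => goon (loglen (r j) + loglen (r (r j))) (update r i (r (r j)))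
  | IStore i j => goon (loglen (r i) + loglen (r j)) (update r (r i) (r j))
  | IRead i =>
      Some (1, Config (pc s).+1 (update r i (head 2 (map nat_of_bool (input s))))
                 (behead (input s)))
  | IJumpPos i l =>
      Some (loglen (r i),
            Config (if 0 < r i then l else (pc s).+1) r (input s))
  | IHalt _ => None
  end.

(* From s, the program P halts with answer b after total cost t; running past
   the end of P is not halting. *)
Inductive halts_from (P : program) : config -> bool -> nat -> Prop :=
  | halts_now (s : config) (b : bool) :
      onth P (pc s) = Some (IHalt b) -> halts_from P s b 1
  | halts_later (s s' : config) (I : instruction) (c : nat) (b : bool) (t : nat) :
      onth P (pc s) = Some I -> exec I s = Some (c, s') ->
      halts_from P s' b t -> halts_from P s b (c + t).

Definition halts (P : program) (w : seq bool) (b : bool) (t : nat) : Prop :=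
  halts_from P (Config 0 (fun _ => 0) w) b t.

(* Main.v *)
(* Splitting elapse steps into unit steps turns an automaton into a finite graph
   on its nodes (state, assignment): arcs reading one letter, silent arcs, and
   an arc from every accepting node to a sink. Letting silent arcs be matched by
   idle ones, the two languages meet iff the pair of sinks is reachable in the
   product graph, whose arcs are the pairs of equally labelled arcs.

   With N the product of the encoding lengths and bounds, the product graph has
   O(N) nodes and O(N) arcs, so relaxing every arc once per node finds the
   reachable pairs in O(N^2) operations; building the graphs of the two automata
   by evaluating the circuits at all assignments is not more expensive. All
   numbers that occur are at most 2^O(N), so an operation has logarithmic cost
   O(N), which gives O(N^3).

   The machine is programmed in a language with arrays and bounded loops, whose
   semantics and cost are therefore total functions of the initial store. *)
Require Import Defs.
From mathcomp Require Import all_boot.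
From mathcomp Require Import zify.

Set Implicit Arguments.
Unset Strict Implicit.
Unset Printing Implicit Defensive.

(** The O(N) logarithmic cost of an instruction presupposes a bound on all register contents, and
    the step count itself supplies it: only constants and additions create new largest values, and
    an addition pays for what it creates beyond a threshold [K]. This threshold meets opposite
    demands. Decoding a binary number forms place values up to 2 to the input length, which must not
    be paid for, so [K] is exponential; yet its logarithm must remain O(N).

    The machine neither multiplies nor divides. Products are repeated additions and quotients are
    found by counting, which is affordable because the loop counts are states, stopwatch values and
    ranks of assignments. For the same reason pairs of nodes are formed by addition: the identifiers
    of the second automaton are multiples of the node count of the first, so a sum of two
    identifiers determines both. The sinks have identifier 0, so the final question is whether 0 is
    marked. *)

Inductive var : Type :=
  | vLEN | vIP | vBIT | vPEND | vACC | vWT | vCN | vT | vU | vDV | vDB | vDQ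
  | vDR | vP | vNQ | vST | vAC | vNX | vPL | vPB | vPZ | vNZ | vPD | vND | vX
  | vB | vM | vM0 | vBB | vBW | vPW | vSTR | vE | vEC | vNW | vQ | vZ | vZX
  | vZQ | vVV | vEID | vEW | vED | vPT | vSRC | vTGT | vNG | vOP | vI1 | vI2
  | vK | vO | vG | vSID | vLT | vGV | vE0 | vS0 | vS1 | vJ | vJ2 | vL1 | vL2
  | vRES.

Inductive array : Type :=
  | aINP | aCODE | aLAB | aSRC | aDST | aMARK | aWGT | aBLEN | aDIG | aDIG2
  | aWIRE | aOUT.

Definition vnum (x : var) : nat :=
  match x with
  | vLEN => 0 | vIP => 1 | vBIT => 2 | vPEND => 3 | vACC => 4 | vWT => 5
  | vCN => 6 | vT => 7 | vU => 8 | vDV => 9 | vDB => 10 | vDQ => 11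
  | vDR => 12 | vP => 13 | vNQ => 14 | vST => 15 | vAC => 16 | vNX => 17
  | vPL => 18 | vPB => 19 | vPZ => 20 | vNZ => 21 | vPD => 22 | vND => 23
  | vX => 24 | vB => 25 | vM => 26 | vM0 => 27 | vBB => 28 | vBW => 29
  | vPW => 30 | vSTR => 31 | vE => 32 | vEC => 33 | vNW => 34 | vQ => 35
  | vZ => 36 | vZX => 37 | vZQ => 38 | vVV => 39 | vEID => 40 | vEW => 41
  | vED => 42 | vPT => 43 | vSRC => 44 | vTGT => 45 | vNG => 46 | vOP => 47
  | vI1 => 48 | vI2 => 49 | vK => 50 | vO => 51 | vG => 52 | vSID => 53
  | vLT => 54 | vGV => 55 | vE0 => 56 | vS0 => 57 | vS1 => 58 | vJ => 59
  | vJ2 => 60 | vL1 => 61 | vL2 => 62 | vRES => 63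
  end.

Definition anum (a : array) : nat :=
  match a with
  | aINP => 0 | aCODE => 1 | aLAB => 2 | aSRC => 3 | aDST => 4 | aMARK => 5
  | aWGT => 6 | aBLEN => 7 | aDIG => 8 | aDIG2 => 9 | aWIRE => 10
  | aOUT => 11
  end.

Definition vars_list : seq var :=
  [::
  vLEN; vIP; vBIT; vPEND; vACC; vWT; vCN; vT; vU; vDV; vDB; vDQ; vDR; vP;
  vNQ; vST; vAC; vNX; vPL; vPB; vPZ; vNZ; vPD; vND; vX; vB; vM; vM0; vBB;
  vBW; vPW; vSTR; vE; vEC; vNW; vQ; vZ; vZX; vZQ; vVV; vEID; vEW; vED; vPT;
  vSRC; vTGT; vNG; vOP; vI1; vI2; vK; vO; vG; vSID; vLT; vGV; vE0; vS0; vS1;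
  vJ; vJ2; vL1; vL2; vRES].

Definition arrays_list : seq array :=
  [::
  aINP; aCODE; aLAB; aSRC; aDST; aMARK; aWGT; aBLEN; aDIG; aDIG2; aWIRE; aOUT].

Lemma vnumK : cancel vnum (nth vLEN vars_list).
Proof. by case. Qed.

Lemma vnum_lt x : vnum x < 100.
Proof. by case: x. Qed.

Lemma anumK : cancel anum (nth aINP arrays_list).
Proof. by case. Qed.

Lemma anum_lt a : anum a < 15.
Proof. by case: a. Qed.

(** Comparing numbers makes equality of concrete names reduce, so that the frame conditions of the
    program logic below hold by computation. *)
Definition veq (x y : var) : bool := Nat.eqb (vnum x) (vnum y).
Definition aeq (a b : array) : bool := Nat.eqb (anum a) (anum b).

Lemma veqP x y : reflect (x = y) (veq x y).
Proof.
apply: (iffP idP) => [/PeanoNat.Nat.eqb_eq h|->]; last exact/PeanoNat.Nat.eqb_eq.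
exact: (can_inj vnumK).
Qed.

Lemma aeqP a b : reflect (a = b) (aeq a b).
Proof.
apply: (iffP idP) => [/PeanoNat.Nat.eqb_eq h|->]; last exact/PeanoNat.Nat.eqb_eq.
exact: (can_inj anumK).
Qed.

(** * A loop language with arrays: semantics, cost, and the bound on values *)

Record store : Type := Store { vars : var -> nat; arr : array -> nat -> nat }.

Definition setv (s : store) (x : var) (v : nat) : store :=
  Store (fun y => if veq y x then v else vars s y) (arr s).

Definition seta (s : store) (a : array) (i v : nat) : store :=
  Store (vars s)
    (fun b => if aeq b a then (fun j => if j == i then v else arr s a j)
              else arr s b).

Inductive atom : Type := Var of var | Cst of nat.

Coercion Var : var >-> atom.
Coercion Cst : nat >-> atom.

Inductive cmd : Type :=
  | Skip
  | Mov of var & atom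
  | Add of var & atom & atom
  | Sub of var & atom & atom
  | Ld of var & array & atom
  | Sto of array & atom & atom
  | Seq of cmd & cmd
  | If of atom & cmd & cmd
  | For of atom & cmd.

Definition aval (s : store) (a : atom) : nat :=
  match a with Var x => vars s x | Cst c => c end.

(** A constant of the program text is charged its value because, like an addition, it may create a
    new largest number. *)
Definition acost (a : atom) : nat := if a is Cst c then c else 0.

Fixpoint rep (f : store -> store) (n : nat) (s : store) : store :=
  if n is n'.+1 then rep f n' (f s) else s.

Fixpoint rep_cost (f : store -> store) (g : store -> nat) (n : nat) (s : store) :
    nat :=
  if n is n'.+1 then (g s).+1 + rep_cost f g n' (f s) else 0.

Fixpoint sem (c : cmd) (s : store) : store :=
  match c with
  | Skip => s
  | Mov x a => setv s x (aval s a)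
  | Add x a b => setv s x (aval s a + aval s b)
  | Sub x a b => setv s x (aval s a - aval s b)
  | Ld x y a => setv s x (arr s y (aval s a))
  | Sto y a b => seta s y (aval s a) (aval s b)
  | Seq c d => sem d (sem c s)
  | If a c d => if 0 < aval s a then sem c s else sem d s
  | For a c => rep (sem c) (aval s a) s
  end.

(* An addition is charged so much that no value ever exceeds K plus the total
   charge, while an addition whose result is at most K costs 1 only. *)
Fixpoint cost (K : nat) (c : cmd) (s : store) : nat :=
  match c with
  | Skip => 0
  | Mov _ a | Ld _ _ a => (acost a).+1
  | Add _ a b => (acost a + acost b
                  + minn (aval s b) (aval s a + aval s b - K)).+1
  | Sub _ a b | Sto _ a b => (acost a + acost b).+1
  | Seq c d => cost K c s + cost K d (sem c s)
  | If a c d =>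
      (acost a + if 0 < aval s a then cost K c s else cost K d s).+1
  | For a c => (acost a + rep_cost (sem c) (cost K c) (aval s a) s).+1
  end.

Definition bounded (M : nat) (s : store) : Prop :=
  (forall x, vars s x <= M) /\ (forall a i, arr s a i <= M).

Lemma bounded_le M N s : M <= N -> bounded M s -> bounded N s.
Proof.
by move=> h [hv ha]; split=> *; apply: leq_trans h; [apply: hv | apply: ha].
Qed.

Lemma bounded_setv M s x v : bounded M s -> v <= M -> bounded M (setv s x v).
Proof. by case=> hv ha h; split=> //= y; case: ifP. Qed.

Lemma bounded_seta M s a i v : bounded M s -> v <= M -> bounded M (seta s a i v).
Proof. by case=> hv ha h; split=> //= b j; case: ifP => // _; case: ifP. Qed.

Lemma aval_le M s a : bounded M s -> aval s a <= M + acost a.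
Proof. by case=> hv _; case: a => [x|c] /=; [rewrite addn0 | apply: leq_addl]. Qed.

(** For an addition, either argument of the minimum suffices: up to the charge for constants, the
    sum is at most [M] plus the second operand, and it is at most [K <= M] plus its excess over [K].
    The bound [M] is quantified inside the induction because it grows along a sequence and from one
    round of a loop to the next. *)
Lemma bounded_sem K c : forall M s, K <= M -> bounded M s ->
  bounded (M + cost K c s) (sem c s).
Proof.
have W M n s : bounded M s -> bounded (M + n) s by apply/bounded_le/leq_addr.
elim: c => [|x a|x a b|x a b|x y a|y a b|c IHc d IHd|a c IHc d IHd|a c IHc]
  M s hK hb /=; have hv := aval_le _ hb.
- exact: W.
- by apply: bounded_setv; [apply: W | have := hv a; lia].
- apply: bounded_setv; first exact: W.
  case: a b => [x1|c1] [x2|c2] /=; have := hb.1; try (move=> h; have := h x1);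
  try (move=> h; have := h x2); rewrite /=; lia.
- by apply: bounded_setv; [apply: W | have := hv a; lia].
- apply: bounded_setv; first exact: W.
  by apply: (leq_trans (hb.2 _ _)); apply: leq_addr.
- by apply: bounded_seta; [apply: W | have := hv b; lia].
- rewrite addnA; apply: IHd; last exact: IHc.
  by apply: leq_trans hK _; apply: leq_addr.
- case: ifP => _; [have := IHc _ _ hK hb | have := IHd _ _ hK hb];
    by apply: bounded_le; lia.
- apply: (@bounded_le (M + rep_cost (sem c) (cost K c) (aval s a) s)); first lia.
  move: (aval s a) => n.
  elim: n M s hK hb {hv} => [|n IHn] M s hK hb /=; first by rewrite addn0.
  apply: (@bounded_le ((M + cost K c s) +
                       rep_cost (sem c) (cost K c) n (sem c s))); first lia.
  by apply: IHn; [lia | apply: IHc].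
Qed.

(** * Compilation to a random access machine *)

(** Memory layout: variables lie below 100, temporaries are 100 to 103, and the addresses from 128
    on are divided by their residue modulo 16. Residues up to 14 are for arrays, and residue 15 (143
    = 128 + 15) is for loop counters, so both have unlimited room. *)
Definition tmp0 := 100.
Definition tmp1 := 101.
Definition tmp2 := 102.
Definition tmp3 := 103.
Definition raddr (a : array) (i : nat) : nat := 128 + anum a + 16 * i.
Definition cnt (d : nat) : nat := 143 + 16 * d.

(** The machine has no direct move between registers; a variable is added to a cleared register
    instead. *)
Definition load_atom (t : nat) (a : atom) : program :=
  match a with
  | Var x => [:: IConst t 0; IAdd t (vnum x) t]
  | Cst c => [:: IConst t c]
  end.

(** Four doublings produce the factor 16 of [raddr]. *)
Definition load_addr (y : array) (a : atom) : program :=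
  load_atom tmp0 a ++
  [:: IAdd tmp0 tmp0 tmp0; IAdd tmp0 tmp0 tmp0; IAdd tmp0 tmp0 tmp0;
      IAdd tmp0 tmp0 tmp0; IConst tmp1 (128 + anum y); IAdd tmp0 tmp0 tmp1].

(* d is the loop nesting depth, which selects the loop counter, and l the
   address of the first instruction. *)
Fixpoint compile (d l : nat) (c : cmd) : program :=
  match c with
  | Skip => [::]
  (* The addition lets x occur in a. *)
  | Mov x a => load_atom tmp0 a ++ [:: IConst tmp1 0; IAdd (vnum x) tmp0 tmp1]
  | Add x a b =>
      load_atom tmp0 a ++ load_atom tmp1 b ++ [:: IAdd (vnum x) tmp0 tmp1]
  | Sub x a b =>
      load_atom tmp0 a ++ load_atom tmp1 b ++ [:: ISub (vnum x) tmp0 tmp1]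
  | Ld x y a => load_addr y a ++ [:: ILoad (vnum x) tmp0]
  | Sto y a b => load_addr y a ++ load_atom tmp1 b ++ [:: IStore tmp0 tmp1]
  | Seq c1 c2 =>
      let p1 := compile d l c1 in p1 ++ compile d (l + size p1) c2
  | If a c1 c2 =>
      let pa := load_atom tmp0 a in
      let p2 := compile d (l + size pa + 1) c2 in
      let l1 := l + size pa + 1 + size p2 + 2 in
      let p1 := compile d l1 c1 in
      pa ++ IJumpPos tmp0 l1 ::
      p2 ++ IConst tmp1 1 :: IJumpPos tmp1 (l1 + size p1) :: p1
  | For a c =>
      let pa := load_atom (cnt d) a in
      let l0 := l + size pa in
      let p := compile d.+1 (l0 + 3) c in
      pa ++ [:: IJumpPos (cnt d) (l0 + 3); IConst tmp1 1;
                IJumpPos tmp1 (l0 + 3 + size p + 3)] ++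
      p ++ [:: IConst tmp1 1; ISub (cnt d) (cnt d) tmp1; IJumpPos tmp1 l0]
  end.

Definition code_at (P : program) (l : nat) (p : program) : Prop :=
  exists P1 P2, P = P1 ++ p ++ P2 /\ size P1 = l.

Lemma code_at_cat P l p q :
  code_at P l (p ++ q) -> code_at P l p /\ code_at P (l + size p) q.
Proof.
move=> [P1 [P2 [-> <-]]]; split.
- by exists P1, (q ++ P2); rewrite -catA.
- by exists (P1 ++ p), P2; rewrite size_cat -!catA.
Qed.

Lemma code_at_cons P l I q :
  code_at P l (I :: q) -> onth P l = Some I /\ code_at P l.+1 q.
Proof.
move=> [P1 [P2 [-> <-]]]; split.
- by rewrite onth_cat ltnn subnn.
- by exists (rcons P1 I), P2; rewrite size_rcons cat_rcons.
Qed.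

(** Execution in continuation form: a halting run from [s'] extends backwards to one from [s]. This
    composes like reachability, allows upper bounds in place of exact costs, and ends directly in
    [halts_from]. *)
Definition steps (P : program) (s s' : config) (u : nat) : Prop :=
  forall b t, halts_from P s' b t ->
  exists2 t', halts_from P s b t' & t' <= u + t.

Lemma steps_refl P s : steps P s s 0.
Proof. by move=> b t h; exists t. Qed.

Lemma steps_trans P s2 s1 s3 u v :
  steps P s1 s2 u -> steps P s2 s3 v -> steps P s1 s3 (u + v).
Proof.
move=> h12 h23 b t /h23 [t1 /h12 [t2 h le2] le1].
by exists t2 => //; lia.
Qed.

Lemma steps_le P s1 s2 u v : u <= v -> steps P s1 s2 u -> steps P s1 s2 v.
Proof. by move=> h hs b t /hs [t' h' le']; exists t' => //; lia. Qed.

Lemma steps1 P s s' I k :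
  onth P (pc s) = Some I -> exec I s = Some (k, s') -> steps P s s' k.
Proof. by move=> h1 h2 b t h; exists (k + t) => //; apply: halts_later h1 h2 h. Qed.

Lemma loglen_le a b : a <= b -> loglen a <= loglen b.
Proof. by move=> h; rewrite /loglen ltnS; apply: leq_trunc_log. Qed.

Definition rbounded (R : nat) (r : nat -> nat) : Prop := forall j, r j <= R.

Lemma rbounded_update R r i v :
  rbounded R r -> v <= R -> rbounded R (update r i v).
Proof. by move=> h hv j; rewrite /update; case: ifP. Qed.

Definition result (I : instruction) (r : nat -> nat) : option (nat * nat) :=
  match I with
  | IConst i c => Some (i, c)
  | IAdd i j k => Some (i, r j + r k)
  | ISub i j k => Some (i, r j - r k)
  | ILoad i j => Some (i, r (r j))
  | IStore i j => Some (r i, r j)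
  | _ => None
  end.

Lemma steps_result R P l I r inp i v :
  onth P l = Some I -> rbounded R r -> result I r = Some (i, v) -> v <= R ->
  steps P (Config l r inp) (Config l.+1 (update r i v) inp) (2 * loglen R).
Proof.
move=> hI hr hv hR; have L j : loglen (r j) <= loglen R by apply/loglen_le/hr.
have L' := loglen_le hR.
by case: I hI hv => //= [i' c|i' j k|i' j k|i' j|i' j] hI [? ?]; subst;
  apply: steps_le (steps1 (s := Config l r inp) hI erefl); rewrite mul2n -addnn;
  do ?apply: leq_add => //; apply: leq_trans L' _; apply: leq_addr.
Qed.

Lemma steps_jump R P l i l' r inp :
  onth P l = Some (IJumpPos i l') -> rbounded R r ->
  steps P (Config l r inp) (Config (if 0 < r i then l' else l.+1) r inp)
    (2 * loglen R).
Proof.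
move=> hI hr; apply: steps_le (steps1 (s := Config l r inp) hI erefl).
by apply: (leq_trans (loglen_le (hr i))); rewrite mul2n -addnn leq_addr.
Qed.

Definition agrees (s : store) (r : nat -> nat) : Prop :=
  (forall x, r (vnum x) = vars s x) /\ (forall a i, r (raddr a i) = arr s a i).

(** Registers that represent no part of a store: temporaries and loop counters. *)
Definition hidden (j : nat) : Prop :=
  (forall x, vnum x != j) /\ (forall a i, raddr a i != j).

Lemma hidden_tmp j : 100 <= j < 128 -> hidden j.
Proof.
move=> hj; split=> [x|a i]; first by have := vnum_lt x; lia.
by rewrite /raddr; lia.
Qed.

Lemma hidden_cnt d : hidden (cnt d).
Proof.
rewrite /cnt; split=> [x|a i]; first by have := vnum_lt x; lia.
by rewrite /raddr; have := anum_lt a; lia.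
Qed.

Lemma agrees_hidden s r j v : hidden j -> agrees s r -> agrees s (update r j v).
Proof.
move=> [h1 h2] [hv ha]; split=> [x|a i]; rewrite /update.
- by rewrite (negbTE (h1 x)).
- by rewrite (negbTE (h2 a i)).
Qed.

Lemma agrees_setv s r x v :
  agrees s r -> agrees (setv s x v) (update r (vnum x) v).
Proof.
move=> [hv ha]; split=> [y|a i]; rewrite /update /=.
- case: veqP => [->|hn]; first by rewrite eqxx.
  rewrite ifN ?hv //; apply/eqP => h; apply: hn; exact: (can_inj vnumK).
- by rewrite ifN ?ha // /raddr; have := vnum_lt x; lia.
Qed.

Lemma agrees_seta s r a i v :
  agrees s r -> agrees (seta s a i v) (update r (raddr a i) v).
Proof.
move=> [hv ha]; split=> [x|b j]; rewrite /update /=.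
- by rewrite ifN ?hv // /raddr; have := vnum_lt x; lia.
- case: aeqP => [->|hn].
    by rewrite ha /raddr eqn_add2l eqn_mul2l.
  rewrite ifN ?ha //; apply/eqP => h; apply: hn; apply: (can_inj anumK).
  by move: h; rewrite /raddr; have := anum_lt a; have := anum_lt b; lia.
Qed.

Lemma load_atom_steps R P l t a s r inp :
  code_at P l (load_atom t a) -> hidden t -> agrees s r -> rbounded R r ->
  aval s a <= R ->
  exists r', [/\ steps P (Config l r inp) (Config (l + size (load_atom t a)) r' inp)
                   (4 * loglen R),
    r' t = aval s a, forall j, j != t -> r' j = r j, agrees s r' & rbounded R r'].
Proof.
case: a => [x|c] hc ht hs hr hv; rewrite /load_atom /size.
- have [h1 /code_at_cons [h2 _]] := code_at_cons hc.
  have hr' : rbounded R (update r t 0) by apply: rbounded_update.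
  have Ex : update r t 0 (vnum x) + update r t 0 t = vars s x.
    by rewrite /update eqxx (negbTE (ht.1 x)) addn0; case: hs.
  exists (update (update r t 0) t (vars s x)); split.
  + have -> : 4 * loglen R = 2 * loglen R + 2 * loglen R by lia.
    have -> : l + 2 = l.+2 by lia.
    have st1 := steps_result (inp := inp) h1 hr erefl (leq0n R).
    by apply: (steps_trans st1 (steps_result (inp := inp) h2 hr' _ hv)); rewrite /= Ex.
  + by rewrite /update eqxx.
  + by move=> j hj; rewrite /update (negbTE hj).
  + by do 2!apply: agrees_hidden => //.
  + exact: rbounded_update.
- have [h1 _] := code_at_cons hc; exists (update r t c); split.
  + have -> : l + 1 = l.+1 by lia.
    by apply: (steps_le _ (steps_result (inp := inp) h1 hr erefl hv)); lia.
  + by rewrite /update eqxx.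
  + by move=> j hj; rewrite /update (negbTE hj).
  + exact: agrees_hidden.
  + exact: rbounded_update.
Qed.

Lemma load_addr_steps R P l y a s r inp :
  code_at P l (load_addr y a) -> agrees s r -> rbounded R r ->
  raddr y (aval s a) <= R ->
  exists r', [/\ steps P (Config l r inp) (Config (l + size (load_addr y a)) r' inp)
                   (16 * loglen R),
    r' tmp0 = raddr y (aval s a), forall d, r' (cnt d) = r (cnt d),
    agrees s r' & rbounded R r'].
Proof.
move=> /code_at_cat [hc hd] hs hr hv.
have hv1 : aval s a <= R by move: hv; rewrite /raddr; lia.
have [r1 [st1 E1 F1 A1 B1]] :=
  load_atom_steps inp hc (@hidden_tmp tmp0 isT) hs hr hv1.
have [h1 hd1] := code_at_cons hd; have [h2 hd2] := code_at_cons hd1.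
have [h3 hd3] := code_at_cons hd2; have [h4 hd4] := code_at_cons hd3.
have [h5 hd5] := code_at_cons hd4; have [h6 _] := code_at_cons hd5.
rewrite /raddr in hv.
have dbl l' r' v (h : onth P l' = Some (IAdd tmp0 tmp0 tmp0)) :
    agrees s r' -> rbounded R r' -> r' tmp0 = v -> v + v <= R ->
    exists r'',
    [/\ steps P (Config l' r' inp) (Config l'.+1 r'' inp) (2 * loglen R),
      r'' tmp0 = v + v, forall j, j != tmp0 -> r'' j = r' j, agrees s r'' &
      rbounded R r''].
  move=> A B E le; exists (update r' tmp0 (v + v)); split.
  - by apply: (steps_result h B); rewrite /= ?E.
  - by rewrite /update eqxx.
  - by move=> j hj; rewrite /update (negbTE hj).
  - by apply: agrees_hidden => //; apply: hidden_tmp.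
  - exact: rbounded_update.
have [r2 [st2 E2 F2 A2 B2]] := dbl _ _ _ h1 A1 B1 E1 ltac:(lia).
have [r3 [st3 E3 F3 A3 B3]] := dbl _ _ _ h2 A2 B2 E2 ltac:(lia).
have [r4 [st4 E4 F4 A4 B4]] := dbl _ _ _ h3 A3 B3 E3 ltac:(lia).
have [r5 [st5 E5 F5 A5 B5]] := dbl _ _ _ h4 A4 B4 E4 ltac:(lia).
have st6 := steps_result (inp := inp) h5 B5 erefl (ltac:(lia) : 128 + anum y <= R).
set r6 := update r5 _ _ in st6.
have B6 : rbounded R r6 by apply: rbounded_update => //; lia.
have A6 : agrees s r6 by apply: agrees_hidden => //; apply: hidden_tmp.
have E6 : r6 tmp0 + r6 tmp1 = raddr y (aval s a).
  by rewrite /r6 {1 2}/update /= E5 /raddr; lia.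
have st7 : steps P _ (Config _ (update r6 tmp0 (raddr y (aval s a))) inp) _ :=
  steps_result (i := tmp0) (v := raddr y (aval s a)) (inp := inp) h6 B6
    ltac:(by rewrite /= E6) ltac:(rewrite /raddr; lia).
exists (update r6 tmp0 (raddr y (aval s a))); split.
- have -> : l + size (load_addr y a) = (l + size (load_atom tmp0 a)).+4.+2.
    by rewrite size_cat /=; lia.
  apply: (steps_le _ (steps_trans st1 (steps_trans st2 (steps_trans st3
    (steps_trans st4 (steps_trans st5 (steps_trans st6 st7))))))); lia.
- by rewrite /update eqxx.
- move=> d; have c0 : cnt d == tmp0 = false by rewrite /cnt /tmp0; lia.
  have c1 : cnt d == tmp1 = false by rewrite /cnt /tmp1; lia.
  by rewrite /r6 /update c0 c1 F5 ?F4 ?F3 ?F2 ?F1 ?c0.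
- by apply: agrees_hidden => //; apply: hidden_tmp.
- by apply: rbounded_update => //; rewrite /raddr; lia.
Qed.

(** Only the counters of the enclosing loops, those of depth below [d], must survive; the code
    itself may use the deeper ones. *)
Definition sim (P : program) (R d l : nat) (p : program) (k : nat) (s' : store)
    (r : nat -> nat) (inp : seq bool) : Prop :=
  exists r', [/\ steps P (Config l r inp) (Config (l + size p) r' inp)
                   (k * (30 * loglen R)),
    forall d', d' < d -> r' (cnt d') = r (cnt d'), agrees s' r' & rbounded R r'].

(** [T] is the charge accumulated before the command, so [K + T] bounds the current values and [M]
    all values to come. A cell with index at most [M] has an address below [200 + 16 * M], hence
    this is a bound for the computed addresses too. The factor 30 is generous: the costliest basic
    command, [Sto], needs 22. *)
Lemma compile_sim K M P inp c : forall d l s r T,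
  code_at P l (compile d l c) -> agrees s r ->
  bounded (K + T) s -> K + T + cost K c s <= M ->
  rbounded (200 + 16 * M) r ->
  sim P (200 + 16 * M) d l (compile d l c) (cost K c s) (sem c s) r inp.
Proof.
set R := 200 + 16 * M.
have MR : M <= R by rewrite /R; lia.
have L1 : 0 < loglen R by [].
have ctmp d j : j < 128 -> cnt d == j = false by rewrite /cnt; lia.
have cvar d x : cnt d == vnum x = false.
  by apply: ctmp; have := vnum_lt x; lia.
have setv_ok l s r x v I :
    onth P l = Some I -> result I r = Some (vnum x, v) -> v <= R ->
    agrees s r -> rbounded R r ->
    [/\ steps P (Config l r inp) (Config l.+1 (update r (vnum x) v) inp)
          (2 * loglen R),
      forall d, update r (vnum x) v (cnt d) = r (cnt d),
      agrees (setv s x v) (update r (vnum x) v) &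
      rbounded R (update r (vnum x) v)].
  move=> hI hres hv A B; split.
  - exact: (steps_result hI B hres hv).
  - by move=> d; rewrite /update cvar.
  - exact: agrees_setv.
  - exact: rbounded_update.
have bin_ok l s r x a b (J : nat -> nat -> nat -> instruction) op :
    (forall i j k r', result (J i j k) r' = Some (i, op (r' j) (r' k))) ->
    code_at P l (load_atom tmp0 a ++ load_atom tmp1 b ++ [:: J (vnum x) tmp0 tmp1]) ->
    agrees s r -> rbounded R r -> aval s a <= R -> aval s b <= R ->
    op (aval s a) (aval s b) <= R ->
    exists r', [/\ steps P (Config l r inp) (Config (l +
        size (load_atom tmp0 a ++ load_atom tmp1 b ++ [:: J (vnum x) tmp0 tmp1]))
          r' inp) (10 * loglen R),
      forall d, r' (cnt d) = r (cnt d),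
      agrees (setv s x (op (aval s a) (aval s b))) r' & rbounded R r'].
  move=> hJ /code_at_cat [h1 /code_at_cat [h2 /code_at_cons [h3 _]]] A B ha hb hop.
  have [r1 [st1 E1 F1 A1 B1]] :=
    load_atom_steps inp h1 (@hidden_tmp tmp0 isT) A B ha.
  have [r2 [st2 E2 F2 A2 B2]] :=
    load_atom_steps inp h2 (@hidden_tmp tmp1 isT) A1 B1 hb.
  have res : result (J (vnum x) tmp0 tmp1) r2 =
      Some (vnum x, op (aval s a) (aval s b)) by rewrite hJ E2 F2 ?E1.
  have [st3 F3 A3 B3] := setv_ok _ _ _ _ _ _ h3 res hop A2 B2.
  exists (update r2 (vnum x) (op (aval s a) (aval s b))); split=> //.
  - rewrite !size_cat addnA addnA /= addn1.
    by apply: (steps_le _ (steps_trans st1 (steps_trans st2 st3))); lia.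
  - by move=> d; rewrite F3 F2 ?F1 // ctmp.
elim: c => [|x a|x a b|x a b|x y a|y a b|c1 IH1 c2 IH2|a c1 IH1 c2 IH2|a c IH]
  d l s r T hP A hb hM B.
- exists r; split => //=; rewrite addn0; apply: steps_le (@steps_refl _ _); lia.
- have ha := aval_le a hb; rewrite /= in hP hM.
  move/code_at_cat: hP => [h1 h2].
  have ha' : aval s a <= R by lia.
  have [r1 [st1 E1 F1 A1 B1]] :=
    load_atom_steps inp h1 (@hidden_tmp tmp0 isT) A B ha'.
  have [h3 /code_at_cons [h4 _]] := code_at_cons h2.
  have st2 := steps_result (inp := inp) h3 B1 erefl (leq0n R).
  have A2 : agrees s (update r1 tmp1 0).
    by apply: agrees_hidden => //; apply: hidden_tmp.
  have B2 : rbounded R (update r1 tmp1 0) by apply: rbounded_update.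
  have res : result (IAdd (vnum x) tmp0 tmp1) (update r1 tmp1 0) =
      Some (vnum x, aval s a) by rewrite /= /update /= E1 addn0.
  have [st3 F3 A3 B3] := setv_ok _ _ _ _ _ _ h4 res ha' A2 B2.
  eexists; split; [|move=> d' _|exact: A3|exact: B3].
  + rewrite size_cat addnA /= addn2.
    by apply: (steps_le _ (steps_trans st1 (steps_trans st2 st3))); lia.
  + by rewrite F3 /update ctmp // F1 // ctmp.
- have ha := aval_le a hb; have hb' := aval_le b hb.
  (* The sum itself must fit below [R], and the general bound on values after a command gives
     this. *)
  have hs := bounded_sem (Add x a b) (leq_addr T K) hb.
  have {hs} := hs.1 x; rewrite /= in hP hM *.
  have -> : veq x x by apply/veqP.
  move=> hs.
  have [|||r' [st F A' B']] := bin_ok _ _ _ _ _ _ IAdd addn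
    (fun _ _ _ _ => erefl) hP A B; try lia.
  exists r'; split=> //; by apply: steps_le st; lia.
- have ha := aval_le a hb; have hb' := aval_le b hb; rewrite /= in hP hM *.
  have [|||r' [st F A' B']] := bin_ok _ _ _ _ _ _ ISub subn
    (fun _ _ _ _ => erefl) hP A B; try lia.
  exists r'; split=> //; by apply: steps_le st; lia.
- have ha := aval_le a hb; rewrite /= in hP hM *.
  move/code_at_cat: hP => [h1 /code_at_cons [h2 _]].
  have hR : raddr y (aval s a) <= R by rewrite /raddr /R; have := anum_lt y; lia.
  have [r1 [st1 E1 F1 A1 B1]] := load_addr_steps inp h1 A B hR.
  have res : result (ILoad (vnum x) tmp0) r1 = Some (vnum x, arr s y (aval s a)).
    by rewrite /= E1 A1.2.
  have hv : arr s y (aval s a) <= R by apply: (leq_trans (hb.2 _ _)); lia.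
  have [st3 F3 A3 B3] := setv_ok _ _ _ _ _ _ h2 res hv A1 B1.
  eexists; split; [|move=> d' _|exact: A3|exact: B3].
  + rewrite size_cat addnA /= addn1.
    by apply: (steps_le _ (steps_trans st1 st3)); nia.
  + by rewrite F3 F1.
- have ha := aval_le a hb; have hb' := aval_le b hb; rewrite /= in hP hM *.
  move/code_at_cat: hP => [h1 /code_at_cat [h2 /code_at_cons [h3 _]]].
  have hR : raddr y (aval s a) <= R by rewrite /raddr /R; have := anum_lt y; lia.
  have [r1 [st1 E1 F1 A1 B1]] := load_addr_steps inp h1 A B hR.
  have bR : aval s b <= R by lia.
  have [r2 [st2 E2 F2 A2 B2]] :=
    load_atom_steps inp h2 (@hidden_tmp tmp1 isT) A1 B1 bR.
  have res : result (IStore tmp0 tmp1) r2 =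
      Some (raddr y (aval s a), aval s b) by rewrite /= E2 F2 ?E1.
  have st3 := steps_result (inp := inp) h3 B2 res bR.
  exists (update r2 (raddr y (aval s a)) (aval s b)); split;
    [|move=> d' _|exact: agrees_seta|exact: rbounded_update].
  + rewrite size_cat (size_cat (load_atom tmp1 b)) !addnA [size [:: _]]/= addn1.
    by apply: (steps_le _ (steps_trans st1 (steps_trans st2 st3))); nia.
  + have n : cnt d' == raddr y (aval s a) = false.
      by rewrite /cnt /raddr; have := anum_lt y; lia.
    by rewrite /update n F2 ?F1 // ctmp.
- rewrite /= in hP hM *; move/code_at_cat: hP => [h1 h2].
  have [|r1 [st1 F1 A1 B1]] := IH1 _ _ _ _ _ h1 A hb _ B; first lia.
  have hb1 := bounded_sem (c1) (leq_addr T K) hb.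
  rewrite -addnA in hb1.
  have [|r2 [st2 F2 A2 B2]] := IH2 d _ _ _ _ h2 A1 hb1 _ B1; first lia.
  exists r2; split=> //.
  + by rewrite size_cat addnA mulnDl; apply: steps_trans st1 st2.
  + by move=> d' h; rewrite F2 ?F1.
- have ha := aval_le a hb; rewrite /= in hP hM *.
  move/code_at_cat: hP => [h1 /code_at_cons [h2 /code_at_cat [h3
    /code_at_cons [h4 /code_at_cons [h5 h6]]]]].
  set p2 := compile d _ c2 in h3 h4 h5 h6 h2 *.
  set l1 := l + _ + 1 + size p2 + 2 in h3 h4 h5 h6 h2 *.
  set p1 := compile d l1 c1 in h3 h4 h5 h6 h2 *.
  have aR : aval s a <= R by lia.
  have [r1 [st1 E1 F1 A1 B1]] :=
    load_atom_steps inp h1 (@hidden_tmp tmp0 isT) A B aR.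
  have := steps_jump (inp := inp) h2 B1; rewrite E1.
  have El : l + size (load_atom tmp0 a ++ IJumpPos tmp0 l1 :: p2 ++
      IConst tmp1 1 :: IJumpPos tmp1 (l1 + size p1) :: p1) = l1 + size p1.
    by rewrite /l1 size_cat /= size_cat /=; lia.
  rewrite /sim El; case: ifP => ca st2; rewrite ca in hM.
  + have h6' : code_at P l1 p1.
      by move: h6; congr code_at; rewrite /l1; lia.
    have [|r2 [st3 F3 A3 B3]] := IH1 _ _ _ _ _ h6' A1 hb _ B1; first lia.
    exists r2; split=> //.
    * by apply: (steps_le _ (steps_trans st1 (steps_trans st2 st3))); nia.
    * by move=> d' h; rewrite F3 // F1 // ctmp.
  + rewrite -[(l + _).+1]addn1 in h3 h4 h5 st2.
    have [|r2 [st3 F3 A3 B3]] := IH2 _ _ _ _ _ h3 A1 hb _ B1; first lia.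
    have R1 : 1 <= R by rewrite /R; lia.
    have st4 := steps_result (inp := inp) h4 B3 erefl R1.
    have B4 : rbounded R (update r2 tmp1 1) by apply: rbounded_update.
    have := steps_jump (inp := inp) h5 B4; rewrite {1}/update /= => st5.
    exists (update r2 tmp1 1); split=> //.
    * by apply: (steps_le _ (steps_trans st1 (steps_trans st2 (steps_trans st3
        (steps_trans st4 st5))))); nia.
    * by move=> d' h; rewrite /update ctmp // F3 // F1 // ctmp.
    * by apply: agrees_hidden => //; apply: hidden_tmp.
- have ha := aval_le a hb; rewrite /= in hP hM *.
  move/code_at_cat: hP => [h1 h2].
  set l0 := l + size (load_atom (cnt d) a) in h2 *.
  set p := compile d.+1 (l0 + 3) c in h2 *.
  move/code_at_cons: h2 => [h2 /code_at_cons [h3 /code_at_cons [h4]]].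
  move=> /code_at_cat [h5 /code_at_cons [h6 /code_at_cons [h7 /code_at_cons [h8 _]]]].
  have e3 : l0.+3 = l0 + 3 by lia.
  rewrite e3 in h5 h6 h7 h8.
  have aR : aval s a <= R by lia.
  have [r1 [st1 E1 F1 A1 B1]] := load_atom_steps inp h1 (@hidden_cnt d) A B aR.
  have {}F1 d' : d' < d -> r1 (cnt d') = r (cnt d').
    by move=> h; rewrite F1 // /cnt; lia.
  rewrite /sim.
  have -> : l + size (load_atom (cnt d) a ++
    [:: IJumpPos (cnt d) (l0 + 3), IConst tmp1 1,
        IJumpPos tmp1 (l0 + 3 + size p + 3)
      & p ++ [:: IConst tmp1 1; ISub (cnt d) (cnt d) tmp1; IJumpPos tmp1 l0]])
    = l0 + 3 + size p + 3.
    by rewrite /l0 size_cat /= size_cat /=; lia.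
  have R1 : 1 <= R by rewrite /R; lia.
  have hb1 : bounded (K + T) s := hb.
  (* The loop proper, entered with its counter loaded. The additive 6 pays for the final failing
     test and the jump out of the loop. *)
  suff [r2 [st2 F2 A2 B2]] : exists r2,
      [/\ steps P (Config l0 r1 inp) (Config (l0 + 3 + size p + 3) r2 inp)
         ((rep_cost (sem c) (cost K c) (aval s a) s) * (30 * loglen R)
          + 6 * loglen R),
       forall d', d' < d -> r2 (cnt d') = r1 (cnt d'),
       agrees (rep (sem c) (aval s a) s) r2 & rbounded R r2].
    exists r2; split=> // [|d' hd]; last by rewrite F2 ?F1.
    by apply: (steps_le _ (steps_trans st1 st2)); lia.
  have {hM ha} : K + T + rep_cost (sem c) (cost K c) (aval s a) s <= M by lia.
  move: (aval s a) E1 => n {st1 F1 A B hb aR h1}.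
  elim: n s T r1 A1 B1 hb1 => [|n IHn] s T r1 A1 B1 hb1 E1 /= hM.
    have := steps_jump (inp := inp) h2 B1; rewrite E1 /= => st1.
    have st2 := steps_result (inp := inp) h3 B1 erefl R1.
    have B2 : rbounded R (update r1 tmp1 1) by apply: rbounded_update.
    have := steps_jump (inp := inp) h4 B2; rewrite {1}/update /= => st3.
    exists (update r1 tmp1 1); split=> //.
    + by apply: (steps_le _ (steps_trans st1 (steps_trans st2 st3))); lia.
    + by apply: (agrees_hidden _ _ A1); apply: hidden_tmp.
  have := steps_jump (inp := inp) h2 B1; rewrite E1 /= => st1.
  have [|r2 [st2 F2 A2 B2]] := IH _ _ _ _ _ h5 A1 hb1 _ B1; first lia.
  have st3 := steps_result (inp := inp) h6 B2 erefl R1.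
  have B3 : rbounded R (update r2 tmp1 1) by apply: rbounded_update.
  have A3 : agrees (sem c s) (update r2 tmp1 1).
    by apply: agrees_hidden => //; apply: hidden_tmp.
  have C3 : update r2 tmp1 1 (cnt d) - update r2 tmp1 1 tmp1 = n.
    by rewrite /update ctmp //= F2 // E1 subn1.
  have nR : n <= R by have := B1 (cnt d); lia.
  have st4 : steps P _ (Config _ (update (update r2 tmp1 1) (cnt d) n) inp) _ :=
    steps_result (i := cnt d) (v := n) (inp := inp) h7 B3
      ltac:(by rewrite /= C3) nR.
  set r4 := update (update r2 tmp1 1) (cnt d) n in st4.
  have B4 : rbounded R r4 by apply: rbounded_update.
  have A4 : agrees (sem c s) r4 by apply: agrees_hidden => //; apply: hidden_cnt.
  have E4 : r4 tmp1 = 1 by rewrite /r4 /update eq_sym ctmp.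
  have := steps_jump (inp := inp) h8 B4; rewrite E4 /= => st5.
  have hb2 := bounded_sem c (leq_addr T K) hb1; rewrite -addnA in hb2.
  have [||r5 [st6 F6 A6 B6]] := IHn _ _ r4 A4 B4 hb2; try lia.
    by rewrite /r4 /update eqxx.
  exists r5; split=> //.
  + by apply: (steps_le _ (steps_trans st1 (steps_trans st2 (steps_trans st3
      (steps_trans st4 (steps_trans st5 st6)))))); nia.
  + move=> d' hd; rewrite F6 // /r4 /update.
    have -> : cnt d' == cnt d = false by rewrite /cnt; lia.
    by rewrite ctmp // F2 //; lia.
Qed.

(* 128 is the address of cell 0 of the array aINP, and 16 the distance between
   consecutive cells. *)
Definition reader : program :=
  [:: IConst tmp3 128; IRead tmp0; IConst tmp1 1; ISub tmp2 tmp0 tmp1;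
      IJumpPos tmp2 10; IStore tmp3 tmp0; IConst tmp2 16; IAdd tmp3 tmp3 tmp2;
      IAdd (vnum vLEN) (vnum vLEN) tmp1; IJumpPos tmp1 1].

Definition init_store (w : seq bool) : store :=
  Store (fun x => if veq x vLEN then size w else 0)
        (fun a i => if aeq a aINP then nth 0 (map nat_of_bool w) i else 0).

(** The end of the tape reads as 2, so truncated subtraction of 1 is positive exactly there and
    triggers the exit to address 10. The loop is stated for an arbitrary part [w1] already copied; a
    round has nine instructions, which gives the 18. *)
Lemma reader_steps R P w :
  code_at P 0 reader -> 200 + 16 * size w <= R ->
  exists r, [/\ steps P (Config 0 (fun _ => 0) w) (Config 10 r [::])
                  ((size w).+1 * (20 * loglen R)),
    agrees (init_store w) r & rbounded R r].
Proof.
move=> /code_at_cons [h0 /code_at_cons [h1 /code_at_cons [h2 /code_at_cons [h3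
  /code_at_cons [h4 /code_at_cons [h5 /code_at_cons [h6 /code_at_cons [h7
  /code_at_cons [h8 /code_at_cons [h9 _]]]]]]]]]] hR.
have L1 : 0 < loglen R by [].
have H j : 100 <= j < 128 -> hidden j by apply: hidden_tmp.
suff loop w2 : forall w1 r, w = w1 ++ w2 -> agrees (init_store w1) r ->
    rbounded R r -> r tmp3 = 128 + 16 * size w1 ->
    exists r', [/\ steps P (Config 1 r w2) (Config 10 r' [::])
                  ((size w2).+1 * (18 * loglen R)),
    agrees (init_store w) r' & rbounded R r'].
  have c128 : 128 <= R by lia.
  have B0 : rbounded R (fun _ => 0) by [].
  have st0 := steps_result (inp := w) h0 B0 erefl c128.
  have [||||r [st1 A B]] := loop w [::] (update (fun _ => 0) tmp3 128) => //.
  - apply: agrees_hidden; first exact: H.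
    by split=> [x|a i] /=; [case: veq | case: aeq; rewrite ?nth_nil].
  - exact: rbounded_update.
  exists r; split=> //; apply: (steps_le _ (steps_trans st0 st1)); nia.
elim: w2 => [|b w2 IH] w1 r Ew A B Ep.
  have B1 : rbounded R (update r tmp0 2) by apply: rbounded_update => //; lia.
  have st1 : steps P (Config 1 r [::]) (Config 2 (update r tmp0 2) [::]) 1.
    exact: (steps1 (s := Config 1 r [::]) h1 erefl).
  have c1 : 1 <= R by lia.
  have st2 := steps_result (inp := [::]) h2 B1 erefl c1.
  have B2 : rbounded R (update (update r tmp0 2) tmp1 1).
    exact: rbounded_update.
  have st3 : steps P _ (Config _ (update (update (update r tmp0 2) tmp1 1) tmp2 1)
      [::]) _ := steps_result (inp := [::]) h3 B2 erefl c1.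
  set r3 := update _ tmp2 1 in st3.
  have B3 : rbounded R r3 by apply: rbounded_update.
  have := steps_jump (inp := [::]) h4 B3; rewrite {1}/r3 {1}/update /= => st4.
  exists r3; split=> //.
    apply: (steps_le _ (steps_trans st1 (steps_trans st2 (steps_trans st3 st4)))).
    by rewrite /=; lia.
  rewrite Ew cats0; rewrite /r3; do 3![apply: agrees_hidden; first exact: H].
  by [].
have bR : nat_of_bool b <= R by apply: leq_trans (leq_b1 b) _; lia.
have B1 : rbounded R (update r tmp0 b) by apply: rbounded_update.
have st1 : steps P (Config 1 r (b :: w2)) (Config 2 (update r tmp0 b) w2) 1.
  exact: (steps1 (s := Config 1 r (b :: w2)) h1 erefl).
have c1 : 1 <= R by lia.
have st2 := steps_result (inp := w2) h2 B1 erefl c1.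
have B2 : rbounded R (update (update r tmp0 b) tmp1 1).
  exact: rbounded_update.
have res3 : result (ISub tmp2 tmp0 tmp1) (update (update r tmp0 b) tmp1 1) =
    Some (tmp2, 0) by rewrite /= /update /=; case: b {B1 B2 bR st1 st2 Ew}.
have st3 := steps_result (inp := w2) h3 B2 res3 (leq0n R).
set r3 := update _ tmp2 0 in st3.
have B3 : rbounded R r3 by apply: rbounded_update.
have := steps_jump (inp := w2) h4 B3; rewrite {1}/r3 {1}/update /= => st4.
have E3 : r3 tmp3 = raddr aINP (size w1).
  by rewrite /r3 /update /= Ep /raddr /= addn0.
have E0 : r3 tmp0 = b by [].
have sw : size w = size w1 + (size w2).+1 by rewrite Ew size_cat.
have A3 : agrees (init_store w1) r3.
  by rewrite /r3; do 3![apply: agrees_hidden; first exact: H].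
have res5 : result (IStore tmp3 tmp0) r3 =
    Some (raddr aINP (size w1), nat_of_bool b) by rewrite /= E3 E0.
have st5 := steps_result (inp := w2) h5 B3 res5 bR.
have A5 := agrees_seta aINP (size w1) b A3.
set r5 := update r3 _ _ in st5 A5.
have B5 : rbounded R r5 by apply: rbounded_update.
have nINP j : 100 <= j < 128 -> j == raddr aINP (size w1) = false.
  by rewrite /raddr; lia.
have c16 : 16 <= R by lia.
have st6 := steps_result (inp := w2) h6 B5 erefl c16.
have B6 : rbounded R (update r5 tmp2 16) by apply: rbounded_update.
have res7 : result (IAdd tmp3 tmp3 tmp2) (update r5 tmp2 16) =
    Some (tmp3, 128 + 16 * (size w1).+1).
  rewrite /= /r5 {1 2}/update /= ?{1}/update /= E3 /raddr /= addn0.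
  by congr (Some (_, _)); lia.
have le7 : 128 + 16 * (size w1).+1 <= R by lia.
have st7 := steps_result (inp := w2) h7 B6 res7 le7.
set r7 := update _ tmp3 _ in st7.
have B7 : rbounded R r7 by apply: rbounded_update.
have A7 : agrees (seta (init_store w1) aINP (size w1) b) r7.
  by rewrite /r7; do 2![apply: agrees_hidden; first exact: H].
have E71 : r7 tmp1 = 1.
  by rewrite /r7 {1}/update /= {1}/update /=.
have res8 : result (IAdd (vnum vLEN) (vnum vLEN) tmp1) r7 =
    Some (vnum vLEN, (size w1).+1) by rewrite /= E71 (A7.1 vLEN) /= addn1.
have le8 : (size w1).+1 <= R by lia.
have st8 := steps_result (inp := w2) h8 B7 res8 le8.
have A8 := agrees_setv vLEN (size w1).+1 A7.
set r8 := update r7 _ _ in st8 A8.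
have B8 : rbounded R r8 by apply: rbounded_update.
have E81 : r8 tmp1 = 1 by [].
have := steps_jump (inp := w2) h9 B8; rewrite E81 /= => st9.
have [||||r' [st A' B']] := IH (rcons w1 b) r8 => //.
- by rewrite Ew cat_rcons.
- case: A8 => hv ha; split=> [x|a i].
  + by rewrite hv /= size_rcons; case: veq.
  + rewrite ha /=; case: aeq => //; rewrite map_rcons nth_rcons size_map.
    have [h|h|h] := ltngtP i (size w1); rewrite ?h ?eqxx ?gtn_eqF ?ltn_eqF //.
    by rewrite nth_default // size_map ltnW.
- by rewrite size_rcons /r8 {1}/update /= /r7 {1}/update /=.
exists r'; split=> //.
apply: (steps_le _ (steps_trans st1 (steps_trans st2 (steps_trans st3
  (steps_trans st4 (steps_trans st5 (steps_trans st6 (steps_trans st7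
  (steps_trans st8 (steps_trans st9 st)))))))))).
by rewrite /=; lia.
Qed.

Definition link (c : cmd) : program :=
  let p := compile 0 10 c in
  reader ++ p ++ [:: IJumpPos (vnum vRES) (10 + size p + 2); IHalt false;
                     IHalt true].

(** Here step counts turn into time: the copying of the input and the compiled program are each
    charged a multiple of the logarithm of the largest possible register content, and one last jump
    turns [vRES] into the answer. *)
Lemma link_halts c K w :
  let M := K + size w + 1 + cost K c (init_store w) in
  exists2 t, halts (link c) w (0 < vars (sem c (init_store w)) vRES) t &
    t <= (size w + cost K c (init_store w) + 2) * (40 * loglen (200 + 16 * M)).
Proof.
move=> M; set P := link c; set p := compile 0 10 c.
set e := [:: IJumpPos (vnum vRES) (10 + size p + 2); IHalt false; IHalt true].
have h1 : code_at P 0 reader by exists [::], (p ++ e).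
have h2 : code_at P 10 p by exists reader, e.
have h3 : code_at P (10 + size p) e.
  by exists (reader ++ p), [::]; rewrite cats0 -catA.
have hR : 200 + 16 * size w <= 200 + 16 * M by rewrite /M; lia.
have [r [st1 A1 B1]] := reader_steps h1 hR.
have hb : bounded (K + (size w + 1)) (init_store w).
  split=> [x|a i] /=; first by case: ifP => _; lia.
  case: ifP => // _.
  have [h|h] := ltnP i (size w); last by rewrite nth_default ?size_map.
  by rewrite (nth_map false) //; have := leq_b1 (nth false w i); lia.
have hM : K + (size w + 1) + cost K c (init_store w) <= M by rewrite /M; lia.
have [r2 [st2 _ A2 B2]] := compile_sim [::] h2 A1 hb hM B1.
move/code_at_cons: h3 => [h3 /code_at_cons [h4 /code_at_cons [h5 _]]].
have := steps_jump (inp := [::]) h3 B2; rewrite A2.1.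
set b := 0 < vars _ vRES; move=> st3.
have hh : halts_from P (Config (if b then 10 + size p + 2 else (10 + size p).+1)
    r2 [::]) b 1.
  by case: (b); apply: halts_now; [rewrite [pc _]/= addn2; exact: h5 | exact: h4].
have [t ht le] := steps_trans st1 (steps_trans st2 st3) hh.
exists t => //; apply: (leq_trans le); rewrite -/M.
have L1 : 0 < loglen (200 + 16 * M) by [].
nia.
Qed.

(** * Program logic *)

Fixpoint writes (c : cmd) (x : var) : bool :=
  match c with
  | Skip | Sto _ _ _ => false
  | Mov y _ | Add y _ _ | Sub y _ _ | Ld y _ _ => veq x y
  | Seq c1 c2 | If _ c1 c2 => writes c1 x || writes c2 x
  | For _ c1 => writes c1 x
  end.

Fixpoint writes_array (c : cmd) (a : array) : bool :=
  match c with
  | Sto b _ _ => aeq a b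
  | Seq c1 c2 | If _ c1 c2 => writes_array c1 a || writes_array c2 a
  | For _ c1 => writes_array c1 a
  | _ => false
  end.

(** The frame of a command, read off its text. It lets a specification mention only what its caller
    needs from the result. *)
Definition same (c : cmd) (s s' : store) : Prop :=
  (forall x, ~~ writes c x -> vars s' x = vars s x) /\
  (forall a, ~~ writes_array c a -> arr s' a = arr s a).

Lemma same_refl c s : same c s s.
Proof. by []. Qed.

Lemma same_trans c s1 s2 s3 : same c s1 s2 -> same c s2 s3 -> same c s1 s3.
Proof.
by move=> [v1 a1] [v2 a2]; split=> [x h|a h]; rewrite ?v2 ?v1 ?a2 ?a1.
Qed.

Lemma same_le c d s s' :
  (forall x, ~~ writes d x -> ~~ writes c x) ->
  (forall a, ~~ writes_array d a -> ~~ writes_array c a) ->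
  same c s s' -> same d s s'.
Proof. by move=> hv ha [h1 h2]; split=> *; [apply/h1/hv | apply/h2/ha]. Qed.

Lemma same_sem c s : same c s (sem c s).
Proof.
elim: c s => [|x a|x a b|x a b|x y a|y a b|c IHc d IHd|a c IHc d IHd|a c IHc] s;
  try by split=> // z /= /negbTE ->.
- by apply: (same_trans (s2 := sem c s)); [apply: same_le (IHc s) |
    apply: same_le (IHd _)] => z; rewrite /= negb_or => /andP [].
- by rewrite /=; case: ifP => _; [apply: same_le (IHc s) |
    apply: same_le (IHd _)] => z; rewrite /= negb_or => /andP [].
- apply: (@same_le c); try by [].
  rewrite /=; move: (aval s a) => n; elim: n s => //= n IH s.
  exact: same_trans (IHc s) (IH _).
Qed.

(** A weakest precondition whose postcondition also receives the cost, so correctness and running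
    time are proved in one pass. *)
Definition run (K : nat) (c : cmd) (s : store) (Q : nat -> store -> Prop) : Prop :=
  Q (cost K c s) (sem c s).

Definition spec (K : nat) (c : cmd) (s : store) (T : nat) (post : store -> Prop) :
  Prop := run K c s (fun k s' => k <= T /\ post s').

Section Rules.
Variables (K : nat).
Implicit Types (c d : cmd) (s : store) (Q : nat -> store -> Prop).

Lemma run_spec c s T post Q :
  spec K c s T post ->
  (forall k s', k <= T -> post s' -> same c s s' -> Q k s') -> run K c s Q.
Proof. by case=> h1 h2; apply=> //; apply: same_sem. Qed.

Lemma run_skip s Q : Q 0 s -> run K Skip s Q.
Proof. by []. Qed.

Lemma run_seq c d s Q :
  run K c s (fun k s' => run K d s' (fun k' s'' => Q (k + k') s'')) ->
  run K (Seq c d) s Q.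
Proof. by []. Qed.

Lemma run_mov x a s Q :
  Q (acost a).+1 (setv s x (aval s a)) -> run K (Mov x a) s Q.
Proof. by []. Qed.

Lemma run_add x a b s Q :
  aval s a + aval s b <= K ->
  Q (acost a + acost b).+1 (setv s x (aval s a + aval s b)) ->
  run K (Add x a b) s Q.
Proof. by rewrite /run /= -subn_eq0 => /eqP ->; rewrite minn0 addn0. Qed.

(** Charging the constant instead of the excess over [K] spares a separate bound for every
    counter. *)
Lemma run_addc x a n s Q :
  (forall k, k <= (acost a + n + n).+1 ->
    Q k (setv s x (aval s a + n))) ->
  run K (Add x a (Cst n)) s Q.
Proof. by apply=> /=; rewrite ltnS leq_add2l geq_minl. Qed.

Lemma run_sub x a b s Q :
  Q (acost a + acost b).+1 (setv s x (aval s a - aval s b)) ->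
  run K (Sub x a b) s Q.
Proof. by []. Qed.

Lemma run_ld x y a s Q :
  Q (acost a).+1 (setv s x (arr s y (aval s a))) -> run K (Ld x y a) s Q.
Proof. by []. Qed.

Lemma run_sto y a b s Q :
  Q (acost a + acost b).+1 (seta s y (aval s a) (aval s b)) ->
  run K (Sto y a b) s Q.
Proof. by []. Qed.

Lemma run_if a c d s Q :
  (0 < aval s a -> run K c s (fun k s' => Q (acost a + k).+1 s')) ->
  (aval s a = 0 -> run K d s (fun k s' => Q (acost a + k).+1 s')) ->
  run K (If a c d) s Q.
Proof.
rewrite /run /=; case: ifP => [_ h _|/negbT]; first exact: h.
by rewrite -eqn0Ngt => /eqP -> _; apply.
Qed.

(** The invariant is indexed by the processed prefix of a list, so that a loop follows the
    mathematical object it traverses: stopwatches, states, gates, transitions or arcs. *)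
Lemma run_for (T : Type) (l : seq T) (I : seq T -> store -> Prop) B a c s Q :
  aval s a = size l -> I [::] s ->
  (forall l1 x l2 s', l = l1 ++ x :: l2 -> I l1 s' -> same c s s' ->
    spec K c s' B (I (rcons l1 x))) ->
  (forall k s', k <= (acost a + size l * B.+1).+1 -> I l s' -> same c s s' ->
    Q k s') ->
  run K (For a c) s Q.
Proof.
move=> Es I0 step fin; rewrite /run /= Es.
suff H l2 : forall l1 s', l = l1 ++ l2 -> I l1 s' -> same c s s' ->
    [/\ rep_cost (sem c) (cost K c) (size l2) s' <= size l2 * B.+1,
      I l (rep (sem c) (size l2) s') & same c s (rep (sem c) (size l2) s')].
  have [h1 h2 h3] := H l [::] s erefl I0 (same_refl _ _).
  by apply: fin; rewrite // ltnS leq_add2l.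
elim: l2 => [|x l2 IH] l1 s' El I1 sm; first by rewrite El cats0.
have [le1 I2] := step _ _ _ _ El I1 sm.
have sm2 := same_trans sm (same_sem c s').
have El' : l = rcons l1 x ++ l2 by rewrite cat_rcons.
have [h1 h2 h3] := IH _ _ El' I2 sm2.
by split=> //=; rewrite mulSn; lia.
Qed.

Lemma run_forn (I : nat -> store -> Prop) n B a c s Q :
  aval s a = n -> I 0 s ->
  (forall i s', i < n -> I i s' -> same c s s' -> spec K c s' B (I i.+1)) ->
  (forall k s', k <= (acost a + n * B.+1).+1 -> I n s' -> same c s s' -> Q k s') ->
  run K (For a c) s Q.
Proof.
move=> Es I0 step fin.
apply: (run_for (l := nseq n tt) (I := fun l => I (size l)) (B := B));
  rewrite ?size_nseq // => l1 x l2 s' El.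
rewrite size_rcons; apply: step.
by rewrite -(size_nseq n tt) El size_cat /=; lia.
Qed.

End Rules.

Notation "c ;; d" := (Seq c d) (at level 60, right associativity).

Ltac step :=
  cbv beta;
  match goal with
  | |- spec _ _ _ _ _ => unfold spec
  | |- run _ (Seq _ _) _ _ => apply: run_seq
  | |- run _ Skip _ _ => apply: run_skip
  | |- run _ (Mov _ _) _ _ => apply: run_mov
  | |- run _ (Add _ _ (Cst _)) _ _ =>
      let k := fresh "k" in let hk := fresh "hk" in
      apply: run_addc => k /= hk
  | |- run _ (Sub _ _ _) _ _ => apply: run_sub
  | |- run _ (Ld _ _ _) _ _ => apply: run_ld
  | |- run _ (Sto _ _ _) _ _ => apply: run_sto
  end.

Ltac steps_tac := repeat step.

Definition seg (f : nat -> nat) (p : nat) (l : seq nat) : Prop :=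
  forall i, i < size l -> f (p + i) = nth 0 l i.

Lemma seg_cat f p l1 l2 :
  seg f p (l1 ++ l2) <-> seg f p l1 /\ seg f (p + size l1) l2.
Proof.
split=> [h|[h1 h2] i].
- split=> i hi; first by rewrite h ?nth_cat ?hi // size_cat; lia.
  by rewrite -addnA h ?size_cat ?ltn_add2l // nth_cat ltnNge leq_addr /= addKn.
- rewrite size_cat nth_cat => hi; case: ltnP => h; first exact: h1.
  by rewrite -h2 ?ltn_subLR // -addnA subnKC.
Qed.

Lemma seg_cons f p x l : seg f p (x :: l) <-> f p = x /\ seg f p.+1 l.
Proof.
rewrite (seg_cat f p [:: x] l) /= addn1; split=> -[h1 h2]; split=> //.
- by have := h1 0 isT; rewrite addn0.
- by case=> //= _; rewrite addn0.
Qed.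

Lemma seg_rcons f p l x :
  seg f p (rcons l x) <-> seg f p l /\ f (p + size l) = x.
Proof.
rewrite -cats1 seg_cat; split=> -[h1 h2]; split=> //.
- by case/seg_cons: h2.
- by apply/seg_cons; split.
Qed.

Lemma seg_ext f g p l :
  (forall i, i < size l -> f (p + i) = g (p + i)) -> seg g p l -> seg f p l.
Proof. by move=> E h i hi; rewrite E // h. Qed.

Lemma seg_push f l v :
  seg f 0 l -> seg (fun j => if j == size l then v else f j) 0 (rcons l v).
Proof.
move=> h; apply/seg_rcons; rewrite add0n eqxx; split=> //.
by apply: seg_ext h => i hi; rewrite add0n ltn_eqF.
Qed.


(** * Reading the input *)

Lemma bits_cons w n : bits w.+1 n = odd n :: bits w n./2.
Proof.
rewrite /bits /= divn1; congr (_ :: _).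
rewrite (iotaDl 1) -map_comp; apply: eq_map => i /=.
by rewrite add1n expnS divnMA divn2.
Qed.

Lemma bits_rcons w n : bits w.+1 n = rcons (bits w n) (odd (n %/ 2 ^ w)).
Proof. by rewrite /bits -[w.+1]addn1 iotaD map_cat cats1. Qed.

Lemma size_bits w n : size (bits w n) = w.
Proof. by rewrite size_map size_iota. Qed.

Lemma bits_val_bits w n : n < 2 ^ w -> bits_val (bits w n) = n.
Proof.
elim: w n => [|w IH] n h; first by rewrite ltnS leqn0 in h; rewrite (eqP h).
rewrite bits_cons /= IH; first by rewrite mul2n odd_double_half.
by rewrite expnS in h; lia.
Qed.

Lemma bitlen_gt n : n < 2 ^ bitlen n.
Proof. exact: (@up_logP 2 n.+1). Qed.

(** A functional model of the loop of [decode]. [pending] means that a continuation marker has been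
    read and a data bit comes next. *)
Record decoder : Type := Decoder {
  pending : bool; acc : nat; weight : nat; decoded : seq nat
}.

Definition decoder_step (D : decoder) (b : bool) : decoder :=
  let: Decoder p a w l := D in
  if p then Decoder false (a + (if b then w else 0)) (w + w) l
  else if b then Decoder true a w l
  else Decoder false 0 1 (rcons l a).

Definition decoder0 l := Decoder false 0 1 l.

Lemma decoder_bits bs a w l :
  foldl decoder_step (Decoder false a w l) (flatten [seq [:: true; b] | b <- bs])
  = Decoder false (a + w * bits_val bs) (w * 2 ^ size bs) l.
Proof.
elim: bs a w => [|b bs IH] a w; first by rewrite /= muln0 muln1 addn0.
rewrite [LHS]/= IH /=; congr Decoder; last by rewrite expnS; lia.
by case: b; lia.
Qed.

Lemma decoderE ns l :
  foldl decoder_step (decoder0 l) (flatten (map nat_code ns)) =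
  decoder0 (l ++ ns).
Proof.
elim: ns l => [|n ns IH] l; first by rewrite cats0.
rewrite /= foldl_cat /nat_code foldl_cat decoder_bits /= IH -cat_rcons.
by rewrite mul1n bits_val_bits // bitlen_gt.
Qed.

Definition decode : cmd :=
  Mov vWT 1 ;;
  For vLEN (
    Ld vBIT aINP vIP ;; Add vIP vIP 1 ;;
    If vPEND
      (If vBIT (Add vACC vACC vWT) Skip ;; Add vWT vWT vWT ;; Mov vPEND 0)
      (If vBIT (Mov vPEND 1)
        (Sto aCODE vCN vACC ;; Add vCN vCN 1 ;; Mov vACC 0 ;; Mov vWT 1))).

Lemma decode_spec K ns :
  let w := flatten (map nat_code ns) in
  2 ^ size w <= K ->
  spec K decode (init_store w) (20 * (size w).+1)
    (fun s => seg (arr s aCODE) 0 ns).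
Proof.
move=> w hK; rewrite /decode; steps_tac.
(* The accumulator stays below the weight and the weight at most doubles with each bit read, so all
   sums stay within [2 ^ size w <= K] and are charged 1. *)
pose I (l : seq bool) (s : store) :=
  let: Decoder p a wt ns := foldl decoder_step (decoder0 [::]) l in
  [/\ [/\ vars s vPEND = p, vars s vACC = a & vars s vWT = wt],
    vars s vIP = size l, vars s vCN = size ns, seg (arr s aCODE) 0 ns
    & a < wt <= 2 ^ size l].
apply: (run_for (l := w) (I := I) (B := 15)) => //.
- move=> l1 x l2 s' Ew; rewrite {1}/I.
  have lt : 2 * 2 ^ size l1 <= K.
    by rewrite -expnS (leq_trans _ hK) // leq_exp2l // Ew size_cat /= addnS leq_addr.
  rewrite /I -cats1 foldl_cat.
  case: (foldl _ _ _) => p a wt ms [[E1 E2 E3] E4 E5 E6 /andP [h1 h2]] [_ Fa].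
  rewrite size_cat addn1.
  have Ex : arr s' aINP (size l1) = x.
    by rewrite (Fa aINP isT) /= (nth_map false) Ew ?nth_cat ?ltnn ?subnn //
      size_cat /=; lia.
  steps_tac; rewrite /= E4 Ex.
  apply: run_if => /=; rewrite E1.
    case: p {E1} => // _; step; apply: run_if => /=.
      case: x {Ew Ex} => // _; apply: run_add => /=; first by rewrite E2 E3; lia.
      step; apply: run_add => /=; first by rewrite E3; lia.
      steps_tac; rewrite /= E2 E3 expnS; split; first lia.
      split; rewrite ?E4 ?E5 ?addn0 ?addn1 //; lia.
    case: x {Ew Ex} => // _; step; step; apply: run_add => /=; first by rewrite E3; lia.
    steps_tac; rewrite /= E2 E3 expnS; split; first lia.
    split; rewrite ?E4 ?E5 ?addn0 ?addn1 //; lia.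
  case: p E1 => // E1 _; apply: run_if => /=.
    case: x {Ew Ex} => // _; step; rewrite /= E2 E3 E5 expnS; split; first lia.
    split; rewrite ?E4 ?addn1 //; lia.
  case: x {Ew Ex} => // _; steps_tac; rewrite /= E2 E5 expnS; split; first lia.
  split; rewrite ?size_rcons ?E4 ?addn1 //; last by rewrite -expnS expn_gt0.
  exact: seg_push.
- move=> k s' hk; rewrite /I decoderE => -[_ _ _ h _] _; split=> //.
  by rewrite /= in hk *; lia.
Qed.

(** * The labelled graph of an automaton *)

(** Ties a loop counter, which equals the length of the processed prefix, to the ordinal being
    treated. *)
Lemma enum_ord_cat n l1 (y : 'I_n) l2 : enum 'I_n = l1 ++ y :: l2 -> size l1 = y.
Proof.
move=> E; have := index_enum_ord y; rewrite E index_cat /= eqxx addn0.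
have := enum_uniq 'I_n; rewrite E cat_uniq => /and3P [_ h _].
by case: ifP => // hx; case/negP: h; apply/hasP; exists y => //; rewrite inE eqxx.
Qed.

Section Graph.
Variables (m : nat) (A : stopwatch_automaton m).
Implicit Types (xi : assignment A) (q : 'I_(nQ A)) (x : 'I_(nX A)).

Notation stopwatches := (enum 'I_(nX A)).

(** Assignments are numbered in mixed radix notation, the stopwatch [x] contributing a digit in
    radix [(beta A x).+1], least significant first. [span l] is the place value after the digits of
    [l], and [rank] starts from the place value [w]. *)
Definition span (l : seq 'I_(nX A)) : nat := foldr (fun x n => (beta A x).+1 * n) 1 l.

Fixpoint rank xi (w : nat) (l : seq 'I_(nX A)) : nat :=
  if l is x :: l' then xi x * w + rank xi (w * (beta A x).+1) l' else 0.

Lemma span_rcons l x : span (rcons l x) = span l * (beta A x).+1.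
Proof. by elim: l => [|y l IH] /=; rewrite ?muln1 ?mul1n // IH mulnA. Qed.

Lemma span_gt0 l : 0 < span l.
Proof. by elim: l => //= x l IH; rewrite muln_gt0. Qed.

Lemma span_cat l1 l2 : span (l1 ++ l2) = span l1 * span l2.
Proof. by elim: l1 => [|y l IH] /=; rewrite ?mul1n // IH mulnA. Qed.

Lemma span_enum : span stopwatches = bound A.
Proof.
have -> : bound A = \prod_(x <- stopwatches) (beta A x).+1 by rewrite big_enum.
by elim: stopwatches => [|x l IH]; rewrite ?big_nil // big_cons /= IH.
Qed.

Lemma rank_cat xi w l1 l2 :
  rank xi w (l1 ++ l2) = rank xi w l1 + rank xi (w * span l1) l2.
Proof.
elim: l1 w => [|x l IH] w /=; first by rewrite muln1.
by rewrite IH addnA mulnA.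
Qed.

Lemma rank_rcons xi w l x :
  rank xi w (rcons l x) = rank xi w l + xi x * (w * span l).
Proof. by rewrite -cats1 rank_cat /= addn0. Qed.

Lemma rankM xi w l : rank xi w l = w * rank xi 1 l.
Proof.
elim: l w => [|x l IH] w /=; first by rewrite muln0.
by rewrite IH [in RHS]IH; lia.
Qed.

Lemma rank_lt xi l : rank xi 1 l < span l.
Proof.
elim: l => //= x l IH; rewrite rankM mul1n muln1.
by have := ltn_ord (xi x); nia.
Qed.

Lemma rank_lt_bound xi : rank xi 1 stopwatches < bound A.
Proof. by rewrite -span_enum rank_lt. Qed.

Definition digit (e : nat) x : nat :=
  (e %/ span (take x stopwatches)) %% (beta A x).+1.

Definition unrank (e : nat) : assignment A :=
  finfun (fun x => Ordinal (ltn_pmod (e %/ span (take x stopwatches))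
                                     (ltn0Sn (beta A x))) : 'I_(beta A x).+1).

Lemma unrankE e x : unrank e x = digit e x :> nat.
Proof. by rewrite ffunE. Qed.

Lemma take_enum l1 x l2 : stopwatches = l1 ++ x :: l2 -> take x stopwatches = l1.
Proof. by move=> E; rewrite -(enum_ord_cat E) E take_size_cat. Qed.

Lemma stopwatch_split x : exists l1 l2, stopwatches = l1 ++ x :: l2.
Proof.
by case/splitPr: (mem_enum 'I_(nX A) x) => l1 l2; exists l1, l2.
Qed.

(** The digits before [x] form a remainder below [span l1], those after it a multiple of the radix
    of [x]. Hence counting through the numbers below the bound meets every assignment. *)
Lemma rankK xi : unrank (rank xi 1 stopwatches) = xi.
Proof.
apply/ffunP => x; apply: ord_inj; rewrite unrankE /digit.
have [l1 [l2 E]] := stopwatch_split x.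
rewrite (take_enum E) E rank_cat /= mul1n (rankM _ (_ * _)).
have h : rank xi 1 l1 < span l1 by apply: rank_lt.
have -> : rank xi 1 l1 + (xi x * span l1 + span l1 * (beta A x).+1 * rank xi 1 l2)
   = ((beta A x).+1 * rank xi 1 l2 + xi x) * span l1 + rank xi 1 l1 by lia.
rewrite divnMDl ?span_gt0 // (divn_small h) addn0.
by rewrite mulnC modnMDl modn_small.
Qed.

Lemma size_pairs_code (T : Type) (f g : T -> nat) l :
  size (flatten [seq [:: f p; g p] | p <- l]) = 2 * size l.
Proof. by elim: l => //= p l ->; rewrite mulnS. Qed.

Definition zeta_count : nat := #|zeta A|.

Definition transitions_code (l : seq (transition (nQ A) (nbits (beta A)))) : seq nat :=
  flatten (map (@transition_code _ _) l).

Lemma size_code :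
  size (automaton_code A) =
  7 + nQ A + nX A + 2 * zeta_count + size (transitions_code (Delta A)).
Proof.
rewrite /automaton_code !size_cat (size_map _ (enum 'I_(nQ A))).
rewrite (size_map _ (enum 'I_(nX A))) !size_enum_ord [size (_ :: _ ++ _)]/=.
rewrite size_cat size_pairs_code -cardE -/zeta_count.
by rewrite [size (_ :: flatten _)]/= -/(transitions_code _) /=; lia.
Qed.

Variable (str : nat).

(* Identifier of a node, scaled by str so that the identifiers of a pair of
   nodes of two automata can be added; 0 is left for a sink. *)
Definition node_id (q : nat) xi : nat :=
  str + str * q + rank xi (str * nQ A) stopwatches.

Definition arc : Type := (nat * nat * nat)%type.
Definition lab (a : arc) : nat := a.1.1.
Definition src (a : arc) : nat := a.1.2.
Definition dst (a : arc) : nat := a.2.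

(* Label 0 marks moves that read nothing, including the idle ones; label 1
   leads from accepting nodes to the sink; letter a has label a + 2. *)
Definition state_arcs xi q : seq arc :=
  [:: (0, node_id q xi, node_id q xi);
      if q == accept A then (1, node_id q xi, 0)
      else ((lambda A q).+2, node_id q xi, node_id q (elapse q 1 xi))].

(** No transition arc leaves the accepting state, since a computation stops on reaching it. *)
Definition transition_arcs xi (d : transition (nQ A) (nbits (beta A))) : seq arc :=
  if (source d != accept A)
     && (circuit_eval (guard d) (assignment_bits xi) == [:: true])
  then [:: (0, node_id (source d) xi, node_id (target d) (act (action d) xi))]
  else [::].

Definition assignment_arcs xi : seq arc :=
  flatten [seq state_arcs xi q | q <- enum 'I_(nQ A)]
  ++ flatten [seq transition_arcs xi d | d <- Delta A].

Definition arcs : seq arc :=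
  flatten [seq assignment_arcs (unrank e) | e <- iota 0 (bound A)].

(** The successor makes room for the sink. *)
Definition node_count : nat := (nQ A * bound A).+1.

Lemma node_idE q xi :
  node_id q xi = str * (q + nQ A * rank xi 1 stopwatches).+1.
Proof. by rewrite /node_id rankM; lia. Qed.

Lemma node_id_lt q xi : 0 < str -> node_id q xi < str * node_count.
Proof.
move=> h; rewrite node_idE ltn_pmul2l // ltnS /node_count.
by have := rank_lt_bound xi; have := ltn_ord q; nia.
Qed.

Lemma bound_gt0 : 0 < bound A.
Proof. by rewrite -span_enum span_gt0. Qed.

Lemma beta_lt_bound x : beta A x < bound A.
Proof.
have [l1 [l2 E]] := stopwatch_split x.
by rewrite -span_enum E span_cat /=; have := span_gt0 l1; have := span_gt0 l2; nia.
Qed.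

Lemma exp_bitlen n : 2 ^ bitlen n <= 2 * n.+1.
Proof.
case: n => [|n]; first by rewrite /bitlen up_log1.
have := @up_log_gtn 2 n.+2 isT isT; rewrite -/(bitlen n.+1).
have : 0 < bitlen n.+1 by rewrite /bitlen up_log_gt0.
by case: (bitlen n.+1) => // k _ /=; rewrite expnS; lia.
Qed.

Lemma bitlen_le n : bitlen n <= n.
Proof.
apply: up_log_min => //; exact: ltn_expl.
Qed.

End Graph.

(** * Computing the labelled graph *)

(** [node_id] by repeated addition: the weight of a stopwatch is added as often as its digit
    says. *)
Definition encode_id (a : array) (q : var) : cmd :=
  Mov vEID vSTR ;; For q (Add vEID vEID vSTR) ;; Mov vX 0 ;;
  For vNX (Ld vEW aWGT vX ;; Ld vED a vX ;; For vED (Add vEID vEID vEW) ;;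
           Add vX vX 1).

(** Division by counting: the remainder is incremented once per unit of the dividend and wraps to 0,
    with a carry into the quotient, when it reaches the divisor. *)
Definition divmod : cmd :=
  Mov vDQ 0 ;; Mov vDR 0 ;;
  For vDV (Add vDR vDR 1 ;; Sub vT vDB vDR ;;
           If vT Skip (Mov vDR 0 ;; Add vDQ vDQ 1)).

Definition unrank_cmd : cmd :=
  Mov vDV vEC ;; Mov vX 0 ;;
  For vNX (Add vT vPB vX ;; Ld vDB aCODE vT ;; Add vDB vDB 1 ;; divmod ;;
           Sto aDIG vX vDR ;; Mov vDV vDQ ;; Add vX vX 1).

Definition bits_cmd : cmd :=
  Mov vNW 0 ;; Mov vX 0 ;; Mov vDB 2 ;;
  For vNX (Ld vDV aDIG vX ;; Ld vBW aBLEN vX ;;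
    For vBW (divmod ;; Sto aWIRE vNW vDR ;; Add vNW vNW 1 ;; Mov vDV vDQ) ;;
    Add vX vX 1).

(** Dispatch on the operation numbers of [gate_code] by decrementing [vOP] between tests. *)
Definition gate_cmd : cmd :=
  If vOP
    (Sub vOP vOP 1 ;; Ld vT aWIRE vI1 ;;
     If vOP
       (Sub vOP vOP 1 ;; Ld vG aWIRE vI2 ;;
        If vOP (If vT (Mov vG 1) Skip) (If vT Skip (Mov vG 0)))
       (Sub vG 1 vT))
    (Mov vG vI1).

(** Gates are written after the [vNW] input wires, which therefore remain available for the next
    circuit on the same assignment. *)
Definition eval_cmd : cmd :=
  Mov vU vNW ;; Ld vNG aCODE vPT ;; Add vPT vPT 1 ;;
  For vNG (
    Ld vOP aCODE vPT ;; Add vPT vPT 1 ;; Ld vI1 aCODE vPT ;; Add vPT vPT 1 ;;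
    Ld vI2 aCODE vPT ;; Add vPT vPT 1 ;;
    gate_cmd ;; Sto aWIRE vU vG ;; Add vU vU 1) ;;
  Ld vK aCODE vPT ;; Add vPT vPT 1 ;; Mov vO 0 ;;
  For vK (Ld vT aCODE vPT ;; Add vPT vPT 1 ;; Ld vT aWIRE vT ;;
          Sto aOUT vO vT ;; Add vO vO 1).

Definition act_cmd : cmd :=
  Mov vX 0 ;; Mov vO 0 ;;
  For vNX (
    Mov vVV 0 ;; Mov vPW 1 ;; Ld vBW aBLEN vX ;;
    For vBW (Ld vT aOUT vO ;; Add vO vO 1 ;;
             If vT (Add vVV vVV vPW) Skip ;; Add vPW vPW vPW) ;;
    Add vT vPB vX ;; Ld vB aCODE vT ;; Sub vT vVV vB ;;
    If vT (Mov vVV vB) Skip ;; Sto aDIG2 vX vVV ;; Add vX vX 1).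

(** Equality of states is the vanishing of both truncated differences. New values are computed from
    [aDIG], which is left intact, and stored in [aDIG2]. *)
Definition elapse_cmd : cmd :=
  Mov vX 0 ;; For vNX (Ld vT aDIG vX ;; Sto aDIG2 vX vT ;; Add vX vX 1) ;;
  Mov vZ vPZ ;;
  For vNZ (
    Ld vZX aCODE vZ ;; Add vZ vZ 1 ;; Ld vZQ aCODE vZ ;; Add vZ vZ 1 ;;
    Sub vT vZQ vQ ;; Sub vU vQ vZQ ;;
    If vT Skip (If vU Skip (
      Ld vVV aDIG vZX ;; Add vVV vVV 1 ;; Add vT vPB vZX ;; Ld vB aCODE vT ;;
      Sub vT vVV vB ;; If vT (Mov vVV vB) Skip ;; Sto aDIG2 vZX vVV))).

Definition push (l : var) (a : var) (b : var) : cmd :=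
  Sto aLAB vE l ;; Sto aSRC vE a ;; Sto aDST vE b ;; Add vE vE 1.

Definition test_neq (x y : var) : cmd :=
  Sub vT x y ;; Sub vU y x ;; Mov vLT 1 ;;
  If vU Skip (If vT Skip (Mov vLT 0)).

Definition move_cmd : cmd :=
  test_neq vQ vAC ;;
  If vLT
    (elapse_cmd ;; encode_id aDIG2 vQ ;; Add vT vPL vQ ;; Ld vLT aCODE vT ;;
     Add vLT vLT 2)
    (Mov vEID 0 ;; Mov vLT 1).

Definition states_cmd : cmd :=
  Mov vQ 0 ;;
  For vNQ (
    encode_id aDIG vQ ;; Mov vSID vEID ;; Mov vLT 0 ;; push vLT vSID vSID ;;
    move_cmd ;; push vLT vSID vEID ;; Add vQ vQ 1).

(** The action is evaluated even when the guard fails, because [eval_cmd] also moves [vPT] past the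
    code of the circuit. *)
Definition transitions_cmd : cmd :=
  Mov vPT vPD ;;
  For vND (
    Ld vSRC aCODE vPT ;; Add vPT vPT 1 ;; Ld vTGT aCODE vPT ;; Add vPT vPT 1 ;;
    encode_id aDIG vSRC ;; Mov vSID vEID ;;
    eval_cmd ;; Ld vGV aOUT 0 ;; eval_cmd ;; act_cmd ;; encode_id aDIG2 vTGT ;;
    If vGV
      (test_neq vSRC vAC ;; If vLT (Mov vLT 0 ;; push vLT vSID vEID) Skip)
      Skip).

Definition header_cmd : cmd :=
  Add vT vP 1 ;; Ld vNQ aCODE vT ;; Add vT vT 1 ;; Ld vST aCODE vT ;;
  Add vT vT 1 ;; Ld vAC aCODE vT ;; Add vT vT 1 ;; Ld vNX aCODE vT ;;
  Add vPL vT 1 ;; Add vPB vPL vNQ ;; Add vPZ vPB vNX ;; Ld vNZ aCODE vPZ ;;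
  Add vPZ vPZ 1 ;; Add vPD vPZ vNZ ;; Add vPD vPD vNZ ;; Ld vND aCODE vPD ;;
  Add vPD vPD 1.

(** The second inner loop multiplies both the current weight [vM] and the partial bound [vBB] by
    [(beta A x).+1]; the first finds the bit length by doubling [vPW]. *)
Definition weights_cmd : cmd :=
  Mov vM 0 ;; For vNQ (Add vM vM vSTR) ;; Mov vBB 1 ;; Mov vX 0 ;;
  For vNX (
    Add vT vPB vX ;; Ld vB aCODE vT ;; Sto aWGT vX vM ;;
    Mov vBW 0 ;; Mov vPW 1 ;; Add vU vB 1 ;;
    For vB (Sub vT vU vPW ;; If vT (Add vBW vBW 1 ;; Add vPW vPW vPW) Skip) ;;
    Sto aBLEN vX vBW ;; Mov vM0 vM ;; Mov vEW vBB ;;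
    For vB (Add vM vM vM0 ;; Add vBB vBB vEW) ;; Add vX vX 1).

(** On exit [vP] points to the code that follows and [vSTR] is multiplied by the node count, so a
    second run handles the second automaton with the right scale and appends its arcs to those of
    the first. *)
Definition graph_cmd : cmd :=
  header_cmd ;; weights_cmd ;; Mov vEC 0 ;;
  For vBB (unrank_cmd ;; bits_cmd ;; states_cmd ;; transitions_cmd ;;
           Add vEC vEC 1) ;;
  Mov vS1 vSTR ;; For vST (Add vS1 vS1 vSTR) ;;
  Mov vP vPT ;; Add vSTR vM vSTR.

Lemma divn_succ i d : 0 < d ->
  (i.+1 %/ d, i.+1 %% d) =
  if (i %% d).+1 == d then ((i %/ d).+1, 0) else (i %/ d, (i %% d).+1).
Proof.
move=> d0; rewrite {1 2}(divn_eq i d) -addnS.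
have := ltn_pmod i d0; rewrite divnMDl // modnMDl.
case: eqP => [->|ne] h; first by rewrite divnn modnn d0 addn1.
have h' : (i %% d).+1 < d by rewrite ltn_neqAle h andbT; apply/eqP.
by rewrite (divn_small h') (modn_small h') addn0.
Qed.

Lemma divmod_spec K s : 0 < vars s vDB ->
  spec K divmod s (12 * (vars s vDV).+1)
    (fun s' => vars s' vDQ = vars s vDV %/ vars s vDB /\
               vars s' vDR = vars s vDV %% vars s vDB).
Proof.
move=> d0; rewrite /divmod; steps_tac.
apply: (run_forn (n := vars s vDV) (B := 10) (I := fun i s' =>
  vars s' vDQ = i %/ vars s vDB /\ vars s' vDR = i %% vars s vDB)) => //=.
- by rewrite div0n mod0n.
- move=> i s' hi [E1 E2] [/(_ vDB isT)/= Fv _].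
  have H := divn_succ i d0; have hm := ltn_pmod i d0.
  steps_tac; apply: run_if => /=; rewrite E2 Fv.
    rewrite subn_gt0 addn1; steps_tac => hh; move: H; rewrite ltn_eqF //.
    by move=> [-> ->]; split=> //=; lia.
  move/eqP; rewrite subn_eq0 addn1 => hh; steps_tac; move: H.
  have -> : (i %% vars s vDB).+1 == vars s vDB by rewrite eqn_leq hh hm.
  by move=> [-> ->]; split; [rewrite /=; lia | rewrite /= E1 addn1].
- by move=> k s' hk [-> ->] _; split=> //; lia.
Qed.

(** * Correctness and cost of the graph construction *)

Section GraphCode.
Variables (K m : nat) (A : stopwatch_automaton m) (str : nat).
Hypothesis str_gt0 : 0 < str.
Hypothesis strK : 4 * (str * node_count A) <= K.
Implicit Types (s : store) (xi : assignment A) (q : 'I_(nQ A)) (x : 'I_(nX A)).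

Notation stopwatches := (enum 'I_(nX A)).
Notation b := (bound A).
Notation transitions_code := (@transitions_code m A).

Record header s : Prop := Header {
  env_NQ : vars s vNQ = nQ A;
  env_AC : vars s vAC = accept A;
  env_NX : vars s vNX = nX A;
  env_STR : vars s vSTR = str;
  env_lambda : seg (arr s aCODE) (vars s vPL)
    [seq val (lambda A q) | q <- enum 'I_(nQ A)];
  env_beta : seg (arr s aCODE) (vars s vPB) [seq beta A x | x <- stopwatches];
  env_NZ : vars s vNZ = #|zeta A|;
  env_zeta : seg (arr s aCODE) (vars s vPZ)
    (flatten [seq [:: val p.1; val p.2] | p <- enum (zeta A)]);
  env_ND : vars s vND = size (Delta A);
  env_Delta : seg (arr s aCODE) (vars s vPD)
    (flatten (map (@transition_code _ _) (Delta A)));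
  env_posL : vars s vPL + nQ A <= K;
  env_posB : vars s vPB + nX A <= K
}.

(** [header] is what parsing establishes, and [env] adds the tables filled by [weights_cmd]. *)
Record env s : Prop := Env {
  env_header :> header s;
  env_WGT : forall x, arr s aWGT x = str * nQ A * span (take x stopwatches);
  env_BLEN : forall x, arr s aBLEN x = bitlen (beta A x)
}.

Definition env_vars : seq var :=
  [:: vNQ; vAC; vNX; vSTR; vPL; vPB; vNZ; vPZ; vND; vPD].

Definition env_arrays : seq array := [:: aCODE; aWGT; aBLEN].

Definition env_eq s s' : Prop :=
  map (vars s') env_vars = map (vars s) env_vars /\
  map (arr s') env_arrays = map (arr s) env_arrays.

Lemma header_ext s s' :
  map (vars s') env_vars = map (vars s) env_vars ->
  arr s' aCODE = arr s aCODE -> header s -> header s'.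
Proof.
case=> e1 e2 e3 e4 e5 e6 e7 e8 e9 e10 f1.
by case=> *; split; rewrite ?(e1, e2, e3, e4, e5, e6, e7, e8, e9, e10, f1).
Qed.

Lemma header_same c s s1 s' :
  header s -> same c s1 s' ->
  map (vars s1) env_vars = map (vars s) env_vars -> arr s1 aCODE = arr s aCODE ->
  all (fun y => ~~ writes c y) env_vars -> ~~ writes_array c aCODE -> header s'.
Proof.
move=> h [Fv Fa] ev ea hv ha.
apply: (header_ext _ _ (header_ext ev ea h)); last by rewrite Fa.
by case/and5P: hv => h1 h2 h3 h4 /and5P [h5 h6 h7 h8 /andP [h9 /andP [h10 _]]];
  rewrite /env_vars /= !Fv.
Qed.

Lemma env_ext s s' : env_eq s s' -> env s -> env s'.
Proof.
case=> ev [f1 f2 f3] [h hw hb]; split; rewrite ?f2 ?f3 //.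
exact: header_ext ev f1 h.
Qed.

Definition env_safe (c : cmd) : bool :=
  all (fun y => ~~ writes c y) env_vars &&
  all (fun a => ~~ writes_array c a) env_arrays.

(* s and s1 may differ by assignments that do not touch the environment; then
   the third hypothesis holds by computation. *)
Lemma env_same c s s1 s' :
  env s -> same c s1 s' -> env_eq s s1 -> env_safe c -> env s'.
Proof.
move=> [h hw hl] sm [ev [ea ew el]] /andP [h1 /and4P [h2 h3 h4 _]].
split; first exact: (header_same h sm).
- by move=> x; rewrite sm.2 // ew.
- by move=> x; rewrite sm.2 // el.
Qed.

Definition digits s (a : array) xi : Prop := forall x, arr s a x = xi x.

Definition encode_time : nat := 12 * (nQ A + nX A * b.+1).+1.

Lemma str_le n : n <= 4 * (nQ A * b).+1 -> str * n <= K.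
Proof.
by move=> h; apply: leq_trans strK; rewrite mulnCA leq_mul2l h orbT.
Qed.

Lemma nodes_le q xi : node_id str q xi <= K.
Proof. by have := node_id_lt q xi str_gt0; lia. Qed.

Lemma encode_id_spec a (qv : var) s q xi :
  env s -> digits s a xi -> vars s qv = q -> ~~ veq qv vEID ->
  spec K (encode_id a qv) s encode_time (fun s' => vars s' vEID = node_id str q xi).
Proof.
move=> e hd hq hn; rewrite /encode_id; steps_tac.
apply: (run_forn (n := q) (B := 1) (I := fun i s' => vars s' vEID = str + str * i)).
- by rewrite /= (negbTE hn).
- by rewrite /= (env_STR e) muln0 addn0.
- move=> i s' hi Ei [/(_ vSTR isT)/= Fv _]; steps_tac; apply: run_add => /=.
    rewrite Ei Fv (env_STR e).
    have -> : str + str * i + str = str * i.+2 by lia.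
    apply: str_le; have := ltn_ord q; have := bound_gt0 A; nia.
  by rewrite Ei Fv (env_STR e); split=> //; lia.
move=> k1 s1 hk1 E1 sm1; steps_tac.
have e1 : env s1 by apply: (env_same e sm1).
have hd1 : digits s1 a xi by move=> x; rewrite sm1.2 //= hd.
apply: (run_for (l := stopwatches) (B := 2 * b + 10) (I := fun l s' =>
  vars s' vEID = str + str * q + rank xi (str * nQ A) l /\ vars s' vX = size l)).
- by rewrite /= (env_NX e1) size_enum_ord.
- by rewrite /= E1 addn0.
- move=> l1 x l2 s' El [I1 I2] sm2; steps_tac; rewrite /= I2.
  have e2 : env s' by apply: (env_same e1 sm2).
  have hd2 : digits s' a xi by move=> y; rewrite sm2.2 //= hd1.
  rewrite (enum_ord_cat El) (env_WGT e2) hd2 (take_enum El).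
  (* A partial sum is at most the whole identifier, so every addition in the inner loop stays within
     [K]. *)
  have hK : str + str * q + rank xi (str * nQ A) (rcons l1 x) <= K.
    apply: leq_trans (nodes_le q xi).
    by rewrite /node_id El -cat_rcons rank_cat addnA leq_addr.
  rewrite rank_rcons in hK.
  apply: (run_forn (n := xi x) (B := 1) (I := fun i s' => vars s' vEID =
     str + str * q + rank xi (str * nQ A) l1 + i * (str * nQ A * span l1))) => //=.
  + by rewrite mul0n addn0.
  + move=> i s3 hi I3 [/(_ vEW isT)/= Fv _]; steps_tac; apply: run_add => /=.
      by rewrite I3 Fv; apply: leq_trans hK; nia.
    by rewrite I3 Fv; split=> //; lia.
  + move=> k3 s3 hk3 I3 [Fv _]; steps_tac => /=.
    rewrite I3 (Fv vX isT) /= I2 size_rcons rank_rcons addn1.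
    have hx := ltn_ord (xi x); have hb := beta_lt_bound x.
    by split; [lia | split=> //; lia].
- move=> k2 s2 hk2 [I1 _] _; split=> //.
  move: hk1 hk2; rewrite /= size_enum_ord /encode_time.
  by have := ltn_ord q; nia.
Qed.

Lemma env_betaE s x : header s -> arr s aCODE (vars s vPB + x) = beta A x.
Proof.
move=> e; rewrite (env_beta e); last by rewrite size_map -cardE card_ord.
by rewrite (nth_map x) ?size_enum_ord // nth_ord_enum.
Qed.

Lemma env_lambdaE s q : env s -> arr s aCODE (vars s vPL + q) = lambda A q.
Proof.
move=> e; rewrite (env_lambda e); last by rewrite size_map -cardE card_ord.
by rewrite (nth_map q) ?size_enum_ord // nth_ord_enum.
Qed.

(** The invariant step common to the loops that fill an array with one entry per stopwatch. *)
Lemma mem_prefix l1 x l2 y (f : nat -> nat) (g : 'I_(nX A) -> nat) v :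
  stopwatches = l1 ++ x :: l2 ->
  (forall z, z \in l1 -> f z = g z) -> v = g x ->
  y \in rcons l1 x -> (if y == size l1 :> nat then v else f y) = g y.
Proof.
move=> E hf -> ; rewrite mem_rcons inE (enum_ord_cat E) => /orP [/eqP ->|hy].
  by rewrite eqxx.
by case: eqP => [/ord_inj ->|_] //; apply: hf.
Qed.

Lemma unrank_spec s e :
  env s -> vars s vEC = e -> e < b ->
  spec K unrank_cmd s (30 * (nX A * b.+1).+1)
    (fun s' => digits s' aDIG (unrank A e)).
Proof.
move=> he hEC heb; rewrite /unrank_cmd; steps_tac.
apply: (run_for (l := stopwatches) (B := 12 * b.+1 + 16) (I := fun l s' =>
  [/\ vars s' vX = size l, vars s' vDV = e %/ span l &
   forall y, y \in l -> arr s' aDIG y = digit e y])).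
- by rewrite /= (env_NX he) size_enum_ord.
- by rewrite /= divn1 hEC.
- move=> l1 x l2 s' El [I1 I2 I3] sm; have e1 : env s' by apply: (env_same he sm).
  have hpos := env_posB e1; have := ltn_ord x; rewrite -{1}(enum_ord_cat El) => hx.
  have hb := beta_lt_bound x; have hle : e %/ span l1 < b.
    by apply: leq_ltn_trans heb; apply: leq_div.
  steps_tac; apply: run_add => /=; first by rewrite I1;
    apply: leq_trans hpos; rewrite leq_add2l ltnW.
  steps_tac => /=; rewrite I1 (enum_ord_cat El) (env_betaE x e1).
  apply: run_spec; first by apply: divmod_spec => /=; rewrite addn1.
  move=> k2 s2 /= hk2 [Q2 R2] [Fv Fa]; steps_tac => /=.
  rewrite Q2 R2 I2 (Fv vX isT) /= I1 addn1 size_rcons addn1; split.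
    by move: hk2; rewrite I2; lia.
  split=> //; first by rewrite span_rcons divnMA.
  move=> y hy; rewrite (Fa aDIG isT) /=; apply: (mem_prefix El I3) => //.
  by rewrite /digit (take_enum El).
- move=> k s' hk [_ _ I3] _; split.
    by move: hk; rewrite /= size_enum_ord; lia.
  by move=> x; rewrite I3 ?mem_enum // unrankE.
Qed.

Lemma bitlen_le_nbits x : bitlen (beta A x) <= nbits (beta A).
Proof.
have [l1 [l2 E]] := stopwatch_split x.
by rewrite /nbits /blocks E map_cat sumn_cat /=; lia.
Qed.

Definition block_bits xi (l : seq 'I_(nX A)) : seq bool :=
  flatten [seq bits (bitlen (beta A y)) (xi y) | y <- l].

Lemma block_bits_rcons xi l x :
  block_bits xi (rcons l x) = block_bits xi l ++ bits (bitlen (beta A x)) (xi x).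
Proof. by rewrite /block_bits map_rcons flatten_rcons. Qed.

Lemma size_assignment_bits xi : size (assignment_bits xi) = nbits (beta A).
Proof.
rewrite size_flatten /shape -map_comp; congr sumn.
by apply: eq_map => x; apply: size_bits.
Qed.

Lemma bits_spec s xi :
  env s -> digits s aDIG xi ->
  spec K bits_cmd s (30 * (nX A * (nbits (beta A) * b.+1).+1).+1)
    (fun s' => seg (arr s' aWIRE) 0 (map nat_of_bool (assignment_bits xi)) /\
               vars s' vNW = nbits (beta A)).
Proof.
move=> e hd; rewrite /bits_cmd; steps_tac.
apply: (run_for (l := stopwatches) (B := nbits (beta A) * (12 * b.+1 + 8) + 12)
  (I := fun l s' => [/\ vars s' vX = size l,
    vars s' vNW = size (block_bits xi l), vars s' vDB = 2 &
    seg (arr s' aWIRE) 0 (map nat_of_bool (block_bits xi l))])).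
- by rewrite /= (env_NX e) size_enum_ord.
- by [].
- move=> l1 x l2 s' El [I1 I2 I3 I4] sm; have e1 : env s' by apply: (env_same e sm).
  have hd1 : digits s' aDIG xi by move=> y; rewrite sm.2 //= hd.
  steps_tac; rewrite /= I1 (enum_ord_cat El) hd1 (env_BLEN e1).
  apply: (run_forn (n := bitlen (beta A x)) (B := 12 * b.+1 + 7)
    (I := fun i s' => [/\ vars s' vDV = xi x %/ 2 ^ i,
      vars s' vNW = size (block_bits xi l1) + i, vars s' vDB = 2 &
      seg (arr s' aWIRE) 0
        (map nat_of_bool (block_bits xi l1 ++ bits i (xi x)))])) => //=.
  + by rewrite divn1 addn0 cats0.
  + move=> i s2 hi [J1 J2 J3 J4] _; steps_tac.
    apply: run_spec; first by apply: divmod_spec; rewrite J3.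
    move=> k3 s3; rewrite J1 J3 => hk3 [Q3 R3] [Fv Fa]; steps_tac => /=.
    have hx : xi x %/ 2 ^ i < b.
      apply: leq_ltn_trans (leq_div _ _) _; have := beta_lt_bound x.
      by have := ltn_ord (xi x); lia.
    split; first by move: hk3; lia.
    split; rewrite ?(Fv vNW isT) ?(Fv vDB isT) ?(Fa aWIRE isT) //.
    * by rewrite Q3 -divnMA mulnC expnS.
    * by rewrite J2 addn1 addnS.
    * rewrite J2 R3 bits_rcons -rcons_cat map_rcons modn2.
      have -> : size (block_bits xi l1) + i =
          size (map nat_of_bool (block_bits xi l1 ++ bits i (xi x))).
        by rewrite size_map size_cat size_bits.
      exact: seg_push.
  + move=> k3 s3 hk3 [J1 J2 J3 J4] [Fv _]; steps_tac => /=.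
    rewrite (Fv vX isT) /= I1 size_rcons addn1 block_bits_rcons size_cat size_bits.
    by split; [have := bitlen_le_nbits x; nia | ].
- move=> k s' hk [_ I2 _ I4] _; split; last first.
    by split=> //; rewrite I2 -(size_assignment_bits xi).
  by move: hk; rewrite /= size_enum_ord; nia.
Qed.

Lemma seg_wires f ws i :
  seg f 0 (map nat_of_bool ws) -> i < size ws -> f i = nth false ws i.
Proof. by move=> h hi; rewrite -[i in LHS]add0n h ?size_map // (nth_map false). Qed.

Lemma gate_spec s g ws :
  [:: vars s vOP; vars s vI1; vars s vI2] = gate_code g ->
  gate_wf (size ws) g -> seg (arr s aWIRE) 0 (map nat_of_bool ws) ->
  spec K gate_cmd s 30 (fun s' => vars s' vG = gate_val ws g).
Proof.
move=> hg hwf hw; rewrite /gate_cmd; steps_tac.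
case: g hg hwf => [c|i|i j|i j] /= [E0 E1 E2] => [_|hi|/andP [hi hj]|/andP [hi hj]];
  apply: run_if => /=; rewrite E0 // => _; steps_tac => /=; rewrite ?E1 //.
- apply: run_if => /=; rewrite ?E0 // => _; steps_tac.
  by rewrite /= (seg_wires hw hi); case: nth.
- apply: run_if => /=; rewrite ?E0 // => _; steps_tac => /=.
  rewrite E2 (seg_wires hw hj).
  apply: run_if => /=; rewrite ?E0 // => _.
  by apply: run_if => /=; rewrite (seg_wires hw hi); case: (nth false ws i) => // _;
    steps_tac => /=.
- apply: run_if => /=; rewrite ?E0 // => _; steps_tac => /=.
  rewrite E2 (seg_wires hw hj).
  apply: run_if => /=; rewrite ?E0 // => _.
  by apply: run_if => /=; rewrite (seg_wires hw hi); case: (nth false ws i) => // _;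
    steps_tac => /=.
Qed.

Lemma size_gates_code l : size (flatten (map gate_code l)) = 3 * size l.
Proof.
by elim: l => // g l IH; rewrite /= size_cat IH; case: g => *; rewrite /= mulnS.
Qed.

Lemma gates_wf_cat n l1 l2 :
  gates_wf n (l1 ++ l2) = gates_wf n l1 && gates_wf (n + size l1) l2.
Proof.
elim: l1 n => [|g l IH] n /=; first by rewrite addn0.
by rewrite IH addSnnS andbA.
Qed.

Lemma wires_rcons v l g : wires v (rcons l g) =
  rcons (wires v l) (gate_val (wires v l) g).
Proof. by rewrite /wires -cats1 foldl_cat. Qed.

Lemma size_wires v l : size (wires v l) = size v + size l.
Proof.
elim/last_ind: l => [|l g IH]; first by rewrite addn0.
by rewrite wires_rcons !size_rcons IH addnS.
Qed.

Lemma wires_prefix v l : exists u, wires v l = v ++ u.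
Proof.
elim/last_ind: l => [|l g [u IH]]; first by exists [::]; rewrite cats0.
by exists (rcons u (gate_val (wires v l) g)); rewrite wires_rcons {1}IH rcons_cat.
Qed.

(** The input wires reappear in the postcondition because [wires] only extends its first argument;
    the guard is evaluated first and the action then starts from the same wires. *)
Lemma eval_spec s n k (C : circuit n k) v :
  seg (arr s aCODE) (vars s vPT) (circuit_code C) ->
  vars s vNW = n -> size v = n -> seg (arr s aWIRE) 0 (map nat_of_bool v) ->
  spec K eval_cmd s (60 * size (circuit_code C))
    (fun s' => [/\ seg (arr s' aOUT) 0 (map nat_of_bool (circuit_eval C v)),
       seg (arr s' aWIRE) 0 (map nat_of_bool v) &
       vars s' vPT = vars s vPT + size (circuit_code C)]).
Proof.
case: C => gs outs wf_gs wf_outs; rewrite /circuit_code /circuit_eval /=.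
move=> /seg_cons [hng /seg_cat [hgs /seg_cons [hk houts]]] hn sv hv.
rewrite size_gates_code in hk houts.
have szc : size (flatten [seq gate_code g | g <- gs] ++ k :: outs) =
  3 * size gs + k.+1 by rewrite size_cat size_gates_code /= size_tuple.
rewrite /eval_cmd; steps_tac => /=.
apply: (run_for (l := gs) (B := 50) (I := fun l s' =>
  [/\ vars s' vU = n + size l, vars s' vPT = vars s vPT + 1 + 3 * size l &
   seg (arr s' aWIRE) 0 (map nat_of_bool (wires v l))])) => //=.
- by rewrite hn !addn0.
- move=> l1 g l2 s' El [I1 I2 I3] sm.
  have hC := sm.2 aCODE isT; rewrite /= in hC.
  move: hgs; rewrite El map_cat flatten_cat seg_cat size_gates_code /= => -[_].
  rewrite seg_cat => -[hg _]; rewrite addn1 in I2.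
  have := wf_gs; rewrite El gates_wf_cat /= => /and3P [_ hwf _].
  steps_tac => /=; rewrite I2 hC.
  set p := _ + 3 * size l1 in hg *.
  apply: run_spec.
    apply: (gate_spec (g := g) (ws := wires v l1)) => //=.
    + case: {El hwf} g hg => [c|i|i j|i j] /=; rewrite !seg_cons;
        by move=> -[-> [h1 [h2 _]]]; rewrite !addn1 h1 h2.
    + by rewrite size_wires sv.
  move=> k4 s4 hk4 G4 [Fv Fa]; steps_tac => /=.
  rewrite (Fv vU isT) (Fv vPT isT) /= I1 G4 size_rcons; split; first lia.
  split; [by rewrite addn1 addnS | by rewrite /p; lia |].
  rewrite (Fa aWIRE isT) /= wires_rcons map_rcons.
  have -> : n + size l1 = size (map nat_of_bool (wires v l1)).
    by rewrite size_map size_wires sv.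
  exact: seg_push.
move=> k1 s1 hk1 [I1 I2 I3] sm1; steps_tac => /=.
have hC := sm1.2 aCODE isT; rewrite /= in hC.
have e2 : vars s vPT + 1 + 3 * size gs = (vars s vPT).+1 + 3 * size gs by lia.
rewrite I2 hC e2 hk.
set p := _ + 3 * size gs in houts hk *.
pose ws := wires v gs.
apply: (run_for (l := tval outs) (B := 20) (I := fun l s' =>
  [/\ vars s' vO = size l, vars s' vPT = p.+1 + size l &
   seg (arr s' aOUT) 0 (map nat_of_bool [seq nth false ws i | i <- l])])) => //=.
- by rewrite size_tuple.
- by rewrite addn1 addn0.
- move=> l1 i l2 s' El [J1 J2 J3] sm; have hC' := sm.2 aCODE isT.
  have hW := sm.2 aWIRE isT; rewrite /= in hC' hW.
  steps_tac => /=; rewrite hC' hC J2 J1 hW.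
  have -> : arr s aCODE (p.+1 + size l1) = i.
    by move: houts; rewrite El seg_cat /= => -[_ /seg_cons []].
  have hi : i < size (wires v gs).
    move: wf_outs; rewrite El all_cat /= => /and3P [_ h _].
    by rewrite size_wires sv.
  rewrite size_rcons addn1 addnS (seg_wires I3 hi).
  split; first lia.
  split; [lia | lia | rewrite !map_rcons].
  have -> : size l1 = size (map nat_of_bool [seq nth false ws i | i <- l1]).
    by rewrite !size_map.
  exact: seg_push.
move=> kk s2 hkk [J1 J2 J3] sm2; split.
  by move: hk1 hkk; rewrite size_tuple szc /=; lia.
split=> //.
- rewrite (sm2.2 aWIRE isT) /=; move: I3.
  by have [u ->] := wires_prefix v gs; rewrite map_cat seg_cat => -[].
- by rewrite J2 szc size_tuple /p; lia.
Qed.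

Lemma bits_val_rcons l c : bits_val (rcons l c) = bits_val l + c * 2 ^ size l.
Proof.
elim: l => [|d l IH] /=; first by rewrite muln0 addn0 muln1.
by rewrite IH expnS; lia.
Qed.

Lemma bits_val_lt l : bits_val l < 2 ^ size l.
Proof. by elim: l => //= d l IH; rewrite expnS; case: d; lia. Qed.

(** Room for reading the output of an action: the place value of a block can reach [2 * b], and the
    proof allows for doubling it once more. *)
Lemma bound_le_K : 4 * b <= K.
Proof.
apply: leq_trans strK; rewrite leq_mul2l /= /node_count.
have nQ0 : 0 < nQ A by apply: leq_ltn_trans (ltn_ord (start A)).
exact: leq_trans (leqW (leq_pmull _ nQ0)) (leq_pmull _ str_gt0).
Qed.

Lemma act_block l1 x l2 (out : seq bool) :
  stopwatches = l1 ++ x :: l2 ->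
  nth [::] (reshape (blocks (beta A)) out) x =
  take (bitlen (beta A x)) (drop (sumn [seq bitlen (beta A y) | y <- l1]) out).
Proof.
move=> E; rewrite nth_reshape /blocks E map_cat -(enum_ord_cat E) nth_cat size_map.
by rewrite ltnn subnn /= take_size_cat ?size_map.
Qed.

Lemma act_spec s (a : circuit (nbits (beta A)) (nbits (beta A))) xi :
  env s ->
  seg (arr s aOUT) 0 (map nat_of_bool (circuit_eval a (assignment_bits xi))) ->
  spec K act_cmd s (40 * (nX A * b.+1).+1)
    (fun s' => digits s' aDIG2 (act a xi)).
Proof.
set out := circuit_eval _ _ => e hout.
have sz : size out = nbits (beta A) by rewrite size_map size_tuple.
pose bl y := bitlen (beta A y).
pose blk x := nth [::] (reshape (blocks (beta A)) out) x.
rewrite /act_cmd; steps_tac.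
apply: (run_for (l := stopwatches) (B := b * 15 + 25)
  (I := fun l s' => [/\ vars s' vX = size l, vars s' vO = sumn (map bl l) &
    forall y, y \in l -> arr s' aDIG2 y = minn (bits_val (blk y)) (beta A y)])).
- by rewrite /= (env_NX e) size_enum_ord.
- by [].
- move=> l1 x l2 s' El [I1 I2 I3] sm; have e1 : env s' by apply: (env_same e sm).
  have hO := sm.2 aOUT isT; rewrite /= in hO.
  have Eb : blk x = take (bl x) (drop (sumn (map bl l1)) out) := act_block _ El.
  have szb : sumn (map bl l1) + bl x <= size out.
    by rewrite sz /nbits /blocks El map_cat sumn_cat /= leq_add2l leq_addr.
  have sb : size (blk x) = bl x by rewrite Eb size_takel // size_drop; lia.
  have hb := beta_lt_bound x; have hK := bound_le_K.
  have h2 : 2 ^ bl x <= 2 * b by apply: leq_trans (exp_bitlen _) _; lia.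
  steps_tac => /=; rewrite I1 (enum_ord_cat El) (env_BLEN e1).
  apply: (run_forn (n := bl x) (B := 14) (I := fun i s' =>
    [/\ vars s' vVV = bits_val (take i (blk x)), vars s' vPW = 2 ^ i &
     vars s' vO = sumn (map bl l1) + i])) => //=.
  + by rewrite take0 I2 addn0.
  + move=> i s2 hi [J1 J2 J3] sm2; have hO2 := sm2.2 aOUT isT; rewrite /= in hO2.
    have hp : 2 ^ i <= 2 ^ bl x by rewrite leq_exp2l // ltnW.
    have hv : bits_val (take i (blk x)) < 2 ^ i.
      by have := bits_val_lt (take i (blk x)); rewrite size_take sb hi.
    have hn : arr s2 aOUT (sumn (map bl l1) + i) = nth false (blk x) i.
      rewrite hO2 hO (seg_wires hout); last by lia.
      by rewrite Eb nth_take // nth_drop.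
    steps_tac => /=; rewrite J3 hn.
    have Et : take i.+1 (blk x) = rcons (take i (blk x)) (nth false (blk x) i).
      by rewrite (take_nth false) // sb.
    rewrite {}Et bits_val_rcons size_take sb hi.
    apply: run_if => /=; case: nth => // _.
      apply: run_add => /=; first by rewrite J1 J2; lia.
      apply: run_add => /=; first by rewrite J2; lia.
      by rewrite J1 J2 mul1n; split; [lia | split=> //; rewrite ?expnS; lia].
    steps_tac; apply: run_add => /=; first by rewrite J2; lia.
    by rewrite J1 J2 mul0n addn0; split; [lia | split=> //; rewrite ?expnS; lia].
  + move=> k3 s3 hk3 [J1 J2 J3] sm3.
    have e3 : env s3 by apply: (env_same e1 sm3).
    have h3 := sm3.1 vX isT; rewrite /= I1 (enum_ord_cat El) in h3.
    have hD := sm3.2 aDIG2 isT; rewrite /= in hD.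
    steps_tac; apply: run_add => /=.
      by rewrite h3; apply: leq_trans (env_posB e3); rewrite leq_add2l ltnW.
    steps_tac => /=; rewrite h3 (env_betaE x e3) J1 -sb take_size.
    have fin v : v = minn (bits_val (blk x)) (beta A x) ->
      forall y, y \in rcons l1 x ->
      (if y == x :> nat then v else arr s3 aDIG2 y) =
      minn (bits_val (blk y)) (beta A y).
      by rewrite hD -(enum_ord_cat El) => hv y; apply: (mem_prefix El I3).
    (* The loop over the bits is charged linearly in the bit length, hence linearly in [b]. *)
    have hnb := bitlen_le (beta A x); rewrite -/(bl x) -sb in hk3 hnb.
    apply: run_if => /= hc; steps_tac => /=; rewrite h3 ?J1 -?sb ?take_size.
    * split; first by nia.
      split; [by rewrite size_rcons (enum_ord_cat El) addn1 | |].
        by rewrite J3 map_rcons sumn_rcons.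
      by apply: fin; lia.
    * split; first by nia.
      split; [by rewrite size_rcons (enum_ord_cat El) addn1 | |].
        by rewrite J3 map_rcons sumn_rcons.
      by apply: fin; lia.
- move=> k s' hk [_ _ I3] _; split.
    by move: hk; rewrite /= size_enum_ord; nia.
  by move=> x; rewrite I3 ?mem_enum // /act ffunE.
Qed.

Lemma elapse_spec s q xi :
  env s -> digits s aDIG xi -> vars s vQ = q ->
  spec K elapse_cmd s (60 * (nX A + (zeta_count A)).+1)
    (fun s' => digits s' aDIG2 (elapse q 1 xi)).
Proof.
move=> e hd hq; rewrite /elapse_cmd; steps_tac.
apply: (run_for (l := stopwatches) (B := 10) (I := fun l s' =>
  vars s' vX = size l /\ forall y, y \in l -> arr s' aDIG2 y = xi y)).
- by rewrite /= (env_NX e) size_enum_ord.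
- by [].
- move=> l1 x l2 s' El [I1 I2] sm; have hD := sm.2 aDIG isT; rewrite /= in hD.
  steps_tac => /=; split; first lia.
  rewrite I1 size_rcons addn1 hD; split=> // y; apply: (mem_prefix El I2).
  by rewrite (enum_ord_cat El) hd.
move=> k1 s1 hk1 [_ I1] sm1; have e1 : env s1 by apply: (env_same e sm1).
have hd1 : digits s1 aDIG xi by move=> y; rewrite sm1.2 //= hd.
have hq1 := sm1.1 vQ isT; rewrite /= hq in hq1.
steps_tac => /=.
apply: (run_for (l := enum (zeta A)) (B := 40) (I := fun l s' =>
  vars s' vZ = vars s1 vPZ + 2 * size l /\ forall y : 'I_(nX A), arr s' aDIG2 y =
    if (y, q) \in l then minn (xi y + 1) (beta A y) else xi y)).
- by rewrite /= (env_NZ e1) cardE.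
- by rewrite /= addn0; split=> // y; rewrite I1 ?mem_enum.
- move=> l1 [x q'] l2 s' El [J1 J2] sm; have e2 : env s' by apply: (env_same e1 sm).
  have hd2 : digits s' aDIG xi by move=> y; rewrite sm.2 //= hd1.
  have hq2 := sm.1 vQ isT; rewrite /= hq1 in hq2.
  have hz := sm.1 vPZ isT; rewrite /= in hz.
  have := env_zeta e2; rewrite El map_cat flatten_cat seg_cat size_pairs_code.
  rewrite hz -J1 /= => -[_ /seg_cons [h1 /seg_cons [h2 _]]].
  steps_tac => /=; rewrite h1 addn1 h2.
  have hZ : (vars s' vZ).+1 + 1 = vars s1 vPZ + 2 * size (rcons l1 (x, q')).
    by rewrite J1 size_rcons; lia.
  have ne : q' <> q -> forall y : 'I_(nX A), arr s' aDIG2 y =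
     if (y, q) \in rcons l1 (x, q') then minn (xi y + 1) (beta A y) else xi y.
    move=> hn y; rewrite J2 mem_rcons inE; case: eqP => // -[_ h].
    by case: hn.
  apply: run_if => /=; rewrite hq2 => c1.
    apply: run_skip; split; first lia.
    by split=> //; apply: ne => h; move: c1; rewrite h subnn.
  apply: run_if => /= c2.
    apply: run_skip; split; first lia.
    by split=> //; apply: ne => h; move: c2; rewrite /= h subnn.
  have Eq : q' = q by apply: ord_inj; move: c1 c2; rewrite /= ?hq2; lia.
  rewrite {}Eq in El hZ ne h2 c1 c2 *.
  steps_tac; apply: run_add => /=.
    by apply: leq_trans (env_posB e2); rewrite leq_add2l ltnW.
  have fin v : v = minn (xi x + 1) (beta A x) -> forall y : 'I_(nX A),
      (if y == x :> nat then v else arr s' aDIG2 y) =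
      if (y, q) \in rcons l1 (x, q) then minn (xi y + 1) (beta A y) else xi y.
    move=> hv y; rewrite mem_rcons inE; case: eqP => [/ord_inj ->|ny].
      by rewrite eqxx.
    by rewrite J2 xpair_eqE; case: eqP => // h; case: ny; rewrite h.
  steps_tac => /=; rewrite ?h1 hd2 (env_betaE x e2).
  apply: run_if => /= hc; steps_tac => /=; rewrite ?h1 ?hd2; split; try lia.
    by split=> //; apply: fin; lia.
  by split=> //; apply: fin; lia.
move=> k2 s2 hk2 [_ J2] _; split.
  have hz : size (enum (zeta A)) = zeta_count A by rewrite /zeta_count cardE.
  by move: hk1 hk2; rewrite /= size_enum_ord hz; lia.
by move=> x; rewrite J2 mem_enum /elapse ffunE; case: ifP.
Qed.

Definition stored s (l : seq arc) : Prop :=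
  [/\ seg (arr s aLAB) 0 (map lab l), seg (arr s aSRC) 0 (map src l),
     seg (arr s aDST) 0 (map dst l) & vars s vE = size l].

Lemma stored_same c s s' l : stored s l -> same c s s' ->
  [&& ~~ writes_array c aLAB, ~~ writes_array c aSRC, ~~ writes_array c aDST
    & ~~ writes c vE] -> stored s' l.
Proof.
move=> [h1 h2 h3 h4] [Fv Fa] /and4P [a1 a2 a3 a4].
by split; rewrite ?(Fa _ a1) ?(Fa _ a2) ?(Fa _ a3) ?(Fv _ a4).
Qed.

Lemma push_spec s l (u v w : var) :
  stored s l ->
  spec K (push u v w) s 10
    (fun s' => stored s' (rcons l (vars s u, vars s v, vars s w))).
Proof.
move=> [h1 h2 h3 h4]; rewrite /push; steps_tac => /=; split; first lia.
rewrite h4; split; rewrite /= ?map_rcons ?size_rcons ?addn1 //.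
- by rewrite -{1}(size_map lab); apply: seg_push.
- by rewrite -{1}(size_map src); apply: seg_push.
- by rewrite -{1}(size_map dst); apply: seg_push.
Qed.

Lemma test_neq_spec s (u v : var) : ~~ veq u vT -> ~~ veq v vT ->
  spec K (test_neq u v) s 10 (fun s' => vars s' vLT = (vars s u != vars s v)).
Proof.
move=> /negbTE hu /negbTE hv; rewrite /test_neq; steps_tac => /=; rewrite hu hv.
apply: run_if => /= h1; first by steps_tac => /=; split=> //; case: eqP h1; lia.
by apply: run_if => /= h2; steps_tac => /=; split=> //; case: eqP h2; lia.
Qed.

Lemma move_spec s xi q :
  env s -> digits s aDIG xi -> vars s vQ = q ->
  spec K move_cmd s (encode_time + 60 * (nX A + (zeta_count A)).+1 + 30)
    (fun s' => vars s' vLT = (if q == accept A then 1 else (lambda A q).+2) /\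
       vars s' vEID =
         if q == accept A then 0 else node_id str q (elapse q 1 xi)).
Proof.
move=> e hd hq; rewrite /move_cmd; steps_tac.
apply: run_spec; first exact: test_neq_spec.
move=> k1 s1 hk1 E1 sm1; have e1 : env s1 by apply: (env_same e sm1).
have hd1 : digits s1 aDIG xi by move=> y; rewrite sm1.2 //= hd.
have hq1 : vars s1 vQ = q by rewrite (sm1.1 vQ isT).
rewrite hq (env_AC e) in E1; apply: run_if; rewrite /= E1; last first.
  case: eqP => // /ord_inj Eq _; steps_tac => /=; rewrite Eq eqxx.
  by split=> //; lia.
case: eqP => // nq _.
have -> : q == accept A = false by apply/eqP => h; rewrite h in nq.
steps_tac; apply: run_spec; first exact: (elapse_spec e1 hd1 hq1).
move=> k2 s2 hk2 D2 sm2; have e2 : env s2 by apply: (env_same e1 sm2).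
have hq2 : vars s2 vQ = q by rewrite (sm2.1 vQ isT).
steps_tac; apply: run_spec; first exact: (encode_id_spec e2 D2 hq2).
move=> k3 s3 hk3 E3 sm3; have e3 : env s3 by apply: (env_same e2 sm3).
have hq3 : vars s3 vQ = q by rewrite (sm3.1 vQ isT).
steps_tac; apply: run_add => /=.
  by rewrite hq3; apply: leq_trans (env_posL e3); rewrite leq_add2l ltnW.
steps_tac => /=; rewrite hq3 (env_lambdaE q e3) addn2 E3.
by split=> //; lia.
Qed.

Lemma states_spec s xi l0 :
  env s -> digits s aDIG xi -> stored s l0 ->
  spec K states_cmd s
    (nQ A * (2 * encode_time + 60 * (nX A + (zeta_count A)) + 180) + 10)
    (fun s' =>
       stored s' (l0 ++ flatten [seq state_arcs str xi q | q <- enum 'I_(nQ A)])).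
Proof.
move=> e hd hl0; rewrite /states_cmd; steps_tac.
apply: (run_for (l := enum 'I_(nQ A))
  (B := 2 * encode_time + 60 * (nX A + (zeta_count A)) + 170)
  (I := fun l s' => vars s' vQ = size l /\
     stored s' (l0 ++ flatten [seq state_arcs str xi q | q <- l]))).
- by rewrite /= (env_NQ e) size_enum_ord.
- by rewrite /= cats0.
- move=> l1 q l2 s' El [I1 I2] sm; have e1 : env s' by apply: (env_same e sm).
  have hd1 : digits s' aDIG xi by move=> y; rewrite sm.2 //= hd.
  rewrite (enum_ord_cat El) in I1; steps_tac.
  apply: run_spec; first exact: (encode_id_spec e1 hd1 I1).
  move=> k1 s1 hk1 J1 sm1.
  have e2 : env s1 by apply: (env_same e1 sm1).
  have hd2 : digits s1 aDIG xi by move=> y; rewrite sm1.2 //= hd1.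
  have hQ1 : vars s1 vQ = q by rewrite (sm1.1 vQ isT).
  have st1 := stored_same I2 sm1 isT.
  steps_tac; apply: run_spec; first by apply: push_spec; exact: st1.
  move=> k2 s2 hk2 st2 sm2; rewrite /= J1 in st2.
  have e3 : env s2 by apply: (env_same e2 sm2).
  have hd3 : digits s2 aDIG xi by move=> y; rewrite sm2.2 //= hd2.
  have hQ2 : vars s2 vQ = q by rewrite (sm2.1 vQ isT).
  have hS2 : vars s2 vSID = node_id str q xi by rewrite (sm2.1 vSID isT).
  steps_tac; apply: run_spec; first exact: (move_spec e3 hd3 hQ2).
  move=> k3 s3 hk3 [L3 E3] sm3; have st3 := stored_same st2 sm3 isT.
  steps_tac; apply: run_spec; first by apply: push_spec; exact: st3.
  move=> k4 s4 hk4; rewrite L3 E3 (sm3.1 vSID isT) hS2 => st4 sm4.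
  steps_tac => /=; rewrite (sm4.1 vQ isT) (sm3.1 vQ isT) hQ2 size_rcons addn1.
  rewrite (enum_ord_cat El); split; first lia.
  split=> //; move: st4; rewrite map_rcons flatten_rcons -!cats1 -!catA /=.
  by rewrite /state_arcs; case: ifP.
- move=> k s' hk [_ I2] _; split=> //.
  by move: hk; rewrite /= size_enum_ord; nia.
Qed.


Lemma circuit_eval1 n (C : circuit n 1) v : exists c, circuit_eval C v = [:: c].
Proof.
have: size (circuit_eval C v) = 1 by rewrite size_map size_tuple.
by case: (circuit_eval C v) => [|c []] // _; exists c.
Qed.

Lemma transitions_code_cons d l :
  transitions_code (d :: l) = val (source d) :: val (target d) ::
    circuit_code (guard d) ++ circuit_code (action d) ++ transitions_code l.
Proof. by rewrite catA. Qed.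

Definition act_time : nat := 40 * (nX A * b.+1).+1.

Lemma transitions_spec s xi l0 :
  env s -> digits s aDIG xi -> stored s l0 ->
  seg (arr s aWIRE) 0 (map nat_of_bool (assignment_bits xi)) ->
  vars s vNW = nbits (beta A) ->
  spec K transitions_cmd s
    (size (Delta A) * (2 * encode_time + 60 * size (transitions_code (Delta A))
                       + act_time + 60) + 10)
    (fun s' => stored s' (l0 ++ flatten [seq transition_arcs str xi d | d <- Delta A])
       /\ vars s' vPT = vars s vPD + size (transitions_code (Delta A))).
Proof.
move=> e hd hl0 hW hN; rewrite /transitions_cmd; steps_tac.
apply: (run_for (l := Delta A)
  (B := 2 * encode_time + 60 * size (transitions_code (Delta A)) + act_time + 55)
  (I := fun l s' => [/\ vars s' vPT = vars s vPD + size (transitions_code l),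
     stored s' (l0 ++ flatten [seq transition_arcs str xi d | d <- l]) &
     seg (arr s' aWIRE) 0 (map nat_of_bool (assignment_bits xi))])).
- by rewrite /= (env_ND e).
- by rewrite /= addn0 cats0.
- move=> l1 d l2 s' El [I1 I2 I3] sm; have e1 : env s' by apply: (env_same e sm).
  have hd1 : digits s' aDIG xi by move=> y; rewrite sm.2 //= hd.
  have hN1 : vars s' vNW = nbits (beta A) by rewrite (sm.1 vNW isT).
  have hC := sm.2 aCODE isT; rewrite /= in hC.
  have szE : size (transitions_code (Delta A)) = size (transitions_code l1) +
     (size (transition_code d) + size (transitions_code l2)).
    by rewrite El /transitions_code map_cat flatten_cat size_cat /= size_cat.
  have szd : size (transition_code d) =
     2 + size (circuit_code (guard d)) + size (circuit_code (action d)).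
    by rewrite /= size_cat.
  have hD := env_Delta e; rewrite El map_cat flatten_cat seg_cat in hD.
  case: hD => _; rewrite -/(transitions_code l1) -I1 -/(transitions_code (d :: l2)).
  rewrite transitions_code_cons => /seg_cons [h1 /seg_cons [h2]].
  move=> /seg_cat [h3 /seg_cat [h4 _]].
  rewrite -hC in h1 h2 h3 h4.
  steps_tac => /=; rewrite h1 addn1 h2.
  apply: run_spec.
    apply: (encode_id_spec (q := source d) (xi := xi)) => //.
    exact: (env_ext _ e1).
  move=> k1 s1 hk1 E1 sm1; have e2 : env s1 by apply: (env_same e1 sm1).
  have hN2 : vars s1 vNW = nbits (beta A) by rewrite (sm1.1 vNW isT).
  have hC2 := sm1.2 aCODE isT; have hP2 := sm1.1 vPT isT.
  have hW2 := sm1.2 aWIRE isT; have hS2 := sm1.1 vSRC isT; have hT2 := sm1.1 vTGT isT.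
  rewrite /= ?addn1 in hC2 hP2 hW2 hS2 hT2.
  have st1 : stored s1 (l0 ++ flatten [seq transition_arcs str xi d | d <- l1]).
    by apply: (stored_same _ sm1) => //; exact: I2.
  steps_tac; apply: run_spec.
    apply: (eval_spec (C := guard d) (v := assignment_bits xi)) => //=.
    + by rewrite hC2 hP2.
    + exact: size_assignment_bits.
    + by rewrite hW2.
  move=> k2 s2 hk2 [O2 W2 P2] sm2; have e3 : env s2 by apply: (env_same e2 sm2).
  have hC3 := sm2.2 aCODE isT; have hN3 := sm2.1 vNW isT.
  rewrite /= in hC3 hN3.
  have {}P2 : vars s2 vPT = vars s1 vPT + size (circuit_code (guard d)) := P2.
  have [c Ec] := circuit_eval1 (guard d) (assignment_bits xi).
  rewrite Ec in O2; steps_tac; rewrite /= (O2 0 isT) /=.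
  apply: run_spec.
    apply: (eval_spec (C := action d) (v := assignment_bits xi)) => //=.
    + by rewrite hC3 hC2 P2 hP2.
    + by rewrite hN3.
    + exact: size_assignment_bits.
  move=> k3 s3 hk3 [O3 W3 P3] sm3.
  have {}P3 : vars s3 vPT = vars s2 vPT + size (circuit_code (action d)) := P3.
  have e4 : env s3 by apply: (env_same e3 sm3).
  steps_tac; apply: run_spec; first exact: (act_spec e4 O3).
  move=> k4 s4 hk4 D4 sm4; have e5 : env s4 by apply: (env_same e4 sm4).
  have hT4 : vars s4 vTGT = target d.
    by rewrite (sm4.1 vTGT isT) (sm3.1 vTGT isT) /= (sm2.1 vTGT isT) /= hT2.
  steps_tac; apply: run_spec; first exact: (encode_id_spec e5 D4 hT4).
  move=> k5 s5 hk5 E5 sm5; have e6 : env s5 by apply: (env_same e5 sm5).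
  have hG5 : vars s5 vGV = c.
    by rewrite (sm5.1 vGV isT) (sm4.1 vGV isT) (sm3.1 vGV isT).
  have hSI5 : vars s5 vSID = node_id str (source d) xi.
    by rewrite (sm5.1 vSID isT) (sm4.1 vSID isT) (sm3.1 vSID isT) /=
      (sm2.1 vSID isT).
  have hSR5 : vars s5 vSRC = source d.
    by rewrite (sm5.1 vSRC isT) (sm4.1 vSRC isT) (sm3.1 vSRC isT) /=
      (sm2.1 vSRC isT) /= hS2.
  have P5 : vars s5 vPT = vars s vPD + size (transitions_code (rcons l1 d)).
    rewrite (sm5.1 vPT isT) (sm4.1 vPT isT) P3 P2 hP2 I1.
    have -> : size (transitions_code (rcons l1 d)) =
        size (transitions_code l1) + size (transition_code d).
      by rewrite /transitions_code map_rcons flatten_rcons size_cat.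
    by rewrite szd; lia.
  have W5 : seg (arr s5 aWIRE) 0 (map nat_of_bool (assignment_bits xi)).
    by rewrite (sm5.2 aWIRE isT) (sm4.2 aWIRE isT).
  have st5 : stored s5 (l0 ++ flatten [seq transition_arcs str xi d | d <- l1]).
    apply: (stored_same _ sm5) => //; apply: (stored_same _ sm4) => //.
    apply: (stored_same _ sm3) => //; apply: (stored_same _ sm2) => //.
  rewrite map_rcons flatten_rcons catA {2}/transition_arcs Ec.
  (* Both circuits are part of the code of [d], so their evaluation is paid for by the length of the
     code. *)
  have ht : k1 + k2 + k3 + k4 + k5 <= 2 * encode_time +
      60 * size (transitions_code (Delta A)) + act_time.
    by rewrite szE szd /act_time; lia.
  apply: run_if; rewrite /= hG5; last first.
    case: (c) => // _; steps_tac; rewrite andbF cats0.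
    by split=> //; lia.
  case: (c) => // _; steps_tac; rewrite andbT.
  apply: run_spec; first exact: test_neq_spec.
  move=> k6 s6 hk6 L6 sm6; rewrite hSR5 (env_AC e6) in L6.
  have W6 := sm6.2 aWIRE isT; have P6 := sm6.1 vPT isT.
  have st6 := stored_same st5 sm6 isT.
  apply: run_if; rewrite /= L6; last first.
    case: eqP => // /ord_inj -> _; steps_tac; rewrite eqxx /= cats0.
    by split; [lia | split; rewrite ?P6 ?W6].
  case: eqP => // nq _.
  have -> : source d != accept A by apply/eqP => h; rewrite h in nq.
  steps_tac; apply: run_spec; first by apply: push_spec; exact: st6.
  move=> k7 s7 hk7; rewrite /= (sm6.1 vEID isT) E5 (sm6.1 vSID isT) hSI5 => st7 sm7.
  split; first lia.
  split; last 2 first.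
  + by rewrite cats1.
  + by rewrite (sm7.2 aWIRE isT) /= W6.
  by rewrite (sm7.1 vPT isT) /= P6.
- move=> k s' hk [I1 I2 _] _; split=> //.
  by move: hk; rewrite /=; nia.
Qed.

Notation code := (automaton_code A).

(** The last clause says that the transitions end where the code ends, which later locates the code
    of the next automaton. *)
Lemma header_spec s :
  seg (arr s aCODE) (vars s vP) code -> vars s vP + size code <= K ->
  vars s vSTR = str ->
  spec K header_cmd s 60 (fun s' => [/\ header s', vars s' vST = start A &
    vars s' vPD + size (transitions_code (Delta A)) = vars s vP + size code]).
Proof.
have := size_code A; set n := size code => szc hc hK hs.
have h := hc; rewrite /automaton_code in h.
move/seg_cat: h => [h0 /seg_cat [h1 /seg_cat [h2 /seg_cons [h3 /seg_cat [h4]]]]].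
move=> /seg_cons [h5 h6]; move: h1 h2 h3 h4 h5 h6.
rewrite (size_map _ (enum 'I_(nQ A))) (size_map _ (enum 'I_(nX A))).
rewrite !size_enum_ord size_pairs_code -cardE /=.
rewrite -/(zeta_count A) => h1 h2 h3 h4 h5 h6.
set p := vars s vP in hc hK szc h0 h1 h2 h3 h4 h5 h6.
move: h0 => /seg_cons [_ /seg_cons [g1 /seg_cons [g2 /seg_cons [g3 /seg_cons [g4 _]]]]].
rewrite /header_cmd; steps_tac => /=; rewrite -/p.
rewrite !addn1 g1 g2 g3 g4; apply: run_add => /=; first by lia.
steps_tac; apply: run_add => /=; first by lia.
steps_tac => /=.
have -> : p.+4.+1 + nQ A + nX A = p + 5 + nQ A + nX A by lia.
rewrite h3; steps_tac; apply: run_add => /=; first by rewrite !addn1; lia.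
steps_tac; apply: run_add => /=; first by rewrite !addn1; lia.
steps_tac => /=.
have -> : p + 5 + nQ A + nX A + 1 + (zeta_count A) + (zeta_count A) =
  (p + 5 + nQ A + nX A).+1 + 2 * (zeta_count A) by lia.
rewrite h5; split; first lia.
split=> //; last by lia.
split=> //=.
- by have -> : p.+4.+1 = p + 5 by lia.
- by have -> : p.+4.+1 + nQ A = p + 5 + nQ A by lia.
- by rewrite addn1.
- by rewrite addn1.
- by lia.
- by lia.
Qed.

Lemma span_le l1 l2 : stopwatches = l1 ++ l2 -> span l1 <= b.
Proof. by move=> E; rewrite -span_enum E span_cat leq_pmulr // span_gt0. Qed.

Lemma weights_spec s :
  header s ->
  spec K weights_cmd s (40 * (nQ A + nX A * b.+1).+1)
    (fun s' => [/\ env s', vars s' vM = str * nQ A * b & vars s' vBB = b]).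
Proof.
move=> hd; rewrite /weights_cmd; steps_tac => /=.
apply: (run_forn (n := nQ A) (B := 1) (I := fun i s' => vars s' vM = str * i)).
- by rewrite /= (env_NQ hd).
- by rewrite /= muln0.
- move=> i s' hi E [Fv _]; steps_tac; apply: run_add => /=.
    rewrite E (Fv vSTR isT) /= (env_STR hd) -mulnSr; apply: str_le.
    by have := bound_gt0 A; nia.
  by rewrite E (Fv vSTR isT) /= (env_STR hd) -mulnSr.
move=> k1 s1 hk1 E1 sm1; steps_tac => /=.
have hd1 : header s1 by apply: (header_same hd sm1).
apply: (run_for (l := stopwatches) (B := 20 * b + 25) (I := fun l s' =>
  [/\ vars s' vX = size l, vars s' vM = str * nQ A * span l, vars s' vBB = span l &
   forall y, y \in l ->
     arr s' aWGT y = str * nQ A * span (take y stopwatches) /\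
     arr s' aBLEN y = bitlen (beta A y)])).
- by rewrite /= (env_NX hd1) size_enum_ord.
- by rewrite /= E1 muln1.
- move=> l1 x l2 s' El [I1 I2 I3 I4] sm.
  have hd2 : header s' by apply: (header_same hd1 sm).
  have hb := beta_lt_bound x; have hK := bound_le_K.
  rewrite (enum_ord_cat El) in I1.
  steps_tac; apply: run_add => /=.
    by rewrite I1; apply: leq_trans (env_posB hd2); rewrite leq_add2l ltnW.
  steps_tac => /=; rewrite I1 (env_betaE x hd2) I2.
  (* Counting stops once the power of two exceeds [beta A x], whence the minimum; since
     [bitlen n <= n], the [beta A x] rounds are enough. *)
  apply: (run_forn (n := beta A x) (B := 12) (I := fun i s' =>
    vars s' vBW = minn i (bitlen (beta A x)) /\ vars s' vPW = 2 ^ vars s' vBW)) => //=.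
  + by rewrite min0n.
  + move=> i s2 hi [J1 J2] sm2; have hU := sm2.1 vU isT; rewrite /= in hU.
    have up j : ((beta A x).+1 <= 2 ^ j) = (bitlen (beta A x) <= j).
      apply/idP/idP => h; first by apply: up_log_min.
      by apply: leq_trans (bitlen_gt _) _; rewrite leq_exp2l.
    steps_tac => /=; rewrite hU J2 addn1; apply: run_if => /=.
      rewrite subn_gt0 => hlt; steps_tac.
      apply: run_add => /=; first by rewrite ?J2; lia.
      have : ~~ (bitlen (beta A x) <= vars s2 vBW) by rewrite -up -ltnNge.
      rewrite ?J2 J1 => hn; split; first lia.
      by rewrite addn1 expnS; split; [lia | rewrite mul2n addnn].
    move/eqP; rewrite subn_eq0 up J1 => hle; apply: run_skip; split; first lia.
    by rewrite /= J2 J1; split=> //; lia.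
  + move=> k2 s2 hk2 [J1 J2] sm2; steps_tac => /=.
    have hX2 := sm2.1 vX isT; have hM2 := sm2.1 vM isT; have hB2 := sm2.1 vB isT.
    have hBB2 := sm2.1 vBB isT; rewrite /= ?I1 ?I2 ?I3 in hX2 hM2 hB2 hBB2.
    rewrite hX2 hM2 hBB2 J1.
    have sle : span (rcons l1 x) <= b.
      by apply: (@span_le _ l2); rewrite cat_rcons.
    rewrite span_rcons in sle.
    apply: (run_forn (n := beta A x) (B := 4) (I := fun i s' =>
       vars s' vM = str * nQ A * span l1 * i.+1 /\ vars s' vBB = span l1 * i.+1)).
    * by rewrite /= hB2.
    * by rewrite /= hM2 hBB2 !muln1.
    * move=> i s3 hi [M1 M2] sm3; have h1 := sm3.1 vM0 isT.
      have h2 := sm3.1 vEW isT; rewrite /= in h1 h2.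
      have hi2 : span l1 * i.+2 <= b.
        by apply: leq_trans sle; rewrite leq_mul2l; apply/orP; right; lia.
      have e1 : str * nQ A * span l1 * i.+1 + str * nQ A * span l1 =
          str * nQ A * span l1 * i.+2 by rewrite -mulnSr.
      have e2 : span l1 * i.+1 + span l1 = span l1 * i.+2 by rewrite -mulnSr.
      steps_tac; apply: run_add; rewrite /= M1 h1 e1.
        rewrite -!mulnA; apply: str_le.
        by have := leq_mul (leqnn (nQ A)) hi2; lia.
      apply: run_add; rewrite /= M2 h2 e2; first by lia.
      by [].
    * move=> k3 s3 hk3 [M1 M2] sm3; steps_tac => /=.
      have hX3 := sm3.1 vX isT; rewrite /= hX2 in hX3.
      rewrite hX3 addn1 span_rcons mulnA; split; first by rewrite /= in hk3; lia.
      split=> //; first by rewrite size_rcons (enum_ord_cat El).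
      move=> y hy; rewrite (sm3.2 aWGT isT) (sm3.2 aBLEN isT) /=.
      rewrite (sm2.2 aWGT isT) (sm2.2 aBLEN isT) /=.
      move: hy; rewrite mem_rcons inE => /orP [/eqP ->|hy].
        rewrite !eqxx (take_enum El); split=> //.
        by apply/minn_idPr; apply: bitlen_le.
      by case: eqP => [/ord_inj yx|_]; [move: (enum_uniq 'I_(nX A)); rewrite El
         cat_uniq -yx /= hy orTb andbF | apply: I4].
- move=> k s' hk [I1 I2 I3 I4] sm; rewrite span_enum in I2 I3.
  split; first by move: hk hk1; rewrite /= size_enum_ord; nia.
  split=> //; split; last 2 first.
  + by move=> x; case: (I4 x) => //; rewrite mem_enum.
  + by move=> x; case: (I4 x) => //; rewrite mem_enum.
  by apply: (header_same hd1 sm).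
Qed.

Definition graph_time : nat :=
  b * (30 * (nX A * b.+1).+1 + 30 * (nX A * (nbits (beta A) * b.+1).+1).+1
       + nQ A * (2 * encode_time + 60 * (nX A + (zeta_count A)) + 180)
       + size (Delta A) * (2 * encode_time + 60 * size (transitions_code (Delta A))
                           + act_time + 60) + 40)
  + 40 * (nQ A + nX A * b.+1).+1 + 2 * nQ A + 100.

Lemma rank_zero w l : rank (zero_assignment A) w l = 0.
Proof. by elim: l w => //= x l IH w; rewrite IH ffunE. Qed.

Lemma graph_spec s l0 :
  seg (arr s aCODE) (vars s vP) code -> vars s vP + size code <= K ->
  vars s vSTR = str -> stored s l0 ->
  spec K graph_cmd s graph_time (fun s' =>
    [/\ stored s' (l0 ++ arcs A str), vars s' vP = vars s vP + size code,
       vars s' vSTR = str * node_count A &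
       vars s' vS1 = node_id str (start A) (zero_assignment A)]).
Proof.
move=> hc hK hs hl0; rewrite /graph_cmd; step; step.
apply: run_spec; first exact: (header_spec hc hK hs).
move=> k1 s1 hk1 [hd1 S1 PD1] sm1; have st1 := stored_same hl0 sm1 isT.
step; apply: run_spec; first exact: (weights_spec hd1).
move=> k2 s2 hk2 [e2 M2 B2] sm2; have st2 := stored_same st1 sm2 isT.
have hD2 := sm2.1 vPD isT; have hS2 := sm2.1 vST isT.
have hP2 : vars s2 vP = vars s vP by rewrite (sm2.1 vP isT) (sm1.1 vP isT).
steps_tac.
set B := 30 * (nX A * b.+1).+1 + 30 * (nX A * (nbits (beta A) * b.+1).+1).+1
       + nQ A * (2 * encode_time + 60 * (nX A + (zeta_count A)) + 180)
       + size (Delta A) * (2 * encode_time + 60 * size (transitions_code (Delta A))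
                           + act_time + 60).
(* [vPT] reaches the end of the code only within a round, hence the guard [0 < size l]; the bound is
   positive, so the guard holds after the loop. *)
apply: (run_for (l := iota 0 b) (B := B + 30) (I := fun l s' =>
  [/\ vars s' vEC = size l,
    stored s' (l0 ++ flatten [seq assignment_arcs str (unrank A e) | e <- l]) &
    0 < size l ->
      vars s' vPT = vars s2 vPD + size (transitions_code (Delta A))])).
- by rewrite size_iota /= B2.
- by rewrite /= cats0; split.
- move=> l1 e l2 s' El [I1 I2 _] sm; have e3 : env s' by apply: (env_same e2 sm).
  have Ee : size l1 = e.
    have hs1 : size l1 < b.
      by rewrite -(size_iota 0 b) El size_cat /= addnS ltnS leq_addr.
    by have := nth_iota 0 0 hs1; rewrite El nth_cat ltnn subnn.
  have he : e < b by have : e \in iota 0 b by [rewrite El mem_cat inE eqxx orbT];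
     rewrite mem_iota.
  rewrite Ee in I1.
  step; step; apply: run_spec; first exact: (unrank_spec e3 I1 he).
  move=> k3 s3 hk3 D3 sm3; have e4 : env s3 by apply: (env_same e3 sm3).
  have st3 := stored_same I2 sm3 isT.
  step; apply: run_spec; first exact: (bits_spec e4 D3).
  move=> k4 s4 hk4 [W4 N4] sm4; have e5 : env s4 by apply: (env_same e4 sm4).
  have st4 := stored_same st3 sm4 isT.
  have D4 : digits s4 aDIG (unrank A e) by move=> x; rewrite (sm4.2 aDIG isT).
  step; apply: run_spec; first exact: (states_spec e5 D4 st4).
  move=> k5 s5 hk5 st5 sm5; have e6 : env s5 by apply: (env_same e5 sm5).
  have D5 : digits s5 aDIG (unrank A e) by move=> x; rewrite (sm5.2 aDIG isT).
  have N5 : vars s5 vNW = nbits (beta A) by rewrite (sm5.1 vNW isT).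
  have W5 : seg (arr s5 aWIRE) 0 (map nat_of_bool (assignment_bits (unrank A e))).
    by rewrite (sm5.2 aWIRE isT).
  step; apply: run_spec; first exact: (transitions_spec e6 D5 st5 W5 N5).
  move=> k6 s6 hk6 [st6 P6] sm6; steps_tac => /=.
  split; first by rewrite /B; lia.
  split.
  + rewrite (sm6.1 vEC isT) (sm5.1 vEC isT) (sm4.1 vEC isT) (sm3.1 vEC isT) I1.
    by rewrite size_rcons Ee addn1.
  + by move: st6; rewrite map_rcons flatten_rcons -!catA.
  + move=> _; rewrite P6 (sm5.1 vPD isT) (sm4.1 vPD isT) (sm3.1 vPD isT).
    by rewrite (sm.1 vPD isT).
move=> k3 s3 hk3 [_ st3 P3] sm3.
have e3 : env s3 by apply: (env_same e2 sm3).
have hP3 : vars s3 vP = vars s vP by rewrite (sm3.1 vP isT).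
have hM3 : vars s3 vM = str * nQ A * b by rewrite (sm3.1 vM isT).
have hS3 : vars s3 vST = start A by rewrite (sm3.1 vST isT) /= hS2.
have {}P3 : vars s3 vPT = vars s vP + size code.
  by rewrite P3 ?size_iota ?bound_gt0 // hD2.
steps_tac => /=; rewrite (env_STR e3).
have ids : node_id str (start A) (zero_assignment A) = str + str * start A.
  by rewrite /node_id rank_zero addn0.
apply: (run_forn (n := start A) (B := 1) (I := fun i s' =>
   vars s' vS1 = str + str * i)) => //=.
- by rewrite muln0 addn0.
- move=> i s' hi E [Fv _]; steps_tac; apply: run_add => /=.
    rewrite E (Fv vSTR isT) /= (env_STR e3).
    have -> : str + str * i + str = str * i.+2 by lia.
    by apply: str_le; have := ltn_ord (start A); have := bound_gt0 A; nia.
  by rewrite E (Fv vSTR isT) /= (env_STR e3); split=> //; lia.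
move=> k4 s4 hk4 E4 sm4; have := sm4.1 vPT isT; have := sm4.1 vM isT.
have := sm4.1 vSTR isT; rewrite /= P3 hM3 (env_STR e3) => T4 M4 P4.
have Es : str * nQ A * b + str = str * node_count A by rewrite /node_count; lia.
steps_tac; apply: run_add; rewrite /= M4 T4 Es; first by have := strK; lia.
split.
  rewrite /graph_time -/B; move: hk3; rewrite /= size_iota.
  by have := ltn_ord (start A); nia.
split=> //=; last by rewrite E4 ids.
by apply: (stored_same _ sm4).
Qed.
End GraphCode.

(** * Reachability in the product graph *)

(* As many rounds as there are nodes (vSTR); every round relaxes all product
   arcs, which are the pairs of arcs with the same label. *)
Definition search_cmd : cmd :=
  Add vT vS0 vS1 ;; Sto aMARK vT 1 ;; Sub vK vE vE0 ;;
  For vSTR (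
    Mov vJ 0 ;;
    For vE0 (
      Ld vL1 aLAB vJ ;; Ld vI1 aSRC vJ ;; Ld vU aDST vJ ;; Mov vJ2 vE0 ;;
      For vK (
        Ld vL2 aLAB vJ2 ;; Sub vT vL1 vL2 ;; Sub vL2 vL2 vL1 ;;
        If vT Skip (If vL2 Skip (
          Ld vT aSRC vJ2 ;; Add vT vI1 vT ;; Ld vT aMARK vT ;;
          If vT (Ld vT aDST vJ2 ;; Add vT vU vT ;; Sto aMARK vT 1) Skip)) ;;
        Add vJ2 vJ2 1) ;;
      Add vJ vJ 1)) ;;
  Ld vRES aMARK 0.

Section Search.
Variables (K N : nat) (G1 G2 : seq arc) (u0 : nat).
Hypothesis NK : N <= K.
Hypothesis u0N : u0 < N.
Hypothesis arcsN : forall a a', a \in G1 -> a' \in G2 ->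
  src a + src a' < N /\ dst a + dst a' < N.

Definition product_rel : rel nat := fun u v =>
  has (fun a => has (fun a' =>
    [&& lab a == lab a', src a + src a' == u & dst a + dst a' == v]) G2) G1.

Lemma product_relP u v :
  reflect (exists a a', [/\ a \in G1, a' \in G2, lab a = lab a',
             src a + src a' = u & dst a + dst a' = v])
          (product_rel u v).
Proof.
apply: (iffP hasP) => [[a h1 /hasP [a' h2 /and3P [/eqP e1 /eqP e2 /eqP e3]]]|].
  by exists a, a'.
move=> [a [a' [h1 h2 e1 e2 e3]]]; exists a => //; apply/hasP; exists a' => //.
by rewrite e1 e2 e3 !eqxx.
Qed.

Definition reachable (v : nat) : Prop :=
  exists2 p, path product_rel u0 p & last u0 p = v.

Definition marked (s : store) (i : nat) : Prop := 0 < arr s aMARK i.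

(** A mark set during a round may already be used in the same round, so completeness is claimed only
    relative to the marks [s0] at its beginning, while soundness is absolute. *)
Definition relaxed (s0 s : store) (l : seq (arc * arc)) : Prop :=
  [/\ forall i, marked s i -> reachable i,
      forall i, marked s0 i -> marked s i &
      forall p, p \in l -> lab p.1 = lab p.2 -> marked s0 (src p.1 + src p.2) ->
        marked s (dst p.1 + dst p.2)].

Lemma reachable_step a a' : a \in G1 -> a' \in G2 -> lab a = lab a' ->
  reachable (src a + src a') -> reachable (dst a + dst a').
Proof.
move=> h1 h2 e [p hp ep]; exists (rcons p (dst a + dst a')); last first.
  by rewrite last_rcons.
by rewrite rcons_path hp ep; apply/product_relP; exists a, a'.
Qed.

Lemma relaxed_sub s0 s l1 l2 : {subset l2 <= l1} -> relaxed s0 s l1 -> relaxed s0 s l2.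
Proof. by move=> h [h1 h2 h3]; split=> // p /h; apply: h3. Qed.

(** After [k] rounds the end of every path of length at most [k] from [u0] is marked, and a path
    without repetitions inside [N] nodes is shorter than [N]. *)
Lemma search_spec s :
  stored s (G1 ++ G2) -> vars s vE0 = size G1 -> vars s vSTR = N ->
  vars s vS0 + vars s vS1 = u0 -> (forall i, arr s aMARK i = 0) ->
  spec K search_cmd s (N * (size G1 * (size G2 * 40 + 40) + 40) + 40)
    (fun s' => 0 < vars s' vRES <-> reachable 0).
Proof.
move=> [hL hS hD hE] hE0 hN hu hM; rewrite /search_cmd; step; step.
apply: run_add; rewrite /= hu; first by lia.
steps_tac => /=; rewrite hE hE0 size_cat addKn.
apply: (run_forn (n := N) (B := size G1 * (size G2 * 40 + 40) + 35) (I := fun k s' =>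
  (forall i, marked s' i -> reachable i) /\
  forall p, path product_rel u0 p -> size p <= k -> marked s' (last u0 p))).
- by [].
- rewrite /marked; split=> [i /=|p hp hs] /=.
    by case: eqP => [->|_]; [exists [::] | rewrite hM].
  by case: p hp hs => //= _ _; rewrite eqxx.
- move=> k s1 hk [Sd Cp] sm1; steps_tac.
  have L1 := sm1.2 aLAB isT; have S1 := sm1.2 aSRC isT; have D1 := sm1.2 aDST isT.
  have E1 := sm1.1 vE0 isT; have K1 := sm1.1 vK isT.
  rewrite /= in L1 S1 D1 E1 K1.
  apply: (run_for (l := G1) (B := size G2 * 40 + 35) (I := fun l s' =>
    vars s' vJ = size l /\ relaxed s1 s' [seq (a, a') | a <- l, a' <- G2])).
  + by rewrite /= E1.
  + by split=> //; split.
  + move=> l1 a l2 s2 El [J2 Rx] sm2.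
    have L2 := sm2.2 aLAB isT; have S2 := sm2.2 aSRC isT; have D2 := sm2.2 aDST isT.
    have E2 := sm2.1 vE0 isT; have K2 := sm2.1 vK isT.
    rewrite /= ?L1 ?S1 ?D1 ?E1 ?K1 in L2 S2 D2 E2 K2.
    have aG : a \in G1 by rewrite El mem_cat inE eqxx orbT.
    have get f (g : arc -> nat) : seg f 0 (map g (G1 ++ G2)) -> f (size l1) = g a.
      by rewrite El -catA map_cat seg_cat /= size_map => -[_ /seg_cons []].
    steps_tac; rewrite /= J2 L2 S2 D2 (get _ _ hL) (get _ _ hS) (get _ _ hD).
    apply: (run_for (l := G2) (B := 30) (I := fun l s' =>
      vars s' vJ2 = size G1 + size l /\
      relaxed s1 s' ([seq (a, a') | a <- l1, a' <- G2] ++ map (pair a) l))).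
    * by rewrite /= K2.
    * rewrite /= E2 hE0 addn0 cats0; split=> //.
    * move=> l3 a' l4 s3 El2 [J3 Rx3] sm3.
      have L3 := sm3.2 aLAB isT; have S3 := sm3.2 aSRC isT; have D3 := sm3.2 aDST isT.
      rewrite /= ?L2 ?S2 ?D2 in L3 S3 D3.
      have VL := sm3.1 vL1 isT; have VI := sm3.1 vI1 isT; have VU := sm3.1 vU isT.
      rewrite /= in VL VI VU.
      have aG2 : a' \in G2 by rewrite El2 mem_cat inE eqxx orbT.
      have get2 f (g : arc -> nat) : seg f 0 (map g (G1 ++ G2)) ->
          f (size G1 + size l3) = g a'.
        rewrite El2 !map_cat !seg_cat /= !size_map add0n.
        by move=> [_ [_ /seg_cons []]].
      have [b1 b2] := arcsN aG aG2; case: (Rx3) => R1 R2 R3.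
      have skip s4 : arr s4 aMARK = arr s3 aMARK ->
          (lab a = lab a' -> marked s1 (src a + src a') ->
             marked s3 (dst a + dst a')) ->
          relaxed s1 s4 ([seq (a, a') | a <- l1, a' <- G2] ++
            map (pair a) (rcons l3 a')).
        rewrite /relaxed /marked => -> h; split=> // p.
        rewrite map_rcons -cats1 catA mem_cat inE => /orP [|/eqP ->] //.
        exact: R3.
      steps_tac; rewrite /= J3 L3 (get2 _ _ hL) VL.
      apply: run_if => /= c1.
        apply: run_skip; steps_tac; rewrite /= J3; split; first lia.
        split; first by rewrite size_rcons; lia.
        by apply: skip => // e; rewrite e subnn in c1.
      apply: run_if => /= c2.
        apply: run_skip; steps_tac; rewrite /= J3; split; first lia.
        split; first by rewrite size_rcons; lia.
        by apply: skip => // e; rewrite e subnn in c2.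
      have eL : lab a = lab a' by lia.
      steps_tac; rewrite /= J3 S3 (get2 _ _ hS); apply: run_add; rewrite /= VI.
        by lia.
      steps_tac; apply: run_if => /= c3; last first.
        steps_tac; rewrite /= J3; split; first lia.
        split; first by rewrite size_rcons; lia.
        by apply: skip => // _ /R2; rewrite /marked c3.
      steps_tac; rewrite /= J3 D3 (get2 _ _ hD); apply: run_add; rewrite /= VU.
        by lia.
      steps_tac; rewrite /= J3; split; first lia.
      split; first by rewrite size_rcons; lia.
      have R1' := reachable_step aG aG2 eL (R1 _ c3).
      rewrite /relaxed /marked /=; split=> [i|i|p].
      -- by case: eqP => [->|_] //; apply: R1.
      -- by case: eqP => // _; apply: R2.
      -- rewrite map_rcons -cats1 catA mem_cat inE => /orP [|/eqP ->].
           by move=> hp e1 e2; case: eqP => // _; apply: R3.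
         by rewrite eqxx.
    * move=> k4 s4 hk4 [_ Rx4] sm4; steps_tac; rewrite /= (sm4.1 vJ isT) /= J2.
      split; first by move: hk4; rewrite /=; lia.
      rewrite size_rcons addn1; split=> //.
      apply: relaxed_sub Rx4 => p /allpairsP [q [h1 h2 ->]].
      rewrite mem_cat; move: h1; rewrite mem_rcons inE => /orP [/eqP ->|h1].
        by apply/orP; right; apply: map_f.
      by apply/orP; left; apply/allpairsP; exists q.
  + move=> k2 s2 hk2 [_ [R1 R2 R3]] _; split; first by move: hk2; rewrite /=; lia.
    split=> //; elim/last_ind => [|p v _] hp; first by move=> _; apply/R2/Cp.
    rewrite size_rcons ltnS => hs; rewrite last_rcons.
    move: hp; rewrite rcons_path => /andP [hp /product_relP [a [a' [h1 h2 e e1 <-]]]].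
    apply: (R3 (a, a')) => //; first by apply/allpairsP; exists (a, a').
    by rewrite /= e1; apply: Cp.
- move=> k1 s1 hk1 [Sd Cp] _; steps_tac; rewrite /=; split.
    by move: hk1; rewrite /=; nia.
  split; first exact: Sd.
  move=> [p hp e0]; move: hp e0.
  case/shortenP => p' hp' up' _ e0; rewrite -/(marked s1 0) -e0; apply: Cp => //.
  (* Every node of the path after [u0] is the target of a product arc and thus below [N]. *)
  have sub : {subset u0 :: p' <= iota 0 N}.
    move=> v; rewrite mem_iota inE => /orP [/eqP ->|hv] //.
    case/splitPr: hv hp' => p1 p2; rewrite cat_path /= => /and3P [_ h _].
    case/product_relP: h => a [a' [h1 h2 _ _ <-]].
    by case: (arcsN h1 h2).
  by have := uniq_leq_size up' sub; rewrite size_iota /=; apply: ltnW.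
Qed.

End Search.

(** * Languages and the product graph *)

Section Steps.
Variables (m : nat) (A : stopwatch_automaton m).
Implicit Types (n : node A) (xi : assignment A).

(** The arcs without their numerical coding: [None] is the sink, and the labels are those of
    [state_arcs]. *)
Inductive arc_step : nat -> option (node A) -> option (node A) -> Prop :=
  | step_idle n : arc_step 0 (Some n) (Some n)
  | step_silent n n' :
      n.1 != accept A -> edge 0 n n' -> arc_step 0 (Some n) (Some n')
  | step_accept n : n.1 = accept A -> arc_step 1 (Some n) None
  | step_tick n :
      n.1 != accept A ->
      arc_step (lambda A n.1).+2 (Some n) (Some (n.1, elapse n.1 1 n.2)).

Definition node_rank (o : option (node A)) : nat :=
  if o is Some n then (n.1 + nQ A * rank n.2 1 (enum 'I_(nX A))).+1 else 0.

Lemma node_rank_lt o : node_rank o < node_count A.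
Proof.
case: o => [[q xi]|] //=; rewrite /node_count ltnS.
by have := rank_lt_bound xi; have := ltn_ord q; nia.
Qed.

(** The state is the remainder modulo [nQ A], and the quotient determines the assignment by
    [rankK]. *)
Lemma node_rank_inj : injective node_rank.
Proof.
case=> [[q xi]|] [[q' xi']|] //= [E].
have hq := ltn_ord q; have hq' := ltn_ord q'.
have Em : q = q' :> nat.
  have modq (p : 'I_(nQ A)) r : (p + nQ A * r) %% nQ A = p.
    by rewrite addnC mulnC modnMDl modn_small.
  by have := congr1 (modn^~ (nQ A)) E; rewrite /= !modq.
have Er : rank xi 1 (enum 'I_(nX A)) = rank xi' 1 (enum 'I_(nX A)).
  move: E; rewrite Em => /addnI /eqP; rewrite eqn_mul2l.
  by case: eqP => [|_ /eqP //]; lia.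
by rewrite (ord_inj Em) -(rankK xi) Er rankK.
Qed.

(** Transitions carry no equality structure, so membership in [Delta] is [List.In], whereas arcs are
    compared by boolean membership. *)
Lemma mem_flatten_In (T : Type) (f : T -> seq arc) l a :
  a \in flatten (map f l) <-> exists d, List.In d l /\ a \in f d.
Proof.
elim: l => [|d l IH] /=; first by split=> // -[d []].
rewrite mem_cat; split=> [/orP [h|/IH [e [h1 h2]]]|[e [[<- h|h1 h2]]]].
- by exists d; split; [left|].
- by exists e; split; [right|].
- by rewrite h.
- by apply/orP; right; apply/IH; exists e.
Qed.

Lemma edge0 n n' : edge 0 n n' -> exists d xi,
  [/\ List.In d (Delta A), satisfies xi (guard d), n = (source d, xi) &
     n' = (target d, act (action d) xi)].
Proof.
move=> h; have E t : edge t n n' -> t = 0 -> exists d xi,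
  [/\ List.In d (Delta A), satisfies xi (guard d), n = (source d, xi) &
     n' = (target d, act (action d) xi)]; last exact: E h _.
by case=> [d xi h1 h2 _|[] //]; exists d, xi.
Qed.

(** For the direction from right to left, the assignment of a node is recovered from its rank, so
    its block of arcs occurs in the enumeration. *)
Lemma arcsP str a :
  a \in arcs A str <->
  exists o o', [/\ arc_step (lab a) o o', src a = str * node_rank o &
                   dst a = str * node_rank o'].
Proof.
have id (q : 'I_(nQ A)) xi : node_id str q xi = str * node_rank (Some (q, xi)).
  exact: node_idE.
split.
- move=> /flattenP [l /mapP [e _ ->]]; rewrite mem_cat => /orP [].
  + move=> /flattenP [l' /mapP [q _ ->]]; rewrite !inE => /orP [/eqP ->|].
      exists (Some (q, unrank A e)), (Some (q, unrank A e)).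
      by rewrite /src /dst /= !id; split=> //; apply: step_idle.
    case: (q =P accept A) => h /eqP -> /=; rewrite /src /dst /=.
      exists (Some (q, unrank A e)), None; rewrite !id muln0; split=> //.
      exact: step_accept.
    exists (Some (q, unrank A e)), (Some (q, elapse q 1 (unrank A e))).
    rewrite !id; split=> //; apply: (@step_tick (q, unrank A e)); exact/eqP.
  + move=> /mem_flatten_In [d [hd]]; rewrite /transition_arcs.
    case: ifP => // /andP [h1 /eqP h2]; rewrite inE => /eqP ->.
    exists (Some (source d, unrank A e)),
      (Some (target d, act (action d) (unrank A e))).
    rewrite /src /dst /= !id; split=> //; apply: step_silent => //.
    exact: edge_transition.
- case: a => -[l s] d [o [o' []]]; rewrite /lab /src /dst /= => hs.
  have key n : flatten [seq state_arcs str n.2 q | q <- enum 'I_(nQ A)]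
      ++ flatten [seq transition_arcs str n.2 d | d <- Delta A] \in
      [seq assignment_arcs str (unrank A e) | e <- iota 0 (bound A)].
    apply/mapP; exists (rank n.2 1 (enum 'I_(nX A))).
      by rewrite mem_iota rank_lt_bound.
    by rewrite rankK.
  have st n a : a \in state_arcs str n.2 n.1 -> a \in arcs A str.
    move=> h; apply/flattenP; eexists; first exact: (key n).
    rewrite mem_cat; apply/orP; left; apply/flattenP.
    by eexists; last exact: h; apply/mapP; exists n.1; rewrite ?mem_enum.
  case: hs => [[q xi]|n n' h1 h2|[q xi] h|[q xi] h] -> ->; try rewrite /= in h.
  + by apply: (st (q, xi)); rewrite !inE -!id eqxx.
  + have [d' [xi [hd hs E1 E2]]] := edge0 h2.
    apply/flattenP; eexists; first exact: (key n).
    rewrite mem_cat; apply/orP; right; apply/mem_flatten_In; exists d'; split=> //.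
    rewrite /transition_arcs -!id; rewrite E1 /= in h1 *.
    by rewrite h1 hs eqxx inE !id E2.
  + by apply: (st (q, xi)); rewrite -!id !inE /= ?muln0 h !eqxx ?orbT.
  + by apply: (st (q, xi)); rewrite -!id !inE /= (negbTE h) !eqxx ?orbT.
Qed.

Lemma elapse0 q xi : elapse q 0 xi = xi.
Proof.
apply/ffunP => x; rewrite ffunE; case: ifP => // _; apply: ord_inj => /=.
by have := ltn_ord (xi x); lia.
Qed.

(** Clipping at [beta] before waiting on does not change the clipped result; this is why long waits
    split into unit ones. *)
Lemma elapseS q t xi : elapse q t.+1 xi = elapse q t (elapse q 1 xi).
Proof.
apply/ffunP => x; rewrite !ffunE; case: ifP => // _; apply: ord_inj => /=.
by lia.
Qed.

(** Serves the passage from computations to the product graph; on the way back [arc_stepP] yields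
    computations directly. *)
Inductive unit_computation : node A -> seq 'I_m.+1 -> node A -> Prop :=
  | unit_nil n : unit_computation n [::] n
  | unit_silent n n' f w :
      n.1 != accept A -> edge 0 n n' -> unit_computation n' w f ->
      unit_computation n w f
  | unit_tick n f w :
      n.1 != accept A -> unit_computation (n.1, elapse n.1 1 n.2) w f ->
      unit_computation n (lambda A n.1 :: w) f.

Lemma unit_ticks q xi t w f :
  q != accept A -> unit_computation (q, elapse q t xi) w f ->
  unit_computation (q, xi) (nseq t (lambda A q) ++ w) f.
Proof.
move=> hq; elim: t xi => [|t IH] xi; first by rewrite elapse0.
by rewrite elapseS => h; apply: (@unit_tick (q, xi)); rewrite //=; apply: IH.
Qed.

Lemma computation_unit n w f : computation n w f -> unit_computation n w f.
Proof.
elim=> {n w f} [n|n n' f t w hn he _ IH]; first exact: unit_nil.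
have E t' : edge t' n n' -> t' = t ->
    unit_computation n (nseq t (lambda A n.1) ++ w) f; last exact: (E t).
move=> h; case: h hn IH he => [d xi hd hs|t0 q xi ht] hn IH he et.
- by rewrite -et in he *; apply: unit_silent hn he IH.
- by rewrite -et; apply: unit_ticks.
Qed.

(** Inversion by label, in the form that the induction on [meets] consumes: how a computation from
    the head of an arc extends to its tail. *)
Lemma arc_stepP l n o : arc_step l (Some n) o ->
  match l with
  | 0 => exists2 n1, o = Some n1 &
           forall w f, computation n1 w f -> computation n w f
  | 1 => n.1 = accept A
  | k.+2 => k = lambda A n.1 /\ exists2 n1, o = Some n1 &
           forall w f, computation n1 w f -> computation n (lambda A n.1 :: w) f
  end.
Proof.
move E : (Some n) => p h; case: h E => {l p o} [n0|n0 n1 hn he|n0 hn|n0 hn] [->] //.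
- by exists n0.
- by exists n1 => // w f; apply: computation_step hn he.
- split=> //; exists (n0.1, elapse n0.1 1 n0.2) => // w f h.
  apply: (computation_step (t := 1) hn _ h).
  by case: n0 {hn h} => q xi; apply: edge_elapse.
Qed.

End Steps.

Section Product.
Variables (m : nat) (A A' : stopwatch_automaton m).

(** Reachability of the pair of sinks in the product graph, freed from numbers. *)
Inductive meets : option (node A) -> option (node A') -> Prop :=
  | meets_sink : meets None None
  | meets_step l o o' p p' :
      arc_step l o p -> arc_step l o' p' -> meets p p' -> meets o o'.

(** The letters of the two computations agree, but their silent steps interleave arbitrarily.
    Induction on the first computation; when it has ended or is about to read a letter, an inner
    induction lets it idle while the second one makes its silent steps. *)
Lemma unit_meets n w f n' f' :
  unit_computation n w f -> f.1 = accept A ->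
  unit_computation n' w f' -> f'.1 = accept A' -> meets (Some n) (Some n').
Proof.
move=> h hf h' hf'; move: h n' f' h' hf' hf; elim
  => {n w f} [n|n n1 f w hn he _ IH|n f w hn h IH] n' f' h' hf' hf.
- move: h'; move Ew : [::] => w h'; elim: h' Ew hf' => {n' w f'}
    [n'|n' n1 f' w hn he _ IH|//] Ew hf'.
  + apply: (meets_step (step_accept hf) (step_accept hf')); exact: meets_sink.
  + by apply: (meets_step (step_idle n) (step_silent hn he)); apply: IH.
- by apply: (meets_step (step_silent hn he) (step_idle n')); apply: IH h' hf' hf.
- move: h'; move Ew : (_ :: w) => w' h'; elim: h' Ew hf' => {n' w' f'}
    [//|n' n1 f' w' hn' he _ IH'|n' f' w' hn' h' _] Ew hf'.
  + by apply: (meets_step (step_idle n) (step_silent hn' he)); apply: IH'.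
  + case: Ew => El Ew; rewrite -Ew in h'.
    have := step_tick hn'; rewrite -El => st.
    by apply: (meets_step (step_tick hn) st); apply: IH h' hf' hf.
Qed.

(** Equal labels make both sides read the same word, and since the sinks are entered by label 1
    only, both accept at the same moment. *)
Lemma meetsP n n' :
  meets (Some n) (Some n') <->
  exists w, (exists2 f, computation n w f & f.1 = accept A) /\
            (exists2 f, computation n' w f & f.1 = accept A').
Proof.
split; last first.
  move=> [w [[f /computation_unit h hf] [f' /computation_unit h' hf']]].
  exact: unit_meets h hf h' hf'.
move E : (Some n) => o; move E' : (Some n') => o' h.
elim: h n n' E E' => {o o'} [//|l o o' p p' st st' hm IH] n n' E E'.
rewrite -{}E in st; rewrite -{}E' in st'.
have := arc_stepP st; have := arc_stepP st'; case: l {st st'} => [|[|l]].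
- move=> [n1' E1' h1'] [n1 E1 h1].
  have [w [[f hf af] [f' hf' af']]] := IH _ _ (esym E1) (esym E1').
  by exists w; split; [exists f; [apply: h1|] | exists f'; [apply: h1'|]].
- by move=> h' h; exists [::]; split; [exists n | exists n'] => //;
    apply: computation_nil.
- move=> [l' [n1' E1' h1']] [l1 [n1 E1 h1]].
  have [w [[f hf af] [f' hf' af']]] := IH _ _ (esym E1) (esym E1').
  have El : lambda A n.1 = lambda A' n'.1 by apply: ord_inj; rewrite -l' -l1.
  exists (lambda A n.1 :: w); split; first by exists f; [apply: h1|].
  by exists f' => //; rewrite El; apply: h1'.
Qed.

Let V := node_count A.

(** The factors 1 and [V] are the scales of the two automata; the 1 is kept so that the summands
    match those of [arcsP]. *)
Definition pair_rank (o : option (node A)) (o' : option (node A')) : nat :=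
  1 * node_rank o + V * node_rank o'.

Lemma pair_rank_inj o o' p p' :
  pair_rank o o' = pair_rank p p' -> o = p /\ o' = p'.
Proof.
have ho := node_rank_lt o; have hp := node_rank_lt p; rewrite /pair_rank !mul1n => E.
have modV (r s : nat) : r < V -> (r + V * s) %% V = r.
  by move=> h; rewrite addnC mulnC modnMDl modn_small.
have Er : node_rank o = node_rank p.
  by have := congr1 (modn^~ V) E; rewrite /= !modV.
split; first exact: node_rank_inj.
apply: node_rank_inj; move: E; rewrite Er => /addnI /eqP.
by rewrite eqn_mul2l => /eqP.
Qed.

(** Since [pair_rank] is injective, a product arc leaving the number of a pair really leaves that
    pair of nodes, and 0 is the number of the two sinks only. *)
Lemma reachable_meets o o' :
  reachable (arcs A 1) (arcs A' V) (pair_rank o o') 0 <-> meets o o'.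
Proof.
split=> [[p]|].
- elim: p o o' => [|v p IH] o o' /=.
    move=> _ h; have [-> ->] : o = None /\ o' = None; last exact: meets_sink.
    by apply: pair_rank_inj; rewrite h /pair_rank /= !muln0.
  move=> /andP [/product_relP [a [a' [ha ha' el es ed]]] hp] hl.
  have [o1 [p1 [st1 s1 d1]]] := (arcsP _ _ _).1 ha.
  have [o2 [p2 [st2 s2 d2]]] := (arcsP _ _ _).1 ha'.
  have [e1 e2] : o1 = o /\ o2 = o'.
    by apply: pair_rank_inj; rewrite /pair_rank -s1 -s2.
  subst o1 o2; rewrite -el in st2; apply: (meets_step st1 st2).
  by apply: IH => //; rewrite /pair_rank -d1 -d2 ed.
- elim=> {o o'} [|l o o' p p' st st' _ [q hq eq0]].
    by exists [::] => //; rewrite /pair_rank /= !muln0.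
  exists (pair_rank p p' :: q) => //=; rewrite hq andbT.
  apply/product_relP.
  exists (l, 1 * node_rank o, 1 * node_rank p), (l, V * node_rank o', V * node_rank p').
  by split=> //; apply/arcsP; [exists o, p | exists o', p'].
Qed.

Lemma reachable_language :
  reachable (arcs A 1) (arcs A' V)
    (node_id 1 (start A) (zero_assignment A)
     + node_id V (start A') (zero_assignment A')) 0 <->
  exists w, language A w /\ language A' w.
Proof.
rewrite !node_idE.
exact: iff_trans (reachable_meets (Some (start A, zero_assignment A))
  (Some (start A', zero_assignment A'))) (meetsP _ _).
Qed.

Lemma arcs_bound a a' :
  a \in arcs A 1 -> a' \in arcs A' V ->
  src a + src a' < V * node_count A' /\ dst a + dst a' < V * node_count A'.
Proof.
move=> /arcsP [o1 [p1 [_ -> ->]]] /arcsP [o2 [p2 [_ -> ->]]].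
have := node_rank_lt o1; have := node_rank_lt p1; have := node_rank_lt o2.
by have := node_rank_lt p2; rewrite -/V !mul1n => *; split; nia.
Qed.

End Product.

(** * The decision procedure *)

(** [vE0] records where the arcs of the second graph begin, and [vS0] saves the initial node of the
    first before [vS1] is overwritten. *)
Definition main_cmd : cmd :=
  decode ;; Mov vSTR 1 ;; graph_cmd ;; Mov vE0 vE ;; Mov vS0 vS1 ;;
  graph_cmd ;; search_cmd.

(** * Sizes and running times in terms of encoding length and bound *)

Section Bounds.
Variables (m : nat) (A : stopwatch_automaton m).

Notation L := (encoding_length A).

Lemma size_nat_code n : size (nat_code n) = 2 * bitlen n + 1.
Proof.
rewrite /nat_code size_cat -[in RHS](size_bits (bitlen n) n); congr (_ + _).
by elim: (bits _ _) => //= c s ->; lia.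
Qed.

Lemma size_le_flatten_code l : size l <= size (flatten (map nat_code l)).
Proof. by elim: l => // n l IH; rewrite /= size_cat size_nat_code; lia. Qed.

Lemma size_code_le : size (automaton_code A) <= L.
Proof. exact: size_le_flatten_code. Qed.

Lemma encoding_length_gt0 : 0 < L.
Proof. by apply: leq_trans size_code_le; rewrite size_code; lia. Qed.

Lemma nbits_le : nbits (beta A) <= L.
Proof.
have H l : sumn [seq bitlen n | n <- l] <= size (flatten (map nat_code l)).
  by elim: l => // n l IH; rewrite /= size_cat size_nat_code; lia.
have -> : nbits (beta A) =
    sumn [seq bitlen n | n <- [seq beta A x | x <- enum 'I_(nX A)]].
  by rewrite -map_comp.
apply: leq_trans (H _) _; rewrite /encoding_length /encode /automaton_code.
by rewrite !map_cat !flatten_cat !size_cat; lia.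
Qed.

Lemma size_Delta_le : size (Delta A) <= size (transitions_code (Delta A)).
Proof.
elim: (Delta A) => // d l IH; have h : 0 < size (transition_code d) by [].
have -> : size (transitions_code (d :: l)) =
  size (transition_code d) + size (transitions_code l) by exact: size_cat.
exact: leq_add h IH.
Qed.

(** An assignment yields two arcs per state and at most one per transition. *)
Lemma size_arcs str : size (arcs A str) <= 3 * (L * bound A).
Proof.
have hs := size_code A; have hc := size_code_le; have hD := size_Delta_le.
have H (xi : assignment A) : size (assignment_arcs str xi) <= 3 * L.
  rewrite size_cat; apply: (@leq_trans (2 * nQ A + size (Delta A))); last by lia.
  apply: leq_add.
    suff h l : size (flatten [seq state_arcs str xi q | q <- l]) = 2 * size l.
      by rewrite h size_enum_ord.
    by elim: l => //= q l ->; rewrite mulnS.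
  elim: (Delta A) => //= d l IH; rewrite size_cat -add1n leq_add //.
  by rewrite /transition_arcs; case: ifP.
have {H} : forall l, size (flatten [seq assignment_arcs str (unrank A e) | e <- l]) <=
    size l * (3 * L).
  by elim=> //= e l IH; rewrite size_cat; have := H (unrank A e); lia.
by move=> /(_ (iota 0 (bound A))); rewrite size_iota -/(arcs A str); lia.
Qed.

Lemma node_count_le : node_count A <= 2 * (L * bound A).
Proof.
have hs := size_code A; have hc := size_code_le; have b0 := bound_gt0 A.
have h : nQ A * bound A <= L * bound A by rewrite leq_mul2r; apply/orP; right; lia.
have : 0 < L * bound A by rewrite muln_gt0 encoding_length_gt0.
by rewrite /node_count; lia.
Qed.

(** With [y = L * bound A], the work for one assignment is at most [1000 * (l * y)], and summing
    over [b] assignments gives [1000 * y ^ 2] because [b * l = y]. The remaining 200 covers what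
    lies outside that loop. *)
Lemma graph_time_le : graph_time A <= 1200 * (L * bound A) ^ 2.
Proof.
have hs := size_code A; have hc := size_code_le; have hD := size_Delta_le.
have hn := nbits_le; have b0 := bound_gt0 A; have L0 := encoding_length_gt0.
rewrite /graph_time /act_time /encode_time.
set q := nQ A in hs *; set x := nX A in hs *; set z := zeta_count A in hs *.
set t := size (transitions_code _) in hs hD *; set d := size (Delta A) in hD *.
set n := nbits _ in hn *; set b := bound A in b0 *; set l := L in hc hn L0 *.
have [hq hx hd ht hxz] : [/\ q <= l, x <= l, d <= l, t <= l & x + z <= l].
  by split; lia.
have [y Ey] : exists y, y = l * b by exists (l * b).
have ly : l <= y by rewrite Ey leq_pmulr.
have y1 : 0 < y by lia.
have hb2 : b.+1 <= 2 * b by lia.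
have xy : x * b.+1 <= 2 * y by have := leq_mul hx hb2; rewrite Ey; lia.
have ny : n * b.+1 <= 2 * y by have := leq_mul hn hb2; rewrite Ey; lia.
have lly : l <= l * y by rewrite leq_pmulr.
have yly : y <= l * y by rewrite leq_pmull.
rewrite -Ey.
have e1 : 12 * (q + x * b.+1).+1 <= 48 * y by lia.
have e2 : x * (n * b.+1).+1 <= 3 * (l * y).
  by apply: (@leq_trans (l * (3 * y))); [apply: leq_mul; lia | lia].
have e3 : q * (2 * (12 * (q + x * b.+1).+1) + 60 * (x + z) + 180) <= 336 * (l * y).
  by apply: (@leq_trans (l * (336 * y))); [apply: leq_mul; lia | lia].
have e4 : d * (2 * (12 * (q + x * b.+1).+1) + 60 * t + 40 * (x * b.+1).+1 + 60)
    <= 336 * (l * y).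
  by apply: (@leq_trans (l * (336 * y))); [apply: leq_mul; lia | lia].
have e5 : b * (1000 * (l * y)) = 1000 * y ^ 2 by rewrite Ey; lia.
have e6 : y <= y ^ 2 by rewrite -mulnn leq_pmulr.
set u := (X in b * X); have : u <= 1000 * (l * y) by rewrite /u; lia.
move=> hu; have := leq_mul (leqnn b) hu; rewrite e5; lia.
Qed.

End Bounds.

Section Main.
Variables (m : nat) (A A' : stopwatch_automaton m).

Let size0 := encoding_length A * encoding_length A' * bound A * bound A'.
Let input0 := encode A ++ encode A'.
(* Exponential, so that decoding large letters is cheap, yet of linear length,
   so that an instruction has logarithmic cost O(size0). *)
Let K := 2 ^ (2 * size0 + 4).

Lemma size0_facts :
  [/\ 0 < size0, encoding_length A * bound A <= size0,
      encoding_length A' * bound A' <= size0 &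
      encoding_length A + encoding_length A' <= 2 * size0].
Proof.
have L0 := encoding_length_gt0 A; have L0' := encoding_length_gt0 A'.
have b0 := bound_gt0 A; have b0' := bound_gt0 A'.
have E : size0 = encoding_length A * bound A * (encoding_length A' * bound A').
  by rewrite /size0; lia.
set y := encoding_length A * bound A in E *.
set y' := encoding_length A' * bound A' in E *.
have y0 : 0 < y by rewrite muln_gt0 L0.
have y0' : 0 < y' by rewrite muln_gt0 L0'.
have h : encoding_length A <= y by rewrite leq_pmulr.
have h' : encoding_length A' <= y' by rewrite leq_pmulr.
have hy : y <= size0 by rewrite E leq_pmulr.
have hy' : y' <= size0 by rewrite E leq_pmull.
by split=> //; [rewrite E muln_gt0 y0 | lia].
Qed.

Lemma main_spec :
  spec K main_cmd (init_store input0) (5000 * size0 ^ 2)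
    (fun s => 0 < vars s vRES <-> exists w, language A w /\ language A' w).
Proof.
have [z0 zA zA' zL] := size0_facts.
have Ew : input0 = flatten (map nat_code (automaton_code A ++ automaton_code A')).
  by rewrite map_cat flatten_cat.
have sw : size input0 <= 2 * size0 by rewrite size_cat.
have zK : 16 * size0 <= K.
  rewrite /K addnC expnD leq_mul2l /= ltnW //.
  by apply: leq_trans (ltn_expl size0 (ltnSn 1)) _; rewrite leq_exp2l //; lia.
have wK : 2 ^ size input0 <= K by rewrite leq_exp2l //; lia.
have c1 := size_code_le A; have c2 := size_code_le A'.
have v1 := node_count_le A; have v2 := node_count_le A'.
have V1K : 4 * (1 * node_count A) <= K by lia.
have Vgt : 0 < node_count A by [].
(* This is both the range of the pair identifiers and the number of search rounds. *)
have VV : node_count A * node_count A' <= 4 * size0.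
  by have := leq_mul v1 v2; rewrite /size0; lia.
have V2K : 4 * (node_count A * node_count A') <= K by lia.
rewrite /main_cmd; step; step.
apply: run_spec; first by rewrite Ew; apply: decode_spec; rewrite -Ew.
rewrite -Ew => k1 s1 hk1 /seg_cat [C1 C2] sm1.
have P1 := sm1.1 vP isT; have E1 := sm1.1 vE isT; have M1 := sm1.2 aMARK isT.
rewrite /= in P1 E1 M1.
have {}C1 : seg (arr s1 aCODE) (vars s1 vP) (automaton_code A) by rewrite P1.
have K1 : vars s1 vP + size (automaton_code A) <= K by rewrite P1; lia.
have st1 : stored s1 [::] by split.
steps_tac; apply: run_spec; first by
  apply: (graph_spec (str := 1) isT V1K (l0 := [::]));
    [exact: C1 | exact: K1 | | exact: st1].
move=> k2 s2 hk2 [st2 P2 V2 S2] sm2; rewrite mul1n in V2.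
have M2 := sm2.2 aMARK isT; have C22 := sm2.2 aCODE isT.
have {}P2 : vars s2 vP = size (automaton_code A) by rewrite P2 [vars _ _]P1.
rewrite /= in M2 C22.
have {}C2 : seg (arr s2 aCODE) (vars s2 vP) (automaton_code A') by rewrite C22 P2.
have K2 : vars s2 vP + size (automaton_code A') <= K by rewrite P2; lia.
steps_tac; apply: run_spec; first by
  apply: (graph_spec Vgt V2K (l0 := arcs A 1));
    [exact: C2 | exact: K2 | exact: V2 | exact: st2].
move=> k3 s3 hk3 [st3 P3 V3 S3] sm3.
have M3 := sm3.2 aMARK isT; have E3 := sm3.1 vE0 isT; have S03 := sm3.1 vS0 isT.
rewrite /= in M3 E3 S03; case: (st2) => _ _ _ F2.
apply: run_spec.
  apply: (search_spec (G1 := arcs A 1) (G2 := arcs A' (node_count A))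
    (N := node_count A * node_count A')
    (u0 := node_id 1 (start A) (zero_assignment A) +
       node_id (node_count A) (start A') (zero_assignment A')) (K := K)) => //.
  - by lia.
  - have r1 := node_rank_lt (Some (start A, zero_assignment A)).
    have r2 := node_rank_lt (Some (start A', zero_assignment A')).
    rewrite !node_idE mul1n; rewrite /= in r1 r2.
    apply: (leq_trans (n := node_count A * (start A' + nQ A' *
      rank (zero_assignment A') 1 (enum 'I_(nX A'))).+2)).
      by rewrite [in X in _ <= X]mulnS ltn_add2r.
    by rewrite leq_mul2l r2 orbT.
  - exact: arcs_bound.
  - by rewrite E3 F2.
  - by rewrite S03 S2 S3.
  - by move=> i; rewrite M3 M2 M1.
move=> k4 s4 hk4 R4 _; split; last first.
  exact: iff_trans R4 (reachable_language A A').
have e1 := size_arcs A 1; have e2 := size_arcs A' (node_count A).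
have g1 : graph_time A <= 1200 * size0 ^ 2.
  by apply: leq_trans (graph_time_le A) _; rewrite leq_mul2l leq_exp2r.
have g2 : graph_time A' <= 1200 * size0 ^ 2.
  by apply: leq_trans (graph_time_le A') _; rewrite leq_mul2l leq_exp2r.
have zz : size0 <= size0 ^ 2 by rewrite -mulnn leq_pmulr.
(* By [size_arcs] the factor is 3 times 3 * 40 + 40 = 160. A round then costs at most [520 * size0],
   and the [4 * size0] rounds give the 2080 below. *)
have h4 : size (arcs A 1) * (size (arcs A' (node_count A)) * 40 + 40) <=
    480 * size0.
  apply: (@leq_trans (3 * (encoding_length A * bound A) *
                      (160 * (encoding_length A' * bound A')))).
    apply: leq_mul => //.
    have : 0 < encoding_length A' * bound A'.
      by rewrite muln_gt0 encoding_length_gt0 bound_gt0.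
    by lia.
  by rewrite /size0; lia.
have h5 : node_count A * node_count A' *
    (size (arcs A 1) * (size (arcs A' (node_count A)) * 40 + 40) + 40) <=
    2080 * size0 ^ 2.
  apply: (@leq_trans (4 * size0 * (520 * size0))); last by rewrite -mulnn; lia.
  by apply: leq_mul => //; lia.
(* The two graphs take 1200 each and the search 2080; decoding, which is linear, fits into the rest
   of 5000. *)
by rewrite /=; lia.
Qed.

(** The constant [c] stays a variable, so that [2 ^ c] is never formed with a large numeral as
    exponent. *)
Lemma main_halts c : 504 + 16 * 5000 <= c ->
  exists2 t, halts (link main_cmd) input0
      (0 < vars (sem main_cmd (init_store input0)) vRES) t &
    t <= (5000 + 4) * (40 * (c + 3)) * size0 ^ 3.
Proof.
move=> hc; have [t ht le] := link_halts main_cmd K input0; exists t => //.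
have [hT _] := main_spec; have [z0 _ _ zL] := size0_facts.
have sw : size input0 <= 2 * size0 by rewrite size_cat.
apply: (leq_trans le); set T := cost K _ _ in hT *.
have lg : loglen (200 + 16 * (K + size input0 + 1 + T)) <= (2 * size0 + c).+1.
  rewrite -[X in _ <= X.+1](@trunc_expnK 2) // ltnS; apply: leq_trunc_log.
  have zP : size0 < 2 ^ size0 by apply: ltn_expl.
  have EP : 2 ^ (2 * size0) = 2 ^ size0 * 2 ^ size0 by rewrite -expnD addnn mul2n.
  have zzP : size0 ^ 2 <= 2 ^ (2 * size0).
    by rewrite EP -mulnn leq_mul // ltnW.
  have z1P : size0 <= 2 ^ (2 * size0).
    by apply: leq_trans zzP; rewrite -mulnn leq_pmulr.
  rewrite /K (expnD 2 _ 4) (expnD 2 _ c).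
  have cP : c <= 2 ^ c by rewrite ltnW // ltn_expl.
  (* 504 = 256 + 32 + 216 collects 16 times the threshold, 16 times the input length, and the
     constants; 16 * 5000 comes from the total charge. *)
  apply: (@leq_trans (2 ^ (2 * size0) * (504 + 16 * 5000))); last first.
    by rewrite leq_mul2l (leq_trans hc cP) orbT.
  by move: (2 ^ (2 * size0)) zzP z1P => Q zzP z1P; rewrite -[2 ^ 4]/16; lia.
have z2 : size0 <= size0 ^ 2 by rewrite -mulnn leq_pmulr.
have h1 : size input0 + T + 2 <= (5000 + 4) * size0 ^ 2 by lia.
have h2 : 40 * loglen (200 + 16 * (K + size input0 + 1 + T)) <=
    40 * (c + 3) * size0.
  have : c.+1 <= c.+1 * size0 by rewrite leq_pmulr.
  by have := leq_mul (leqnn 40) lg; lia.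
by apply: leq_trans (leq_mul h1 h2) _; rewrite mulnACA -expnSr.
Qed.

End Main.

Theorem mainTheorem6 :
  exists (P : program) (c : nat),
    forall (m : nat) (A A' : stopwatch_automaton m),
    exists (b : bool) (t : nat),
      [/\ halts P (encode A ++ encode A') b t,
          b <-> (exists w : seq 'I_m.+1, language A w /\ language A' w)
        & t <= c * (encoding_length A * encoding_length A'
                    * bound A * bound A') ^ 3].
Proof.
exists (link main_cmd), ((5000 + 4) * (40 * (504 + 16 * 5000 + 3))) => m A A'.
have [t ht le] := main_halts A A' (leqnn _).
exists (0 < vars (sem main_cmd (init_store (encode A ++ encode A'))) vRES), t.
by split=> //; case: (main_spec A A').
Qed.
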